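(* For every prime $p$, let $\mathcal{A}=\mathcal{A}(p)$ and $\mathcal{B}=\mathcal{B}(p)$ be subsets of $\mathbb{F}_p$. Suppose there exist an even positive integer $m$ and real constants $\ell,\gamma>0$, all independent of $p$, such that the following two conditions hold: (a) For every sufficiently large prime $p$, for every $a\in\mathcal{A}(p)$ and all $a_1,\ldots,a_{2m}\in\mathcal{A}(p)\setminus\{a\}$, $$\sum_{j=1}^m\frac{1}{a-a_j}=\sum_{j=m+1}^{2m}\frac{1}{a-a_j}\quad\text{(in the field }\mathbb{F}_p)$$ only if $(a_1,\ldots,a_m)$ and $(a_{m+1},\ldots,a_{2m})$ are permutations of each other. (b) For every $\eta>0$ there exists $P=P(\eta)$ such that for every prime $p\geq P$, every subset $S\subseteq\mathcal{B}(p)$ with $|S|\geq p^\ell$ satisfies $E(S,S)\leq p^{-\gamma+\eta}|S|^3$. Let $\alpha$ be such that, for some $\epsilon'>0$ and every sufficiently large $p$, $$\Omega(p^\alpha)\leq|\mathcal{A}(p)|\leq p^\alpha,\qquad |\mathcal{B}(p)|\geq\Omega(p^{1-\alpha+\epsilon'}).$$ Let $c_0=1/10430$, and let $\epsilon_1>0$ be such that there exist $\alpha_1,\alpha_2,\epsilon,x,y>0$ satisfying all of the following: \begin{align*} \epsilon_1+\epsilon&<\alpha_1-\alpha-(4/3)x-\epsilon,\\ \ell&\leq 1/2+(4/3)x-\alpha_1+\epsilon/2,\\ \epsilon_1+\epsilon&<\gamma/4-y/4-\epsilon,\\ \alpha_2&\geq 9x+\epsilon,\\ c_0y/8-(\alpha_1/4+9\alpha_2/8)/m&\leq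 x/8-\alpha/4,\\ \epsilon_1+\epsilon&<c_0y/8-(\alpha_1/4+9\alpha_2/8)/m,\\ my&\leq\min\{1/2-\alpha_1,\,1/2-\alpha_2\},\\ 3\alpha_2-2\alpha_1&\leq(2-c_0)my. \end{align*} Then for any $\epsilon''>0$ and any $0<\delta<\sqrt{2}-1$, for all sufficiently large primes $p$, the $p\times|\mathcal{A}(p)||\mathcal{B}(p)|$ matrix with columns $$u_{a,b}:=\frac{1}{\sqrt{p}}\Big(e^{2\pi i(at^2+bt)/p}\Big)_{t\in\mathbb{F}_p},\qquad a\in\mathcal{A}(p),\ b\in\mathcal{B}(p),$$ satisfies the $(p^{1/2+\epsilon_1/2-\epsilon''},\delta)$-restricted isometry property. Consequently this family of matrices witnesses $\mathrm{ExRIP}[1/2+\epsilon_1/2]$.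
   Context: For finite subsets $A,B$ of an additive group, the additive energy is $E(A,B):=\#\{(a_1,a_2,b_1,b_2)\in A^2\times B^2: a_1+b_1=a_2+b_2\}$. A matrix $\Phi$ satisfies the $(K,\delta)$-restricted isometry property (RIP) if $(1-\delta)\|x\|^2\leq\|\Phi x\|^2\leq(1+\delta)\|x\|^2$ for every $K$-sparse vector $x$ (at most $K$ nonzero entries), with $\|\cdot\|$ the Euclidean norm. $\mathrm{ExRIP}[z]$ denotes the statement: there exists an explicit family of $M\times N$ matrices with arbitrarily large aspect ratio $N/M$ which are $(K,\delta)$-RIP with $K=\Omega(M^{z-\epsilon})$ for all $\epsilon>0$ and $\delta<\sqrt{2}-1$. $f\geq\Omega(g)$ (equivalently $\Omega(g)\leq f$) means there is a constant $c>0$ independent of $p$ with $f\geq cg$ for all sufficiently large $p$. $\mathbb{F}_p$ is the field with $p$ elements. *)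

(* Defs.v *)
(* MathComp / MathComp-Analysis, over an arbitrary [R : realType]; complex
   numbers are [R[i]] from mathcomp-real-closed. *)
From HB Require Import structures.
From mathcomp Require Import all_boot all_order all_algebra.
From mathcomp Require Import all_classical all_reals all_analysis.
From mathcomp Require Import complex.

Set Implicit Arguments.
Unset Strict Implicit.
Unset Printing Implicit Defensive.

Import Order.TTheory GRing.Theory Num.Theory.
Local Open Scope ring_scope.

Definition additive_energy (G : finZmodType) (A B : {set G}) : nat :=
  #|[set q : (G * G) * (G * G) |
      [&& q.1.1 \in A, q.1.2 \in A, q.2.1 \in B, q.2.2 \in B
        & q.1.1 + q.2.1 == q.1.2 + q.2.2]]|.

Definition l2norm (R : realType) (n : nat) (x : 'cV[R[i]]_n) : R :=
  Num.sqrt (\sum_(k < n) (ComplexField.Normc.normc (x k ord0)) ^+ 2).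

(* The sparsity level is a real number because it is used at values such as
   p ^ (1/2 + s). *)
Definition sparse (R : realType) (n : nat) (K : R) (x : 'cV[R[i]]_n) : Prop :=
  #|[set k : 'I_n | x k ord0 != 0]|%:R <= K.

Definition RIP (R : realType) (M N : nat) (K delta : R)
    (Phi : 'M[R[i]]_(M, N)) : Prop :=
  forall x : 'cV[R[i]]_N, sparse K x ->
    (1 - delta) * l2norm x ^+ 2 <= l2norm (Phi *m x) ^+ 2 /\
    l2norm (Phi *m x) ^+ 2 <= (1 + delta) * l2norm x ^+ 2.

(* The property that a family of M i x N i matrices has to satisfy in order to
   witness ExRIP[z].  The asymptotics are in M: aspect ratios N/M are unbounded
   along members with M arbitrarily large, and K = Omega(M^(z - eps)) as
   M -> oo.  The informal adjective "explicit" is not part of this predicate;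
   it refers to the family being given by a formula. *)
Definition witnesses_ExRIP (R : realType) (z : R) (I : Type) (M N : I -> nat)
    (Phi : forall i : I, 'M[R[i]]_(M i, N i)) : Prop :=
  (forall (rho : R) (M0 : nat), exists i : I,
      (M0 <= M i)%N /\ rho <= (N i)%:R / (M i)%:R) /\
  (forall delta : R, 0 < delta -> delta < Num.sqrt 2 - 1 ->
    exists K : I -> R,
      (forall eps : R, 0 < eps ->
        exists c : R, 0 < c /\
        exists M0 : nat, forall i : I, (M0 <= M i)%N ->
          c * (M i)%:R `^ (z - eps) <= K i) /\
      (forall i : I, RIP (K i) delta (Phi i))).

(* exp(2 pi i r / p), with r the representative of x in [0, p). *)
Definition addchar (R : realType) (p : nat) (x : 'F_p) : R[i] :=
  let theta : R := 2 * pi * (nat_of_ord x)%:R / p%:R in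
  Complex (cos theta) (sin theta).

(* Rows are indexed by t in {0, ..., p-1}, read in F_p; columns by the pairs
   (a, b) in A x B, in the order of [enum]; #|finset.setX A B| = #|A| * #|B| by
   [finset.cardsX]. *)
Definition chirp_matrix (R : realType) (p : nat) (A B : {set 'F_p}) :
    'M[R[i]]_(p, #|finset.setX A B|) :=
  \matrix_(t < p, j < #|finset.setX A B|)
    (let: (a, b) := enum_val j in
     real_complex R (Num.sqrt p%:R)^-1 *
     addchar R (a * (nat_of_ord t)%:R ^+ 2 + b * (nat_of_ord t)%:R)).

(* Main.v *)
(* For a1 <> a2, completing the square shows that the Gram entry of the columns
   (a1, b1) and (a2, b2) is a complex number of modulus p^(-1/2) depending only
   on a1 and a2, times e(-(b1 - b2)^2 / (4 (a1 - a2))); for a1 = a2 and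
   b1 <> b2 it vanishes. The main point is the bound p^(1 - eps1) for
     sum_(a1 <> a2) |sum_(b1 in O1 a1, b2 in O2 a2) e(-(b1 - b2)^2 / (4 (a1 - a2)))|
   over families of sets O1 a, O2 a in B of total size at most p^(1/2) each.

   If #|O1 a1| and #|O2 a2| are both at least p^(1/2 - y), the inner sum is
   controlled by the additive energies of the two sets, hence by condition (b)
   (or trivially when one of them has less than p^l elements). If the sets O2 a2
   are smaller, fix a1 and decompose O1 a1 by the Balog-Szemeredi-Gowers theorem
   into sets B with small B - B and a remainder of low energy, for which a fourth
   moment suffices. For a structured B, the (2m)-th power of the sum over a2 and
   b2 leads to a trilinear sum over B - B, B + B and the differences of sums of
   m / 2 terms 1 / (4 (a1 - a)). Condition (a) bounds the second moment of the
   number of representations of such differences, and their products with B - B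
   are spread out because few dilates of B - B overlap substantially, by a
   sum-product theorem in F_p. A growth lemma with a polynomial dependence K^41 on the
   doubling constant is enough for the value c0 = 1 / 10430.

   This gives |<u_I, u_J>| <= p^(-eps1/2) (#|I| #|J|)^(1/2), off the diagonal, for
   sums u_I, u_J over sets of at most p^(1/2) columns. Cutting larger sets into
   blocks and a sparse vector into level sets yields the restricted isometry
   property. *)
Require Import Defs.
From HB Require Import structures.
From mathcomp Require Import all_boot all_order all_algebra fingroup perm.
From mathcomp Require Import all_classical all_reals all_analysis.
From mathcomp Require Import complex.
From mathcomp Require Import zify ring lra.
From mathcomp Require Import fintype finset.

Set Implicit Arguments.
Unset Strict Implicit.
Unset Printing Implicit Defensive.

Import Order.TTheory GRing.Theory Num.Theory.
Local Open Scope ring_scope.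

(** * Sumset inequalities *)

(** Gains are measured in the exponent z = m y. For sets below p^(1/2 - y), the second moment of the
    cardinalities is at most p^(1 - y); raised to the power m it saves p^(-z), and the final root of
    order 2 m leaves a fixed fraction of y. Every loss in between (doubling constants, overlap
    thresholds, growth constants) must therefore be a power of p with a small multiple of z as
    exponent, which is why the combinatorial lemmas carry explicit polynomial constants. Structured
    pieces can be removed any number of times because the bound for a piece is linear in its size:
    the pieces add up to the whole set, and the low-energy remainder is paid once for each a1. Over
    both chirp rates that remainder costs p^(2 alpha), so alpha has to be small against the exponent
    of the energy threshold. At the end, level sets of ratio a small power of p keep their number
    independent of p. Since [witnesses_ExRIP] wants one K for all eps and an isometry for every
    prime, K is a largest admissible integer rather than a formula. *)

Section Sumsets.
Variable G : finZmodType.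
Implicit Types A B C X Y Z : {set G}.

Definition sumset A B : {set G} := [set a + b | a in A, b in B].
Definition diffset A B : {set G} := [set a - b | a in A, b in B].
Definition nsum n B : {set G} := iter n (sumset B) [set 0].

Lemma sumsetP A B x :
  reflect (exists a b, [/\ a \in A, b \in B & x = a + b]) (x \in sumset A B).
Proof.
apply: (iffP imset2P) => [[a b aA bB ->]|[a [b [aA bB ->]]]]; last by exists a b.
by exists a, b.
Qed.

Lemma diffsetP A B x :
  reflect (exists a b, [/\ a \in A, b \in B & x = a - b]) (x \in diffset A B).
Proof.
apply: (iffP imset2P) => [[a b aA bB ->]|[a [b [aA bB ->]]]]; last by exists a b.
by exists a, b.
Qed.

Lemma mem_sumset A B a b : a \in A -> b \in B -> a + b \in sumset A B.
Proof. by move=> aA bB; apply/sumsetP; exists a, b. Qed.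

Lemma mem_diffset A B a b : a \in A -> b \in B -> a - b \in diffset A B.
Proof. by move=> aA bB; apply/diffsetP; exists a, b. Qed.

Lemma sumsetS A A' B B' :
  A \subset A' -> B \subset B' -> sumset A B \subset sumset A' B'.
Proof.
move=> /subsetP sA /subsetP sB; apply/subsetP => x /sumsetP[a [b [aA bB ->]]].
by rewrite mem_sumset ?sA ?sB.
Qed.

Lemma sumsetA A B C : sumset A (sumset B C) = sumset (sumset A B) C.
Proof.
apply/setP=> x; apply/sumsetP/sumsetP => [[a [y [aA /sumsetP[b [c [bB cC ->]]] ->]]]|].
  by exists (a + b), c; rewrite mem_sumset ?addrA.
case=> y [c [/sumsetP[a [b [aA bB ->]]] cC ->]].
by exists a, (b + c); rewrite mem_sumset ?addrA.
Qed.

Lemma sumset0 A : sumset A [set 0] = A.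
Proof.
apply/setP=> x; apply/sumsetP/idP => [[a [b [aA /set1P-> ->]]]|xA].
  by rewrite addr0.
by exists x, 0; rewrite inE addr0.
Qed.

Lemma card_shift A c : #|[set a + c | a in A]| = #|A|.
Proof. by rewrite card_imset //; exact: addIr. Qed.

(** Fix a representation v = x - z of each v in X - Z. Then (v, y) goes to (x - y, y - z)
    injectively, because the sum of the two entries returns v and then the first entry returns y.
    The default (0, 0) of the choice is never met on X - Z. *)
Lemma ruzsa_triangle X Y Z :
  (#|diffset X Z| * #|Y| <= #|diffset X Y| * #|diffset Y Z|)%N.
Proof.
have [pf pfP] : exists pf : G -> G * G, forall v, v \in diffset X Z ->
    [/\ (pf v).1 \in X, (pf v).2 \in Z & v = (pf v).1 - (pf v).2].
  exists (fun v => odflt (0, 0) [pick q : G * G |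
     [&& q.1 \in X, q.2 \in Z & v == q.1 - q.2]]) => v /diffsetP[x [z [xX zZ ev]]].
  case: pickP => [q /and3P[h1 h2 /eqP h3] /=|/(_ (x, z))]; first by split.
  by rewrite /= xX zZ ev eqxx.
pose f (q : G * G) := ((pf q.1).1 - q.2, q.2 - (pf q.1).2).
rewrite -!cardsX -(@card_in_imset _ _ f).
  apply: subset_leq_card; apply/subsetP => q /imsetP[[v y]].
  rewrite inE /= => /andP[/pfP[h1 h2 _] yY] ->.
  by rewrite inE /= !mem_diffset.
move=> [v y] [v' y']; rewrite !inE /= => /andP[/pfP[_ _ ev] _] /andP[/pfP[_ _ ev'] _].
case=> e1 e2; have evv : v = v'.
  by rewrite ev ev' -(subrKA y) e1 e2 subrKA.
by congr pair => //; move: e1; rewrite evv => /addrI /oppr_inj.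
Qed.

(* [X] minimizes the growth ratio [#|X + B| / #|X|]. *)
Lemma petridis A B : A != set0 ->
  exists X, [/\ X \subset A, X != set0,
    (#|sumset X B| * #|A| <= #|sumset A B| * #|X|)%N &
    forall C, (#|sumset (sumset X B) C| * #|X| <= #|sumset X B| * #|sumset X C|)%N].
Proof.
move=> A0.
pose ok X := (X \subset A) && (X != set0).
pose le (X Y : {set G}) := (#|sumset X B| * #|Y| <= #|sumset Y B| * #|X|)%N.
have [X okX minX] : exists2 X, ok X & forall Y, ok Y -> le X Y.
  pose rt (X : {set G}) : rat := #|sumset X B|%:R / #|X|%:R.
  have okA : ok A by rewrite /ok subxx.
  case: (@Order.TotalTheory.arg_minP _ rat _ A ok rt okA) => X okX minX.
  exists X => // Y okY; have := minX _ okY.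
  have cpos Z : ok Z -> (0 : rat) < #|Z|%:R.
    by case/andP=> _; rewrite -card_gt0 ltr0n.
  by rewrite /rt ler_pdivrMr ?cpos // mulrAC ler_pdivlMr ?cpos // -!natrM ler_nat.
case/andP: (okX) => sXA X0.
have X1 : (0 < #|X|)%N by rewrite card_gt0.
exists X; split => //; first by apply: minX; rewrite /ok subxx.
move=> C; move: {2}#|C| (erefl #|C|) => n.
elim: n C => [|n IHn] C cardC.
  move/eqP: cardC; rewrite cards_eq0 => /eqP->.
  suff -> : forall Y, sumset Y set0 = set0 by rewrite cards0 mul0n.
  by move=> Y; apply/setP=> x; rewrite inE; apply/sumsetP => -[a [b [_]]]; rewrite inE.
have [c cC] : exists c, c \in C by apply/set0Pn; rewrite -card_gt0 cardC.
pose C' := C :\ c.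
have eC : C = c |: C' by rewrite setD1K.
have cC' : #|C'| = n by move: cardC; rewrite (cardsD1 c) cC add1n => -[].
have {IHn cC'} IH := IHn _ cC'.
pose sh (Y : {set G}) := [set y + c | y in Y].
(* Restoring c adds at most |X + B| - |Z + B| points to X + B + C', as the translates of Z + B are
   already there. On the other side it adds at least |X| - |W| points to X + C'. Since W lies in Z,
   minimality of X tested on Z compares the two. *)
pose Z := [set x in X | [set x + b + c | b in B] \subset sumset (sumset X B) C'].
pose W := [set x in X | x + c \in sumset X C'].
have sWZ : W \subset Z.
  apply/subsetP=> x; rewrite !inE => /andP[xX /sumsetP[y [d [yX dC' e]]]].
  rewrite xX /=; apply/subsetP=> _ /imsetP[b bB ->].
  apply/sumsetP; exists (y + b), d; rewrite mem_sumset //; split=> //.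
  by rewrite addrAC e addrAC.
have sZX : Z \subset X by apply/subsetP=> x; rewrite inE => /andP[].
have sZB : sumset Z B \subset sumset X B by apply: sumsetS.
have h1 : (#|sumset (sumset X B) C| + #|sumset Z B| <=
     #|sumset (sumset X B) C'| + #|sumset X B|)%N.
  have sub : sumset (sumset X B) C \subset
     sumset (sumset X B) C' :|: (sh (sumset X B) :\: sh (sumset Z B)).
    apply/subsetP=> _ /sumsetP[w [d [wXB dC ->]]]; rewrite inE.
    have [->|dc] := eqVneq d c; last first.
      by rewrite mem_sumset // /C' !inE dc.
    case: (boolP (_ \in sumset (sumset X B) C')) => //= nin.
    rewrite inE; apply/andP; split; last by apply/imsetP; exists w.
    apply: contra nin => /imsetP[z zZB /addIr ->].
    case/sumsetP: zZB => z' [b [z'Z bB ->]].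
    move: z'Z; rewrite inE => /andP[_ /subsetP]; apply.
    by apply/imsetP; exists b.
  have := subset_leq_card sub; rewrite cardsU.
  move=> le1; have le2 := leq_trans le1 (leq_subr _ _).
  apply: (@leq_trans (#|sumset (sumset X B) C'| + #|sh (sumset X B) :\: sh (sumset Z B)| + #|sumset Z B|)).
    by rewrite leq_add2r.
  rewrite -addnA leq_add2l cardsD (setIidPr _) ?imsetS //.
  by rewrite !card_shift subnK // subset_leq_card.
have h2 : (#|sumset X C'| + #|X| <= #|sumset X C| + #|W|)%N.
  have sub : sumset X C' :|: (sh X :\: sh W) \subset sumset X C.
    apply/subsetP=> x; rewrite inE => /orP[].
      by apply/subsetP; rewrite sumsetS // subsetDl.
    by rewrite inE => /andP[_ /imsetP[y yX ->]]; rewrite mem_sumset.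
  have := subset_leq_card sub; rewrite cardsU (_ : _ :&: _ = set0) ?cards0 ?subn0.
    have -> : #|sh X :\: sh W| = (#|X| - #|W|)%N.
      rewrite cardsD (setIidPr _) ?card_shift //.
      by apply: imsetS; apply: subset_trans sWZ sZX.
    have : (#|W| <= #|X|)%N by apply: subset_leq_card; apply: subset_trans sWZ sZX.
    by lia.
  apply/setP=> x; rewrite !inE; apply/negbTE/negP => /andP[xXC /andP[+ /imsetP[y yX ex]]].
  by case/negP; rewrite ex; apply/imsetP; exists y; rewrite // inE yX -ex.
have h3 : (#|sumset X B| * #|W| <= #|sumset Z B| * #|X|)%N.
  apply: (@leq_trans (#|sumset X B| * #|Z|)).
    by rewrite leq_mul2l subset_leq_card ?orbT.
  have [->|Z0] := eqVneq Z set0; first by rewrite cards0 muln0.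
  by apply: minX; rewrite /ok Z0 (subset_trans sZX).
nia.
Qed.

Lemma nsumS n B : nsum n.+1 B = sumset B (nsum n B).
Proof. by []. Qed.

Lemma card_sumset_gel A B a : a \in A -> (#|B| <= #|sumset A B|)%N.
Proof.
move=> aA; rewrite -(card_shift B a); apply: subset_leq_card.
by apply/subsetP=> _ /imsetP[b bB ->]; rewrite addrC mem_sumset.
Qed.

Lemma card_diffset_gel A B a : a \in A -> (#|B| <= #|diffset A B|)%N.
Proof.
move=> aA; have <- : #|[set a - b | b in B]| = #|B|.
  by rewrite card_imset // => x y /addrI /oppr_inj.
apply: subset_leq_card.
by apply/subsetP=> _ /imsetP[b bB ->]; rewrite mem_diffset.
Qed.

(** One X serves all n: taking C = nB in [petridis], each further summand B multiplies |X + nB| by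
    at most |X + B| / |X| <= K. *)
Lemma plunnecke_base A B K : A != set0 -> (#|sumset A B| <= K * #|A|)%N ->
  exists X, [/\ X \subset A, X != set0 &
    forall n, (#|sumset X (nsum n B)| <= K ^ n * #|X|)%N].
Proof.
move=> A0 hK; have [X [sXA X0 hX hC]] := petridis B A0.
have A1 : (0 < #|A|)%N by rewrite card_gt0.
have X1 : (0 < #|X|)%N by rewrite card_gt0.
have hXB : (#|sumset X B| <= K * #|X|)%N.
  by rewrite -(leq_pmul2r A1); apply: leq_trans hX _; nia.
exists X; split=> //; elim=> [|n IHn]; first by rewrite sumset0 expn0 mul1n.
rewrite nsumS sumsetA expnS -(leq_pmul2r X1); apply: leq_trans (hC _) _.
by apply: (leq_trans (leq_mul hXB IHn)); rewrite mulnACA !mulnA.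
Qed.

Lemma plunnecke A B K n : A != set0 -> (#|sumset A B| <= K * #|A|)%N ->
  (#|nsum n B| <= K ^ n * #|A|)%N.
Proof.
move=> A0 /(plunnecke_base A0)[X [sXA /set0Pn[x xX] hX]].
apply: leq_trans (card_sumset_gel _ xX) _; apply: leq_trans (hX n) _.
by rewrite leq_mul2l subset_leq_card ?orbT.
Qed.

Definition oppset A : {set G} := [set - a | a in A].

Lemma mem_oppset A x : (x \in oppset A) = (- x \in A).
Proof.
apply/imsetP/idP => [[a aA ->]|xA]; first by rewrite opprK.
by exists (- x); rewrite ?opprK.
Qed.

Lemma oppsetK A : oppset (oppset A) = A.
Proof. by apply/setP=> x; rewrite !mem_oppset opprK. Qed.

Lemma card_oppset A : #|oppset A| = #|A|.
Proof. by rewrite card_imset //; exact: oppr_inj. Qed.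

Lemma sumset_oppset A B : sumset A (oppset B) = diffset A B.
Proof.
apply/setP=> x; apply/sumsetP/diffsetP => -[a [b [aA bB ->]]].
  by exists a, (- b); rewrite opprK -mem_oppset.
by exists a, (- b); rewrite mem_oppset opprK.
Qed.

Lemma diffset_oppset A B : diffset A (oppset B) = sumset A B.
Proof. by rewrite -sumset_oppset oppsetK. Qed.

Lemma oppset_sumset A B : oppset (sumset A B) = sumset (oppset A) (oppset B).
Proof.
apply/setP=> x; rewrite mem_oppset; apply/sumsetP/sumsetP => -[a [b [aA bB e]]].
  exists (- a), (- b); rewrite !mem_oppset !opprK; split=> //.
  by rewrite -opprD -e opprK.
by exists (- a), (- b); rewrite -!mem_oppset; split=> //; rewrite -opprD e.
Qed.

Lemma oppset_nsum n B : oppset (nsum n B) = nsum n (oppset B).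
Proof.
elim: n => [|n IHn]; last by rewrite !nsumS oppset_sumset IHn.
by apply/setP=> x; rewrite mem_oppset !inE oppr_eq0.
Qed.

Lemma nsum1 B : nsum 1 B = B.
Proof. by rewrite nsumS sumset0. Qed.

Lemma oppset_diffset A B : oppset (diffset A B) = diffset B A.
Proof.
apply/setP=> x; rewrite mem_oppset; apply/diffsetP/diffsetP => -[a [b [aA bB e]]].
  by exists b, a; rewrite -opprB -e opprK.
by exists b, a; rewrite e opprB.
Qed.

(** [plunnecke_base] for the pair B, -B gives one X with all X - nB small; the triangle inequality
    through this X then handles nB - kB. *)
Lemma plunnecke_ruzsa B K n k : B != set0 -> (#|diffset B B| <= K * #|B|)%N ->
  (#|diffset (nsum n B) (nsum k B)| <= K ^ (n + k) * #|B|)%N.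
Proof.
move=> B0; rewrite -sumset_oppset => /(plunnecke_base B0)[X [sXB X0 hX]].
have X1 : (0 < #|X|)%N by rewrite card_gt0.
rewrite -(leq_pmul2r X1); apply: leq_trans (ruzsa_triangle _ X _) _.
have hd m : (#|diffset X (nsum m B)| <= K ^ m * #|X|)%N.
  by rewrite -sumset_oppset oppset_nsum.
rewrite -(card_oppset (diffset _ X)) oppset_diffset expnD.
apply: leq_trans (leq_mul (hd n) (hd k)) _.
have : (#|X| <= #|B|)%N by apply: subset_leq_card.
by nia.
Qed.

End Sumsets.

(** * The Balog-Szemeredi-Gowers theorem *)

Section NatSums.

Lemma card_sum_nat (I : finType) (A : {set I}) (P : pred I) :
  #|[set x in A | P x]| = (\sum_(x in A) P x)%N.
Proof.
rewrite -sum1_card big_mkcond [RHS]big_mkcond; apply: eq_bigr => x _.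
by rewrite inE; case: (x \in A); case: (P x).
Qed.

Lemma sqr_sum_leq (I : finType) (A : {set I}) (F : I -> nat) :
  ((\sum_(i in A) F i) ^ 2 <= #|A| * \sum_(i in A) F i ^ 2)%N.
Proof.
rewrite -(leq_pmul2l (isT : 0 < 2)%N).
have -> : (2 * (\sum_(i in A) F i) ^ 2 =
           \sum_(i in A) \sum_(j in A) 2 * (F i * F j))%N.
  rewrite expnS expn1 big_distrl big_distrr; apply: eq_bigr => i _ /=.
  by rewrite big_distrr big_distrr.
have -> : (2 * (#|A| * \sum_(i in A) F i ^ 2) =
           \sum_(i in A) \sum_(j in A) (F i ^ 2 + F j ^ 2))%N.
  under [RHS]eq_bigr do rewrite big_split /= sum_nat_const.
  by rewrite big_split /= sum_nat_const -big_distrr /= addnn mul2n.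
by apply: leq_sum => i _; apply: leq_sum => j _; exact: (nat_Cauchy (F i) (F j)).1.
Qed.

Lemma sum_eq_nat (I : finType) (P : {set I}) (x : I) :
  (\sum_(v in P) (x == v) = (x \in P))%N.
Proof.
have [xP|xP] := boolP (x \in P).
  rewrite (bigD1 x) //= eqxx big1 // => v /andP[_ /negbTE].
  by rewrite eq_sym => ->.
by rewrite big1 // => v vP; case: eqP => // e; move: xP; rewrite e vP.
Qed.

Lemma card_triple (I J L : finType) (Q : I -> J -> L -> bool) :
  #|[set q : I * (J * L) | Q q.1 q.2.1 q.2.2]| = (\sum_x \sum_y \sum_z Q x y z)%N.
Proof.
under eq_bigr do rewrite pair_bigA; rewrite pair_bigA /=.
rewrite -sum1_card big_mkcond /=; apply: eq_bigr => q _.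
by rewrite inE; case: (Q _ _ _).
Qed.

End NatSums.

Section BSG.
Variable G : finZmodType.
Implicit Types B P : {set G}.

Definition drep B (v : G) : nat := (\sum_(b in B) \sum_(d in B) ((b - d)%R == v))%N.

Lemma sum_drep B P :
  (\sum_(v in P) drep B v = \sum_(b in B) \sum_(d in B) ((b - d)%R \in P))%N.
Proof.
rewrite exchange_big; apply: eq_bigr => b _; rewrite exchange_big.
by apply: eq_bigr => d _; exact: sum_eq_nat.
Qed.

Lemma sum_drepT B : (\sum_v drep B v = #|B| ^ 2)%N.
Proof.
have := sum_drep B setT; rewrite (eq_bigl predT) => [->|v]; last by rewrite inE.
under eq_bigr do under eq_bigr do rewrite inE.
by under eq_bigr do rewrite sum1_card; rewrite sum_nat_const.
Qed.

Lemma drep_le B v : (drep B v <= #|B|)%N.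
Proof.
rewrite /drep -sum1_card; apply: leq_sum => b _.
rewrite (eq_bigr (fun d => ((b - v)%R == d : nat))) => [|d _].
  by rewrite sum_eq_nat leq_b1.
by rewrite subr_eq addrC -subr_eq.
Qed.

(* Dependent random choice: [B'] consists of the elements of the neighbourhood of
   a well chosen [d], in the graph of popular differences, that have many common
   neighbours with most of that neighbourhood. *)
Lemma bsg B K : (0 < K)%N -> B != set0 ->
  (#|B| ^ 3 <= K * \sum_v drep B v ^ 2)%N ->
  exists B', [/\ B' \subset B, B' != set0, (#|B| <= 6 * K * #|B'|)%N &
    (#|diffset B' B'| <= 2 ^ 22 * K ^ 10 * #|B'|)%N].
Proof.
move=> K0 B0 hE; set n := #|B| in hE *.
have n0 : (0 < n)%N by rewrite card_gt0.
(* Popular differences: those outside P contribute at most n^3 / (2 K), half of the guaranteed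
   energy. *)
pose P := [set v | (n <= 2 * K * drep B v)%N].
have cardP : (#|P| <= 2 * K * n)%N.
  have : (#|P| * n <= 2 * K * \sum_v drep B v)%N.
    rewrite -sum_nat_const big_distrr /= [leqRHS](bigID (mem P)) /=.
    by apply: leq_trans (leq_addr _ _); apply: leq_sum => v; rewrite inE.
  rewrite sum_drepT -/n; nia.
have hP : (n ^ 2 <= 2 * K * \sum_(v in P) drep B v)%N.
  have h1 : (2 * K * \sum_(v | v \notin P) drep B v ^ 2 <= n * n ^ 2)%N.
    rewrite -[X in (_ <= n * X)%N]sum_drepT !big_distrr /= [leqRHS](bigID (mem P)) /=.
    apply: leq_trans (leq_addl _ _); apply: leq_sum => v; rewrite inE -ltnNge.
    by move=> h; rewrite expnS expn1 mulnA leq_mul2r ltnW ?orbT.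
  have h2 : (\sum_(v in P) drep B v ^ 2 <= n * \sum_(v in P) drep B v)%N.
    rewrite big_distrr /=; apply: leq_sum => v _.
    by rewrite expnS expn1 leq_mul2r drep_le orbT.
  move: hE; rewrite (bigID (mem P)) /=.
  set s1 := (\sum_(v in P) drep B v ^ 2)%N in h2 *; set s2 := (\sum_(v | _) _)%N in h1 *.
  set s3 := (\sum_(v in P) drep B v)%N in h2 *; move=> hE.
  rewrite -(leq_pmul2l n0).
  have : (K * s1 <= K * (n * s3))%N by rewrite leq_mul2l h2 orbT.
  by nia.
pose N d := [set b in B | b - d \in P].
have sumN : (\sum_(d in B) #|N d| = \sum_(v in P) drep B v)%N.
  rewrite sum_drep exchange_big; apply: eq_bigr => d _.
  exact: card_sum_nat.
pose c b1 b2 := (\sum_(d in B) (((b1 - d)%R \in P) && ((b2 - d)%R \in P)))%N.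
(* A bad pair has few common neighbours d, so it lies in few of the neighbourhoods N d; this is what
   makes bad pairs rare on average over d. *)
pose bad b1 b2 := (64 * K ^ 2 * c b1 b2 < n)%N.
pose bd d := (\sum_(b1 in N d) \sum_(b2 in N d) bad b1 b2)%N.
have hbd : (64 * K ^ 2 * \sum_(d in B) bd d <= n ^ 3)%N.
  have -> : (\sum_(d in B) bd d =
      \sum_(b1 in B) \sum_(b2 in B) bad b1 b2 * c b1 b2)%N.
    have -> : (\sum_(d in B) bd d = \sum_(d in B) \sum_(b1 in B) \sum_(b2 in B)
        bad b1 b2 * (((b1 - d)%R \in P) && ((b2 - d)%R \in P)))%N.
      apply: eq_bigr => d _; rewrite /bd big_mkcond [RHS]big_mkcond.
      apply: eq_bigr => b1 _; rewrite inE; case: (b1 \in B) => //=.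
      case: ((b1 - d)%R \in P); last by rewrite big1 // => b2 _; rewrite muln0.
      rewrite big_mkcond [RHS]big_mkcond; apply: eq_bigr => b2 _; rewrite inE.
      by case: (b2 \in B) => //=; case: ((b2 - d)%R \in P); rewrite ?muln1 ?muln0.
    rewrite exchange_big; apply: eq_bigr => b1 _; rewrite exchange_big.
    by apply: eq_bigr => b2 _; rewrite big_distrr.
  have -> : (n ^ 3 = \sum_(b1 in B) \sum_(b2 in B) n)%N.
    by rewrite !sum_nat_const -/n; lia.
  rewrite big_distrr; apply: leq_sum => b1 _; rewrite big_distrr.
  apply: leq_sum => b2 _ /=; rewrite /bad; case: ltnP => [h|_]; rewrite ?mul0n ?muln0 //.
  by rewrite mul1n ltnW.
have hN2 : (n ^ 3 <= 4 * K ^ 2 * \sum_(d in B) #|N d| ^ 2)%N.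
  have := sqr_sum_leq B (fun d => #|N d|); rewrite sumN -/n => h.
  rewrite -(leq_pmul2l n0).
  have : ((n ^ 2) ^ 2 <= (2 * K * \sum_(v in P) drep B v) ^ 2)%N by rewrite leq_exp2r.
  by move: h; set u := (\sum_(v in P) _)%N; set w := (\sum_(d in B) _)%N; nia.
(* Averaging a single combined inequality yields a d for which N d is large (n <= 3 K |N d|) and at
   most one eighth of its pairs are bad. *)
have [d dB hd] : exists2 d, d \in B & (n ^ 2 + 64 * K ^ 2 * bd d <= 8 * K ^ 2 * #|N d| ^ 2)%N.
  case: (pickP (fun d => (d \in B) && (n ^ 2 + 64 * K ^ 2 * bd d <= 8 * K ^ 2 * #|N d| ^ 2)%N)).
    by move=> d /andP[dB h]; exists d.
  move=> hn; exfalso.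
  have : (\sum_(d in B) 8 * K ^ 2 * #|N d| ^ 2 < \sum_(d in B) (n ^ 2 + 64 * K ^ 2 * bd d))%N.
    have [b bB] := set0Pn _ B0.
    rewrite (bigD1 b) //= [ltnRHS](bigD1 b) //= -addSn; apply: leq_add.
      by have := hn b; rewrite bB /= leqNgt => /negbFE.
    apply: leq_sum => d /andP[dB _].
    by have := hn d; rewrite dB /= leqNgt => /negbFE /ltnW.
  rewrite big_split /= sum_nat_const -/n -[ltnLHS]big_distrr /= -big_distrr /=.
  move: hN2 hbd; rewrite -/n; set u := (\sum_(d in B) _)%N; set w := (\sum_(d in B) bd d)%N.
  by clear; set k := (K ^ 2)%N; lia.
set Nd := N d in hd.
have hNd : (n <= 3 * K * #|Nd|)%N.
  rewrite -leq_sqr; nia.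
have Nd0 : (0 < #|Nd|)%N by rewrite lt0n; apply/eqP => e; move: hNd; rewrite e muln0; lia.
have hbd8 : (8 * bd d <= #|Nd| ^ 2)%N.
  have K2 : (0 < 8 * K ^ 2)%N by nia.
  by rewrite -(leq_pmul2l K2); nia.
pose bb b1 := (\sum_(b2 in Nd) bad b1 b2)%N.
pose B' := [set b1 in Nd | (4 * bb b1 <= #|Nd|)%N].
have sB'N : B' \subset Nd by apply/subsetP=> b; rewrite inE => /andP[].
have hB' : (#|Nd| <= 2 * #|B'|)%N.
  have e : (#|Nd| = #|B'| + #|Nd :\: B'|)%N by rewrite -(cardsID B' Nd) (setIidPr sB'N).
  have : (#|Nd :\: B'| * #|Nd| <= 4 * bd d)%N.
    rewrite -sum_nat_const big_distrr /= [leqRHS](bigID (mem B')) /=.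
    apply: leq_trans (leq_addl _ _).
    rewrite [leqRHS](eq_bigl (mem (Nd :\: B'))) /=; last by move=> b /=; rewrite [in RHS]in_setD andbC.
    apply: leq_sum => b; rewrite !inE -/Nd => /andP[+ bN]; rewrite bN /= -ltnNge.
    exact: ltnW.
  clear -e Nd0 hbd8; nia.
have B'0 : B' != set0 by rewrite -card_gt0; clear -hB' Nd0; lia.
have sB'B : B' \subset B.
  by apply: subset_trans sB'N _; apply/subsetP=> b; rewrite inE => /andP[].
exists B'; split => //; first by clear -hB' hNd; nia.
(* Each v = b1 - b2 is written as ((b1 - d1) - (x - d1)) - ((b2 - d2) - (x - d2)) with four popular
   differences. At least half of the x in [Nd] form no bad pair with b1 or b2, and each leaves n /
   (64 K^2) choices for d1 and as many for d2. The quadruple of differences determines v, x, d1 and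
   d2, so there are at most |P|^4 of them. *)
have key : (#|diffset B' B'| * (#|Nd| * n ^ 2) <= 2 * (64 * K ^ 2) ^ 2 * #|P| ^ 4)%N.
  pose pf v : G * G := odflt (0, 0) [pick q : G * G |
     [&& q.1 \in B', q.2 \in B' & v == q.1 - q.2]].
  have pfP v : v \in diffset B' B' ->
      [/\ (pf v).1 \in B', (pf v).2 \in B' & v = (pf v).1 - (pf v).2].
    case/diffsetP=> b1 [b2 [h1 h2 e]]; rewrite /pf.
    case: pickP => [q /and3P[g1 g2 /eqP g3] /=|/(_ (b1, b2))]; first by split.
    by rewrite /= h1 h2 e eqxx.
  pose S v := [set q : G * (G * G) | [&& q.1 \in Nd,
    (q.2.1 \in B) && (((pf v).1 - q.2.1 \in P) && (q.1 - q.2.1 \in P)) &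
    (q.2.2 \in B) && (((pf v).2 - q.2.2 \in P) && (q.1 - q.2.2 \in P))]].
  pose PP := setX (setX P P) (setX P P).
  pose g (q : (G * G) * (G * G)) := (q.1.1 - q.1.2) - (q.2.1 - q.2.2).
  have hS : (\sum_(v in diffset B' B') #|S v| <= #|P| ^ 4)%N.
    have -> : (#|P| ^ 4 = #|PP|)%N by rewrite !cardsX; lia.
    rewrite -[#|PP|]sum1_card (partition_big g xpredT) //= [leqRHS](bigID (mem (diffset B' B'))) /=.
    apply: leq_trans (leq_addr _ _); apply: leq_sum => v vD.
    rewrite sum1dep_card; have [_ _ ev] := pfP _ vD.
    pose f (q : G * (G * G)) :=
      (((pf v).1 - q.2.1, q.1 - q.2.1), ((pf v).2 - q.2.2, q.1 - q.2.2)).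
    rewrite -(@card_in_imset _ _ f (S v)).
      apply: subset_leq_card; apply/subsetP => w /imsetP[[x [d1 d2]]].
      rewrite inE /= => /and3P[_ /and3P[_ h1 h2] /and3P[_ h3 h4]] ->.
      rewrite inE /f !in_setX /= h1 h2 h3 h4 /= /g /= [X in _ == X]ev; apply/eqP.
      have aux (a y z : G) : a - z - (y - z) = a - y by rewrite opprB subrKA.
      by rewrite !aux.
    move=> [x [d1 d2]] [x' [d1' d2']] _ _ [] /addrI/oppr_inj -> e /addrI/oppr_inj ->.
    by move/addIr: e => ->.
  have hSv v : v \in diffset B' B' -> (#|Nd| * n ^ 2 <= 2 * (64 * K ^ 2) ^ 2 * #|S v|)%N.
    move=> /pfP[h1 h2 _]; set b1 := (pf v).1 in h1 *; set b2 := (pf v).2 in h2 *.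
    have -> : (#|S v| = \sum_(x in Nd) c b1 x * c b2 x)%N.
      rewrite [LHS](card_triple (fun x y z => [&& x \in Nd,
        (y \in B) && ((b1 - y \in P) && (x - y \in P)) &
        (z \in B) && ((b2 - z \in P) && (x - z \in P))])) [RHS]big_mkcond.
      apply: eq_bigr => x _.
      case: ifP => xN; last by rewrite big1 // => y _; rewrite big1.
      rewrite /c big_distrl /= [RHS]big_mkcond; apply: eq_bigr => y _.
      case yB: (y \in B); last by rewrite big1.
      rewrite big_distrr /= [RHS]big_mkcond; apply: eq_bigr => z _.
      by case: (z \in B); rewrite ?andbF //= mulnb.
    have hg : (#|Nd| <= 2 * \sum_(x in Nd) (~~ bad b1 x && ~~ bad b2 x))%N.
      have e1 : (\sum_(x in Nd) 1 <= \sum_(x in Nd) (~~ bad b1 x && ~~ bad b2 x) +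
          (bb b1 + bb b2))%N.
        rewrite -!big_split /=; apply: leq_sum => x _.
        by case: (bad b1 x); case: (bad b2 x).
      move: h1 h2 e1; rewrite !inE sum1_card => /andP[_ g1] /andP[_ g2].
      by lia.
    apply: leq_trans (leq_mul hg (leqnn _)) _.
    rewrite -[leqLHS]mulnA -[leqRHS]mulnA leq_mul2l /= big_distrl [leqRHS]big_distrr /=.
    apply: leq_sum => x _.
    have [|g1] := boolP (bad b1 x); rewrite ?mul0n //=.
    have [|g2] := boolP (bad b2 x); rewrite ?mul0n //=.
    rewrite mul1n !expnS !expn0 !muln1 [leqRHS]mulnACA.
    by move: g1 g2; rewrite /bad -!leqNgt => g1 g2; rewrite leq_mul // mulnA.
  apply: leq_trans (_ : 2 * (64 * K ^ 2) ^ 2 * \sum_(v in diffset B' B') #|S v| <= _)%N.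
    by rewrite -sum_nat_const [leqRHS]big_distrr /=; apply: leq_sum => v vD; exact: hSv.
  by rewrite leq_mul2l hS orbT.
have : (#|diffset B' B'| * (#|Nd| * n ^ 2) <= 2 * (64 * K ^ 2) ^ 2 * (2 * K * n) ^ 4)%N.
  apply: leq_trans key _; rewrite leq_mul2l; apply/orP; right.
  by rewrite leq_exp2r.
move=> h.
have h2 : (#|diffset B' B'| * #|Nd| <= 2 ^ 17 * K ^ 8 * n ^ 2)%N.
  have n2 : (0 < n ^ 2)%N by rewrite expn_gt0 n0.
  rewrite -(leq_pmul2r n2); apply: leq_trans (_ : _ <= _)%N (leq_trans h _).
    by rewrite -mulnA.
  have -> : (2 * (64 * K ^ 2) ^ 2 * (2 * K * n) ^ 4 = 2 ^ 17 * K ^ 8 * n ^ 2 * n ^ 2)%N.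
    by rewrite !expnMn; ring.
  by [].
(* The factor 2^17 is 2 * 64^2 * 2^4; the remaining 2^5 covers the 9 * 2 coming from n <= 3 K |Nd|
   and |Nd| <= 2 |B'|. *)
rewrite (expnD 2 17 5) (_ : 2 ^ 5 = 32)%N //; move: h2.
move: (2 ^ 17)%N => u h2; rewrite -(leq_pmul2r Nd0); apply: leq_trans h2 _.
have h3 : (n ^ 2 <= (3 * K * #|Nd|) ^ 2)%N by rewrite leq_exp2r.
apply: leq_trans (leq_mul (leqnn _) h3) _.
rewrite (_ : K ^ 10 = K ^ 8 * K ^ 2)%N; last by rewrite -expnD.
rewrite [((_ * _ * _) ^ 2)%N]expnMn [((_ * _) ^ 2)%N]expnMn.
have h4 : (u * K ^ 8 * K ^ 2 * #|Nd| * #|Nd| <= u * K ^ 8 * K ^ 2 * (2 * #|B'|) * #|Nd|)%N.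
  by rewrite leq_mul2r leq_mul2l hB' !orbT.
move: h4; move: (K ^ 8)%N (K ^ 2)%N #|Nd| #|B'| => a b c1 c2; clear.
have : (0 <= u * a * b * c1 * c2)%N by [].
by rewrite -!mulnn; lia.
Qed.

End BSG.

(** * Sum-product growth of dilates in a prime field *)

Section Counting.
Variable G : finZmodType.
Implicit Types A B W : {set G}.

(** All translates A + t i live in W, so by Cauchy-Schwarz many pairs of them intersect, and two
    translates can meet only if t i - t j lies in A - A. This is how a small sumset is converted
    into many incidences with A - A. *)
Lemma sumset_count (I : finType) A W (T : {set I}) (t : I -> G) : A != set0 ->
  (forall a i, a \in A -> i \in T -> a + t i \in W) ->
  (#|A| * #|T| ^ 2 <=
   #|W| * \sum_(i in T) \sum_(j in T) ((t i - t j)%R \in diffset A A))%N.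
Proof.
move=> A0 hW; have A1 : (0 < #|A|)%N by rewrite card_gt0.
pose h x := (\sum_(i in T) ((x - t i)%R \in A))%N.
have sh : (\sum_(x in W) h x = #|A| * #|T|)%N.
  rewrite exchange_big mulnC -sum_nat_const; apply: eq_bigr => i iT.
  rewrite -card_sum_nat -(card_shift A (t i)); apply: eq_card => x.
  rewrite inE; apply/andP/imsetP => [[_ xA]|[a aA ->]].
    by exists (x - t i); rewrite ?subrK.
  by rewrite addrK hW.
have := sqr_sum_leq W h; rewrite sh => h1.
rewrite -(leq_pmul2l A1).
have e : (#|A| * (#|A| * #|T| ^ 2) = (#|A| * #|T|) ^ 2)%N by rewrite expnMn; ring.
rewrite e; apply: leq_trans h1 _; rewrite mulnCA leq_mul2l; apply/orP; right.
have h2 : (\sum_(x in W) h x ^ 2 <= \sum_(x : G) \sum_(i in T) \sum_(j in T)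
   (((x - t i)%R \in A) && ((x - t j)%R \in A)))%N.
  rewrite [leqRHS](bigID (mem W)) /=; apply: leq_trans (leq_addr _ _).
  apply: leq_sum => x _; rewrite expnS expn1 big_distrl; apply: leq_sum => i _ /=.
  by rewrite big_distrr; apply: leq_sum => j _ /=; rewrite mulnb.
apply: leq_trans h2 _; rewrite exchange_big big_distrr; apply: leq_sum => i _ /=.
rewrite exchange_big big_distrr; apply: leq_sum => j _ /=.
have [tD|tD] := boolP (_ \in diffset A A).
  rewrite muln1 -(card_shift A (t i)).
  rewrite -sum1_card [leqRHS]big_mkcond; apply: leq_sum => x _.
  case: ifP => [|/negbT h3]; first by case: (_ && _).
  rewrite leqn0 eqb0; apply: contra h3 => /andP[xA _].
  by apply/imsetP; exists (x - t i); rewrite ?subrK.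
rewrite muln0 big1 // => x _; apply/eqP; rewrite eqb0; apply: contra tD => /andP[h3 h4].
by apply/diffsetP; exists (x - t j), (x - t i); split=> //; rewrite opprB [RHS]addrC subrKA.
Qed.

Definition sumsets (Bs : seq {set G}) : {set G} := foldr (@sumset G) [set 0] Bs.

(** Different summands are replaced by their union U: A + U is at most size Bs times larger than the
    bound for one summand, and the sum of all the sets lies in an iterated sumset of U. *)
Lemma plunnecke_seq A L (Bs : seq {set G}) : A != set0 ->
  (forall B, B \in Bs -> (#|sumset A B| <= L * #|A|)%N) ->
  (#|sumsets Bs| <= (size Bs * L) ^ size Bs * #|A|)%N.
Proof.
move=> A0 hB; pose U := \bigcup_(B <- Bs) B.
have hAU : (#|sumset A U| <= size Bs * L * #|A|)%N.
  rewrite /U; elim: Bs hB {U} => [|B Bs IH] hB.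
    rewrite big_nil (_ : sumset A set0 = set0) ?cards0 //.
    by apply/setP=> x; rewrite inE; apply/sumsetP => -[a [b [_]]]; rewrite inE.
  have sU : sumset A (\bigcup_(C <- B :: Bs) C) \subset
      sumset A B :|: sumset A (\bigcup_(C <- Bs) C).
    rewrite big_cons; apply/subsetP=> x /sumsetP[a [b [aA]]]; rewrite inE => bU ->.
    by rewrite inE; apply/orP; case/orP: bU => bU; [left|right]; apply: mem_sumset.
  apply: leq_trans (subset_leq_card sU) _; apply: leq_trans (leq_card_setU _ _) _.
  rewrite /= mulSn mulnDl leq_add ?hB ?mem_head // IH // => C CB.
  by rewrite hB // inE CB orbT.
apply: leq_trans (plunnecke (size Bs) A0 hAU).
apply: subset_leq_card; rewrite /U; move: Bs {hB hAU U}.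
suff h : forall (V : {set G}) Bs, (forall B, B \in Bs -> B \subset V) ->
    sumsets Bs \subset nsum (size Bs) V.
  move=> Bs; apply: h => B BB.
  apply/subsetP=> x xB; elim: Bs BB => // C Bs IH; rewrite inE big_cons in_setU.
  by case/orP => [/eqP<-|/IH->]; rewrite ?xB ?orbT.
move=> V; elim=> [|B Bs IH] hV //=.
rewrite sumsetS ?hV ?mem_head //; apply: IH => C CB.
by rewrite hV // inE CB orbT.
Qed.

End Counting.

Section SumProduct.
Variable F : finFieldType.
Implicit Types A R : {set F}.

Definition dil (c : F) A : {set F} := [set c * a | a in A].

Lemma mem_dil c A a : a \in A -> c * a \in dil c A.
Proof. by move=> aA; apply/imsetP; exists a. Qed.

Lemma card_dil c A : c != 0 -> #|dil c A| = #|A|.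
Proof. by move=> c0; rewrite card_imset //; apply: mulfI. Qed.

Lemma dil_diffset c A B : dil c (diffset A B) = diffset (dil c A) (dil c B).
Proof.
apply/setP=> x; apply/imsetP/diffsetP => [[y /diffsetP[a [b [aA bB ->]]] ->]|].
  by exists (c * a), (c * b); rewrite !mem_dil // mulrBr.
case=> y [z [/imsetP[a aA ->] /imsetP[b bB ->] ->]].
by exists (a - b); rewrite ?mem_diffset // mulrBr.
Qed.

Lemma dil_sumset c A B : dil c (sumset A B) = sumset (dil c A) (dil c B).
Proof.
apply/setP=> x; apply/imsetP/sumsetP => [[y /sumsetP[a [b [aA bB ->]]] ->]|].
  by exists (c * a), (c * b); rewrite !mem_dil // mulrDr.
case=> y [z [/imsetP[a aA ->] /imsetP[b bB ->] ->]].
by exists (a + b); rewrite ?mem_sumset // mulrDr.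
Qed.

Lemma dilM c d A : dil c (dil d A) = dil (c * d) A.
Proof.
apply/setP=> x; apply/imsetP/imsetP => [[y /imsetP[a aA ->] ->]|[a aA ->]].
  by exists a; rewrite // mulrA.
by exists (d * a); rewrite ?mem_dil // mulrA.
Qed.

Lemma dil1 A : dil 1 A = A.
Proof.
apply/setP=> x; apply/imsetP/idP => [[a aA ->]|xA]; first by rewrite mul1r.
by exists x; rewrite ?mul1r.
Qed.

Lemma dil0 c A : A != set0 -> (dil c A) != set0.
Proof. by case/set0Pn=> a aA; apply/set0Pn; exists (c * a); rewrite mem_dil. Qed.

Lemma oppset_dil c A : oppset (dil c A) = dil (- c) A.
Proof.
apply/setP=> x; rewrite mem_oppset; apply/imsetP/imsetP => -[a aA e].
  by exists a; rewrite // mulNr -e opprK.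
by exists a; rewrite // e mulNr opprK.
Qed.

Lemma mem_dil_iff c A x : c != 0 -> (c * x \in dil c A) = (x \in A).
Proof.
move=> c0; apply/imsetP/idP => [[a aA /(mulfI c0) ->]|xA] //.
by exists x.
Qed.

(* Below, [q] is called good if this set is a positive proportion of [R] for some
   [s != s'] in [R]. Good elements are stable under [q |-> q + 1], so all of F_p
   is good, and averaging over all [q] bounds the size of [R]. *)
Definition dilates_into A R (q s s' : F) : {set F} :=
  [set r in R | r * q * (s - s') \in diffset A A].

Section Fixed.
Variables (A R : {set F}) (K : nat).
Hypotheses (A0 : A != set0) (K0 : (0 < K)%N) (R0 : 0 \notin R).
Hypotheses (hAD : (#|sumset A A| <= K * #|A|)%N) (hAB : (#|diffset A A| <= K * #|A|)%N).
Hypothesis hRD : forall r, r \in R -> (#|sumset A (dil r A)| <= K * #|A|)%N.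
Hypothesis hRB : forall r, r \in R -> (#|diffset A (dil r A)| <= K * #|A|)%N.
Hypothesis sRD : R \subset diffset A A.

Let A1 : (0 < #|A|)%N. Proof. by rewrite card_gt0. Qed.

Let unitK r : r \in R -> r != 0.
Proof. by move=> rR; apply: contraNneq R0 => <-. Qed.

Lemma card_dilN r : r \in R -> (#|sumset A (dil (- r)%R A)| <= K * #|A|)%N.
Proof. by move=> rR; rewrite -oppset_dil sumset_oppset hRB. Qed.

(** Triangle inequality through t A: the set t A + t s A is a dilate of A + s A. *)
Lemma card_dil2 t s : t \in R -> s \in R ->
  (#|sumset A (dil (t * s)%R A)| <= K ^ 2 * #|A|)%N.
Proof.
move=> tR sR; have tA : #|dil t A| = #|A| by rewrite card_dil ?unitK.
rewrite -(leq_pmul2r A1) -{1}tA -diffset_oppset; apply: leq_trans (ruzsa_triangle _ _ _) _.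
rewrite diffset_oppset -dilM -dil_sumset card_dil ?unitK //.
by apply: leq_trans (leq_mul (hRB tR) (hRD sR)) _; rewrite mulnACA mulnn mulnA.
Qed.

Lemma card_dil2N t s : t \in R -> s \in R ->
  (#|sumset A (dil (- (t * s))%R A)| <= K ^ 2 * #|A|)%N.
Proof.
move=> tR sR; have tA : #|dil t A| = #|A| by rewrite card_dil ?unitK.
rewrite -(leq_pmul2r A1) -{1}tA -oppset_dil sumset_oppset.
apply: leq_trans (ruzsa_triangle _ _ _) _.
rewrite -dilM -dil_diffset card_dil ?unitK //.
by apply: leq_trans (leq_mul (hRB tR) (hRB sR)) _; rewrite mulnACA mulnn mulnA.
Qed.

Let leK2 n : (n <= K * #|A| -> n <= K ^ 2 * #|A|)%N.
Proof.
move=> h; apply: leq_trans h _; rewrite leq_mul2r; apply/orP; right.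
by rewrite expnS expn1 leq_pmulr.
Qed.

Let M := ((8 * K ^ 2) ^ 8)%N.
Let M' := ((4 * K ^ 2) ^ 4)%N.

Let good q := exists s s', [/\ s \in R, s' \in R, s != s' &
  (#|R| <= 2 * M * #|dilates_into A R q s s'|)%N].

(** The identity (s - s') t (q + 1) i = t (i q (s - s')) + t (s - s') i carries the passage from q
    to q + 1. Its first term is controlled because i q (s - s') lies in A - A, its second because i
    itself does, which is the purpose of [sRD]. Together with (s - s') A this makes eight dilates of
    A, whence M = (8 K^2)^8; [sumset_count] concludes after division by s - s'. *)
Lemma count_step q s s' t : s \in R -> s' \in R -> s != s' -> t \in R ->
  (#|dilates_into A R q s s'| ^ 2 <= M *
    \sum_(i in dilates_into A R q s s') \sum_(j in dilates_into A R q s s')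
      ((t * (q + 1) * (i - j))%R \in diffset A A))%N.
Proof.
move=> sR s'R ss' tR; set R1 := dilates_into A R q s s'.
have d0 : s - s' != 0 by rewrite subr_eq0.
pose c := [:: s; - s'; t; - t; t * s; - (t * s); - (t * s'); t * s'].
pose W := sumsets [seq dil x A | x <- c].
have hW : (#|W| <= M * #|A|)%N.
  apply: (plunnecke_seq (L := (K ^ 2)%N)) => // B /mapP[x xc ->].
  move: x xc; apply/allP; rewrite /= !(card_dil2, card_dil2N) //.
  by rewrite !leK2 //; first [exact: card_dilN | exact: hRD].
have hmem a i : a \in dil (s - s') A -> i \in R1 -> a + (s - s') * (t * (q + 1) * i) \in W.
  case/imsetP=> a0 aA ->; rewrite inE => /andP[iR /diffsetP[a1 [a2 [a1A a2A e]]]].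
  have /diffsetP[a3 [a4 [a3A a4A e']]] := subsetP sRD _ iR.
  have -> : (s - s') * a0 + (s - s') * (t * (q + 1) * i) =
      s * a0 + (- s' * a0 + (t * a1 + (- t * a2 + (t * s * a3 + (- (t * s) * a4
       + (- (t * s') * a3 + (t * s' * a4 + 0))))))).
    have -> : (s - s') * (t * (q + 1) * i) = t * (i * q * (s - s')) + t * (s - s') * i by ring.
    by rewrite e e'; ring.
  by rewrite /W /=; do 8! [apply: mem_sumset; first exact: mem_dil]; rewrite inE.
have := sumset_count (dil0 (s - s') A0) hmem.
rewrite card_dil // => h; rewrite -(leq_pmul2l A1); apply: leq_trans h _.
rewrite mulnCA mulnA; apply: leq_mul => //.
apply: leq_sum => i _; apply: leq_sum => j _.
by rewrite -mulrBr -dil_diffset mem_dil_iff // -mulrBr.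
Qed.

Lemma good0 : (1 < #|R|)%N -> good 0.
Proof.
case/card_gt1P=> s [s' [sR s'R ss']]; exists s, s'; split=> //.
have -> : dilates_into A R 0 s s' = R.
  apply/setP=> r; rewrite inE; case: (r \in R) => //=.
  by case/set0Pn: A0 => a aA; apply/diffsetP; exists a, a; rewrite mulr0 mul0r subrr.
by rewrite leq_pmull // muln_gt0 /= /M expn_gt0 muln_gt0 expn_gt0 K0.
Qed.

(** The new pair s, s' is found inside the old set R1. Summing [count_step] over t in R, some
    off-diagonal pair (i, j) in R1 has t (q + 1) (i - j) in A - A for a positive proportion of t;
    the lower bound on |R| makes |R1| > 2 M, so the diagonal pairs cannot account for the total. *)
Lemma goodS q : (4 * M ^ 2 < #|R|)%N -> good q -> good (q + 1).
Proof.
move=> hR [s [s' [sR s'R ss' hg]]]; set R1 := dilates_into A R q s s' in hg.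
have hR1 : (2 * M < #|R1|)%N by nia.
case: (boolP [exists s1 in R1, exists s2 in R1, (s1 != s2) &&
   (#|R| <= 2 * M * #|dilates_into A R (q + 1)%R s1 s2|)%N]).
  have sub : {subset R1 <= R} by move=> x; rewrite inE => /andP[].
  case/exists_inP=> s1 s1R /exists_inP[s2 s2R /andP[s12 h]].
  by exists s1, s2; split; rewrite ?sub.
move=> /exists_inPn hn; exfalso.
have hsum : (#|R| * #|R1| ^ 2 <= M * \sum_(i in R1) \sum_(j in R1)
     #|dilates_into A R (q + 1)%R i j|)%N.
  rewrite -sum_nat_const.
  apply: leq_trans (leq_sum _ (fun t tR => count_step q sR s'R ss' tR)) _.
  rewrite -big_distrr leq_mul2l /= exchange_big; apply/orP; right.
  apply: leq_sum => i _; rewrite exchange_big; apply: leq_sum => j _.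
  by rewrite card_sum_nat.
have hb : (2 * M * \sum_(i in R1) \sum_(j in R1) #|dilates_into A R (q + 1)%R i j|
    <= #|R1| * (2 * M * #|R| + #|R1| * #|R|))%N.
  rewrite big_distrr -sum_nat_const; apply: leq_sum => i iR1 /=.
  rewrite (bigD1 i) //= mulnDr leq_add //.
    rewrite leq_mul2l; apply/orP; right; apply: subset_leq_card.
    by apply/subsetP=> x; rewrite inE => /andP[].
  rewrite big_distrr -sum_nat_const /= [leqRHS](bigD1 i) //=.
  apply: leq_trans (leq_addl _ _); apply: leq_sum => j /andP[jR1 ji].
  have /exists_inPn/(_ j jR1) := hn i iR1.
  by rewrite eq_sym ji /= -ltnNge => /ltnW.
have : (0 < #|R|)%N by apply: leq_ltn_trans hR.
nia.
Qed.

(** As in [count_step], but without a factor t: (s - s') A + (s - s') rho i stays in s A - s' A + A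
    - A, four dilates, whence M' = (4 K^2)^4. *)
Lemma good_count rho : good rho ->
  (#|R| ^ 2 <= 4 * M ^ 2 * M' * \sum_(i in R) \sum_(j in R)
      ((rho * (i - j))%R \in diffset A A))%N.
Proof.
move=> [s [s' [sR s'R ss' hg]]]; set R1 := dilates_into A R rho s s' in hg.
have d0 : s - s' != 0 by rewrite subr_eq0.
pose c := [:: s; - s'; 1; - 1].
pose W := sumsets [seq dil x A | x <- c].
have hW : (#|W| <= M' * #|A|)%N.
  apply: (plunnecke_seq (L := (K ^ 2)%N)) => // B /mapP[x xc ->].
  move: x xc; apply/allP; rewrite /= !leK2 //; try first [exact: card_dilN | exact: hRD].
    by rewrite -oppset_dil sumset_oppset dil1.
  by rewrite dil1.
have hmem a i : a \in dil (s - s') A -> i \in R1 -> a + (s - s') * (rho * i) \in W.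
  case/imsetP=> a0 aA ->; rewrite inE => /andP[iR /diffsetP[a1 [a2 [a1A a2A e]]]].
  have -> : (s - s') * a0 + (s - s') * (rho * i) =
      s * a0 + (- s' * a0 + (1 * a1 + (- 1 * a2 + 0))).
    have -> : (s - s') * (rho * i) = i * rho * (s - s') by ring.
    by rewrite e; ring.
  by rewrite /W /=; do 4! [apply: mem_sumset; first exact: mem_dil]; rewrite inE.
have := sumset_count (dil0 (s - s') A0) hmem.
rewrite card_dil // => h.
have h1 : (#|R1| ^ 2 <= M' * \sum_(i in R) \sum_(j in R)
      ((rho * (i - j))%R \in diffset A A))%N.
  have sR1 : R1 \subset R by apply/subsetP=> x; rewrite inE => /andP[].
  have sub (g : F -> nat) : (\sum_(i in R1) g i <= \sum_(i in R) g i)%N.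
    rewrite [leqRHS](bigID (mem R1)) /=; apply: leq_trans (leq_addr _ _).
    rewrite [leqRHS](eq_bigl (mem R1)) // => x.
    by apply: andb_idl => /(subsetP sR1).
  rewrite -(leq_pmul2l A1); apply: leq_trans h _.
  rewrite mulnCA mulnA; apply: leq_mul => //.
  apply: leq_trans (sub _); apply: leq_sum => i _.
  apply: leq_trans (sub _); apply: leq_sum => j _.
  by rewrite -mulrBr -dil_diffset mem_dil_iff // -mulrBr.
have : (#|R| ^ 2 <= (2 * M * #|R1|) ^ 2)%N by rewrite leq_exp2r.
move=> h2; apply: leq_trans h2 _.
by rewrite 2!expnMn (_ : 2 ^ 2 = 4)%N // -[leqRHS]mulnA leq_mul2l h1 orbT.
Qed.

End Fixed.

Lemma sum_over_dilates A R (K : nat) : (#|diffset A A| <= K * #|A|)%N ->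
  (\sum_rho \sum_(i in R) \sum_(j in R) ((rho * (i - j))%R \in diffset A A)
     <= #|R| * #|F| + #|R| ^ 2 * (K * #|A|))%N.
Proof.
move=> hK; rewrite exchange_big /=.
have -> : (#|R| * #|F| + #|R| ^ 2 * (K * #|A|) =
   \sum_(i in R) (#|F| + #|R| * (K * #|A|)))%N.
  by rewrite sum_nat_const; ring.
apply: leq_sum => i iR; rewrite exchange_big (bigD1 i) //=; apply: leq_add.
  by rewrite -sum1_card; apply: leq_sum => rho _; exact: leq_b1.
rewrite -sum_nat_const [leqRHS](bigD1 i) //=; apply: leq_trans (leq_addl _ _).
apply: leq_sum => j /andP[_ ji]; apply: leq_trans hK.
have d0 : i - j != 0 by rewrite subr_eq0 eq_sym.
have inj : injective (fun rho : F => rho * (i - j)) by exact: mulIf.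
rewrite -(card_imset _ (can_inj (divfK d0))) -sum1_card.
rewrite [leqRHS]big_mkcond; apply: leq_sum => rho _.
case: (boolP (rho * (i - j) \in _)) => //= h.
rewrite (_ : _ \in _ = true) //; apply/imsetP; exists (rho * (i - j)) => //.
by rewrite mulfK.
Qed.

End SumProduct.

Section PrimeField.
Variables (p : nat) (pr_p : prime p).
Implicit Types A R : {set 'F_p}.

(** This is where the prime field matters: every element is a sum of ones, while in a proper
    extension the same steps would stop at the prime subfield. *)
Lemma Fp_additive_ind (Q : 'F_p -> Prop) :
  Q 0 -> (forall q, Q q -> Q (q + 1)) -> forall q, Q q.
Proof.
move=> Q0 QS q; rewrite -[q]natr_Zp.
by elim: (nat_of_ord q) => [|n IH]; rewrite ?mulr0n // mulrSr; apply: QS.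
Qed.

(** Every rho is good, so [good_count] bounds from below the number of triples with rho (i - j) in A
    - A, whereas for i != j only |A - A| values of rho qualify. With X = 4 M^2 M' = 2^58 K^40 this
    gives p |R| <= X (p + K |A| |R|), and p >= 2 X K |A| absorbs the last term, leaving |R| <= 2
    X. *)
Lemma sum_product_contained A R (K : nat) : A != set0 -> (0 < K)%N -> 0 \notin R ->
  (#|sumset A A| <= K * #|A|)%N -> (#|diffset A A| <= K * #|A|)%N ->
  (forall r, r \in R -> (#|sumset A (dil r A)| <= K * #|A|)%N) ->
  (forall r, r \in R -> (#|diffset A (dil r A)| <= K * #|A|)%N) ->
  R \subset diffset A A -> (2 ^ 59 * K ^ 41 * #|A| <= p)%N ->
  (#|R| <= 2 ^ 59 * K ^ 40)%N.
Proof.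
move=> A0 K0 R0 hAD hAB hRD hRB sRD hp; rewrite leqNgt; apply/negP => hR.
pose M := ((8 * K ^ 2) ^ 8)%N; pose M' := ((4 * K ^ 2) ^ 4)%N.
have eM : (2 * (4 * M ^ 2 * M') = 2 ^ 59 * K ^ 40)%N.
  have h8 : (8 = 2 ^ 3)%N by [].
  have h4 : (4 = 2 ^ 2)%N by [].
  have -> : M = (2 ^ (3 * 8) * K ^ (2 * 8))%N by rewrite /M {1}h8 expnMn -!expnM.
  have -> : M' = (2 ^ (2 * 4) * K ^ (2 * 4))%N by rewrite /M' {1}h4 expnMn -!expnM.
  rewrite {1}h4 expnMn -!expnM (_ : 59 = 1 + 2 + 3 * 8 * 2 + 2 * 4)%N //.
  rewrite (_ : 40 = 2 * 8 * 2 + 2 * 4)%N // !expnD expn1.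
  move: (2 ^ 2)%N (2 ^ (3 * 8 * 2))%N (K ^ (2 * 8 * 2))%N (2 ^ (2 * 4))%N (K ^ (2 * 4))%N.
  by move=> *; ring.
have M'0 : (0 < M')%N by rewrite expn_gt0 muln_gt0 expn_gt0 K0.
have M0 : (0 < M)%N by rewrite expn_gt0 muln_gt0 expn_gt0 K0.
have hR2 : (2 * (4 * M ^ 2 * M') < #|R|)%N by rewrite eM.
have hM : (4 * M ^ 2 < #|R|)%N.
  by apply: leq_ltn_trans hR2; move: (4 * M ^ 2)%N => u; clear -M'0; nia.
have hall : forall rho : 'F_p, exists s s', [/\ s \in R, s' \in R, s != s' &
  (#|R| <= 2 * M * #|dilates_into A R rho s s'|)%N].
  apply: Fp_additive_ind.
    apply: (@good0 _ A R K A0 K0); apply: leq_ltn_trans hM.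
    by rewrite muln_gt0 expn_gt0 M0.
  by move=> q hq; apply: (@goodS _ A R K).
have cnt rho : (#|R| ^ 2 <= 4 * M ^ 2 * M' * \sum_(i in R) \sum_(j in R)
    ((rho * (i - j))%R \in diffset A A))%N by apply: (@good_count _ A R K).
have : (\sum_(rho : 'F_p) #|R| ^ 2 <= 4 * M ^ 2 * M' * (#|R| * #|{: 'F_p}| + #|R| ^ 2 * (K * #|A|)))%N.
  apply: leq_trans (leq_mul (leqnn _) (sum_over_dilates R hAB)).
  by rewrite big_distrr; apply: leq_sum => rho _; exact: cnt.
rewrite sum_nat_const card_Fp // => h.
have R1 : (0 < #|R|)%N by apply: leq_ltn_trans hR.
have hX : (p * #|R| <= 4 * M ^ 2 * M' * (p + #|R| * (K * #|A|)))%N.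
  rewrite -(leq_pmul2r R1) -[leqLHS]mulnA mulnn; apply: leq_trans h _.
  by move: (4 * M ^ 2 * M')%N => X; clear; lia.
have hp2 : (2 * (4 * M ^ 2 * M') * K * #|A| <= p)%N.
  by rewrite eM -[(2 ^ 59 * _ * _)%N]mulnA -expnSr.
move: hX hp2 hR2 R1; move: (4 * M ^ 2 * M')%N => X hX hp2 hR2 R1.
have : (0 < p)%N by apply: prime_gt0.
clear -hX hp2 hR2 R1 => p0; nia.
Qed.

(** The inclusion of R in A - A is gained by rescaling: averaging finds a != b in A such that r (a -
    b) is in A - A for at least |R| / (2 K) elements r, and A is replaced by its dilate by 1 / (a -
    b). The condition 2 K < |A| excludes that only the diagonal a = b contributes, and the loss 2 K
    turns 2^59 K^40 into 2^60 K^41. *)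
Lemma sum_product A R (K : nat) : (0 < K)%N -> 0 \notin R ->
  (2 * K < #|A|)%N ->
  (#|sumset A A| <= K * #|A|)%N -> (#|diffset A A| <= K * #|A|)%N ->
  (forall r, r \in R -> (#|sumset A (dil r A)| <= K * #|A|)%N) ->
  (forall r, r \in R -> (#|diffset A (dil r A)| <= K * #|A|)%N) ->
  (2 ^ 59 * K ^ 41 * #|A| <= p)%N -> (#|R| <= 2 ^ 60 * K ^ 41)%N.
Proof.
move=> K0 R0 hA hAD hAB hRD hRB hp.
have A1 : (0 < #|A|)%N by apply: leq_ltn_trans hA.
have A0 : A != set0 by rewrite -card_gt0.
pose g (a b : 'F_p) := (\sum_(r in R) ((r * (a - b))%R \in diffset A A))%N.
have hr r : r \in R -> (#|A| ^ 2 <= K * \sum_(a in A) \sum_(b in A)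
    ((r * (a - b))%R \in diffset A A))%N.
  move=> rR; have hm a i : a \in A -> i \in A -> a + r * i \in sumset A (dil r A).
    by move=> aA iA; rewrite mem_sumset // mem_dil.
  have := sumset_count A0 hm.
  move=> h; rewrite -(leq_pmul2l A1); apply: leq_trans h _.
  rewrite mulnCA mulnA; apply: leq_mul; first by rewrite hRD.
  by apply: leq_sum => i _; apply: leq_sum => j _; rewrite -mulrBr.
have hsum : (#|R| * #|A| ^ 2 <= K * \sum_(a in A) \sum_(b in A) g a b)%N.
  rewrite -sum_nat_const; apply: leq_trans (leq_sum _ hr) _.
  rewrite -big_distrr leq_mul2l exchange_big /=; apply/orP; right.
  by apply: leq_sum => a _; rewrite exchange_big.
have [->|Rn0] := eqVneq R set0; first by rewrite cards0.
have R1 : (0 < #|R|)%N by rewrite card_gt0.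
case: (boolP [exists a in A, exists b in A, (a != b) && (#|R| <= 2 * K * g a b)%N]).
  case/exists_inP=> a aA /exists_inP[b bA /andP[ab hg]].
  have d0 : a - b != 0 by rewrite subr_eq0.
  pose S := [set r in R | r * (a - b) \in diffset A A].
  have gS : g a b = #|S| by rewrite card_sum_nat.
  have sSR : S \subset R by apply/subsetP=> x; rewrite inE => /andP[].
  have i0 : (a - b)^-1 != 0 by rewrite invr_eq0.
  have sc : (#|S| <= 2 ^ 59 * K ^ 40)%N.
    apply: (@sum_product_contained (dil (a - b)^-1 A)) => //.
    - exact: dil0.
    - by apply: contra R0; exact: (subsetP sSR).
    - by rewrite -dil_sumset !card_dil.
    - by rewrite -dil_diffset !card_dil.
    - move=> r rS; rewrite dilM mulrC -dilM -dil_sumset !card_dil //.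
      by rewrite hRD // (subsetP sSR).
    - move=> r rS; rewrite dilM mulrC -dilM -dil_diffset !card_dil //.
      by rewrite hRB // (subsetP sSR).
    - apply/subsetP=> r; rewrite inE => /andP[_ hD].
      by rewrite -dil_diffset -(mem_dil_iff _ _ d0) dilM mulfV // dil1 mulrC.
    - by rewrite card_dil.
  rewrite gS in hg; apply: leq_trans hg _.
  apply: leq_trans (leq_mul (leqnn (2 * K)%N) sc) _.
  rewrite (expnS 2 59) (expnS K 40).
  by move: (2 ^ 59)%N (K ^ 40)%N => u v; rewrite mulnACA leqnn.
move=> /exists_inPn hn; exfalso.
have hb : (2 * K * \sum_(a in A) \sum_(b in A) g a b
    <= #|A| * (2 * K * #|R| + #|A| * #|R|))%N.
  rewrite big_distrr -sum_nat_const; apply: leq_sum => i iA /=.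
  rewrite (bigD1 i) //= mulnDr leq_add //.
    by rewrite leq_mul2l /g -card_sum_nat; apply/orP; right; apply: subset_leq_card;
      apply/subsetP=> x; rewrite inE => /andP[].
  rewrite big_distrr -sum_nat_const /= [leqRHS](bigD1 i) //=.
  apply: leq_trans (leq_addl _ _); apply: leq_sum => j /andP[jA ji].
  have /exists_inPn/(_ j jA) := hn i iA.
  by rewrite eq_sym ji /= -ltnNge => /ltnW.
move: hsum hb hA R1 A1; clear; set s := (\sum_(a in A) _)%N; nia.
Qed.

End PrimeField.

(** * Complex absolute values and additive characters *)

Section Modulus.
Variable R : realType.
Implicit Types (z w : R[i]) (x y : R).

Definition cabs z : R := ComplexField.Normc.normc z.

Lemma cabsE z : cabs z = Num.sqrt (complex.Re z ^+ 2 + complex.Im z ^+ 2).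
Proof. by case: z. Qed.

Lemma cabs_ge0 z : 0 <= cabs z.
Proof. by rewrite cabsE sqrtr_ge0. Qed.

Lemma cabsM z w : cabs (z * w) = cabs z * cabs w.
Proof. exact: ComplexField.Normc.normcM. Qed.

Lemma cabsD z w : cabs (z + w) <= cabs z + cabs w.
Proof. exact: le_normcD. Qed.

Lemma cabs0 : cabs 0 = 0.
Proof. exact: ComplexField.Normc.normc0. Qed.

Lemma cabs1 : cabs 1 = 1.
Proof. exact: ComplexField.Normc.normc1. Qed.

Lemma cabsR x : cabs (real_complex R x) = `|x|.
Proof. by rewrite cabsE /= expr0n addr0 sqrtr_sqr. Qed.

Lemma cabs_sum (I : Type) (r : seq I) (P : pred I) (F : I -> R[i]) :
  cabs (\sum_(i <- r | P i) F i) <= \sum_(i <- r | P i) cabs (F i).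
Proof.
elim/big_rec2: _ => [|i x z _ le]; first by rewrite cabs0.
by apply: le_trans (cabsD _ _) _; rewrite lerD2l.
Qed.

Lemma cabs_prod (I : Type) (r : seq I) (P : pred I) (F : I -> R[i]) :
  cabs (\prod_(i <- r | P i) F i) = \prod_(i <- r | P i) cabs (F i).
Proof. by elim/big_rec2: _ => [|i x z _ <-]; rewrite ?cabs1 ?cabsM. Qed.

Lemma cabsX z n : cabs (z ^+ n) = cabs z ^+ n.
Proof. by elim: n => [|n IH]; rewrite ?expr0 ?cabs1 // !exprS cabsM IH. Qed.

Lemma cabs_conj z : cabs (conjc z) = cabs z.
Proof. by case: z => a b; rewrite !cabsE /= sqrrN. Qed.

Lemma sqr_cabs z : real_complex R (cabs z ^+ 2) = z * conjc z.
Proof.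
case: z => a b; rewrite cabsE sqr_sqrtr ?addr_ge0 ?sqr_ge0 //=.
by apply/eqP; rewrite eq_complex /=; apply/andP; split; apply/eqP; ring.
Qed.

Lemma conjcM z w : conjc (z * w) = conjc z * conjc w.
Proof. exact: (rmorphM conjc). Qed.

Lemma conjc_sum (I : Type) (r : seq I) (P : pred I) (F : I -> R[i]) :
  conjc (\sum_(i <- r | P i) F i) = \sum_(i <- r | P i) conjc (F i).
Proof. exact: (rmorph_sum conjc). Qed.

Lemma real_complexM x y :
  real_complex R (x * y) = real_complex R x * real_complex R y.
Proof. exact: (rmorphM (real_complex R)). Qed.

Lemma real_complex_sum (I : Type) (r : seq I) (P : pred I) (F : I -> R) :
  real_complex R (\sum_(i <- r | P i) F i) = \sum_(i <- r | P i) real_complex R (F i).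
Proof. exact: rmorph_sum. Qed.

(** The square is opened and the sums exchanged before the triangle inequality is applied, so
    cancellation in the sum over i survives. *)
Lemma sum_sqr_cabs (I J : finType) (P : pred I) (Q : pred J) (g : I -> J -> R[i]) :
  \sum_(i | P i) cabs (\sum_(j | Q j) g i j) ^+ 2 <=
  \sum_(j | Q j) \sum_(k | Q k) cabs (\sum_(i | P i) g i j * conjc (g i k)).
Proof.
have e : real_complex R (\sum_(i | P i) cabs (\sum_(j | Q j) g i j) ^+ 2) =
    \sum_(j | Q j) \sum_(k | Q k) \sum_(i | P i) g i j * conjc (g i k).
  rewrite real_complex_sum.
  under eq_bigr => i _.
    rewrite sqr_cabs conjc_sum big_distrl /=.
    under eq_bigr do rewrite big_distrr /=.
    over.
  by rewrite exchange_big; apply: eq_bigr => j _; rewrite exchange_big.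
have -> : \sum_(i | P i) cabs (\sum_(j | Q j) g i j) ^+ 2 =
    cabs (real_complex R (\sum_(i | P i) cabs (\sum_(j | Q j) g i j) ^+ 2)).
  by rewrite cabsR ger0_norm // sumr_ge0 // => i _; rewrite sqr_ge0.
rewrite e; apply: le_trans (cabs_sum _ _ _) _; apply: ler_sum => j _.
exact: cabs_sum.
Qed.

End Modulus.

Section Inequalities.
Variable R : realType.

Lemma cauchy_schwarz (I : Type) (r : seq I) (P : pred I) (a b : I -> R) :
  (\sum_(i <- r | P i) a i * b i) ^+ 2 <=
  (\sum_(i <- r | P i) a i ^+ 2) * (\sum_(i <- r | P i) b i ^+ 2).
Proof.
have -> : (\sum_(i <- r | P i) a i * b i) ^+ 2 =
   \sum_(i <- r | P i) \sum_(j <- r | P j) a i * b i * (a j * b j).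
  by rewrite expr2 big_distrl; apply: eq_bigr => i _; rewrite big_distrr.
have e : (\sum_(i <- r | P i) a i ^+ 2) * (\sum_(i <- r | P i) b i ^+ 2) =
   \sum_(i <- r | P i) \sum_(j <- r | P j) a i ^+ 2 * b j ^+ 2.
  by rewrite big_distrl; apply: eq_bigr => i _; rewrite big_distrr.
have e' : (\sum_(i <- r | P i) a i ^+ 2) * (\sum_(i <- r | P i) b i ^+ 2) =
   \sum_(i <- r | P i) \sum_(j <- r | P j) a j ^+ 2 * b i ^+ 2.
  by rewrite e exchange_big.
rewrite -(ler_pM2l (ltr0n R 2)) [leRHS](_ : _ = (\sum_(i <- r | P i) a i ^+ 2) *
  (\sum_(i <- r | P i) b i ^+ 2) + (\sum_(i <- r | P i) a i ^+ 2) *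
  (\sum_(i <- r | P i) b i ^+ 2)); last by rewrite mulr_natl mulr2n.
rewrite {1}e e' -big_split /= big_distrr /=; apply: ler_sum => i _.
rewrite -big_split /= big_distrr /=; apply: ler_sum => j _.
by have := sqr_ge0 (a i * b j - a j * b i); nra.
Qed.

Lemma sum_sqr_le (I : finType) (A : {set I}) (a : I -> R) :
  (\sum_(i in A) a i) ^+ 2 <= #|A|%:R * \sum_(i in A) a i ^+ 2.
Proof.
have := cauchy_schwarz (index_enum I) (mem A) (fun=> 1) a.
under eq_bigr do rewrite mul1r.
by under [X in X * _]eq_bigr do rewrite expr1n; rewrite sumr_const.
Qed.

(* Chebyshev's sum inequality gives the induction step. *)
Lemma power_mean (I : finType) (A : {set I}) (a : I -> R) n :
  (forall i, i \in A -> 0 <= a i) ->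
  (\sum_(i in A) a i) ^+ n.+1 <= #|A|%:R ^+ n * \sum_(i in A) a i ^+ n.+1.
Proof.
move=> a0; elim: n => [|n IH].
  by rewrite expr0 mul1r expr1; under [leRHS]eq_bigr do rewrite expr1.
have s0 : 0 <= \sum_(i in A) a i by apply: sumr_ge0.
have cheb : (\sum_(i in A) a i) * (\sum_(i in A) a i ^+ n.+1) <=
    #|A|%:R * \sum_(i in A) a i ^+ n.+2.
  have e1 : (\sum_(i in A) a i) * (\sum_(i in A) a i ^+ n.+1) =
     \sum_(i in A) \sum_(j in A) a i * a j ^+ n.+1.
    by rewrite big_distrl; apply: eq_bigr => i _; rewrite big_distrr.
  have e2 : (\sum_(i in A) a i) * (\sum_(i in A) a i ^+ n.+1) =
     \sum_(i in A) \sum_(j in A) a j * a i ^+ n.+1.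
    by rewrite e1 exchange_big.
  have e3 : #|A|%:R * \sum_(i in A) a i ^+ n.+2 = \sum_(i in A) \sum_(j in A) a i ^+ n.+2.
    rewrite big_distrr; apply: eq_bigr => i _ /=.
    by rewrite sumr_const mulr_natl.
  have e4 : #|A|%:R * \sum_(i in A) a i ^+ n.+2 = \sum_(i in A) \sum_(j in A) a j ^+ n.+2.
    by rewrite e3 exchange_big.
  suff : (\sum_(i in A) a i) * (\sum_(i in A) a i ^+ n.+1) +
      (\sum_(i in A) a i) * (\sum_(i in A) a i ^+ n.+1) <=
    #|A|%:R * (\sum_(i in A) a i ^+ n.+2) + #|A|%:R * \sum_(i in A) a i ^+ n.+2 by lra.
  rewrite {1}e1 e2 {1}e3 e4 -!big_split /=; apply: ler_sum => i iA.
  rewrite -!big_split /=; apply: ler_sum => j jA.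
  have ai := a0 _ iA; have aj := a0 _ jA.
  rewrite !(exprS _ n.+1) -subr_ge0.
  have -> : a i * a i ^+ n.+1 + a j * a j ^+ n.+1 -
     (a i * a j ^+ n.+1 + a j * a i ^+ n.+1) = (a i - a j) * (a i ^+ n.+1 - a j ^+ n.+1).
    by ring.
  have [le|lt] := leP (a i) (a j).
    by rewrite -mulrNN mulr_ge0 // opprB subr_ge0 // lerXn2r.
  by rewrite mulr_ge0 ?subr_ge0 ?(ltW lt) // lerXn2r // ltW.
rewrite exprS; apply: le_trans (ler_wpM2l s0 IH) _.
rewrite mulrCA [_ ^+ n.+1]exprSr -[leRHS]mulrA.
by apply: ler_wpM2l => //; rewrite exprn_ge0 // ler0n.
Qed.

End Inequalities.

Section Character.
Variables (R : realType) (p : nat).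
Hypothesis pr_p : prime p.
Local Notation e := (@addchar R p).

(** [addchar] on unreduced exponents: there multiplicativity is the addition formula, and reduction
    modulo p is harmless because the value at p is 1. *)
Definition root_pow (k : nat) : R[i] :=
  let theta : R := 2 * pi * k%:R / p%:R in Complex (cos theta) (sin theta).

Lemma root_powD k l : root_pow (k + l) = root_pow k * root_pow l.
Proof.
rewrite /root_pow natrD mulrDr mulrDl cosD sinD.
by apply/eqP; rewrite eq_complex /=; apply/andP; split; apply/eqP; ring.
Qed.

Let p0 : (p%:R : R) != 0. Proof. by rewrite pnatr_eq0 -lt0n prime_gt0. Qed.

Lemma root_pow_p : root_pow p = 1.
Proof.
rewrite /root_pow mulfK // mulr_natl cos2pi.
by rewrite (_ : sin _ = 0) // sin_mulr2n sinpi mulr0 mul0rn.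
Qed.

Lemma root_pow0 : root_pow 0 = 1.
Proof. by rewrite /root_pow mulr0 mul0r cos0 sin0. Qed.

Lemma root_pow_mul k : root_pow (k * p) = 1.
Proof. by elim: k => [|k IH]; rewrite ?mul0n ?root_pow0 // mulSn root_powD root_pow_p IH mulr1. Qed.

Lemma addcharD x y : e (x + y) = e x * e y.
Proof.
have -> : e (x + y) = root_pow ((x + y)%R : 'F_p) by [].
have -> : (((x + y)%R : 'F_p) : nat) = ((x + y) %% p)%N.
  by rewrite /=; congr modn; exact: Fp_cast.
have -> : root_pow ((x + y) %% p) = root_pow (x + y).
  by rewrite [in RHS](divn_eq (x + y) p) root_powD root_pow_mul mul1r.
by rewrite root_powD.
Qed.

Lemma addchar0 : e 0 = 1.
Proof. exact: root_pow0. Qed.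

Lemma cabs_addchar x : cabs (e x) = 1.
Proof. by rewrite cabsE /= cos2Dsin2 sqrtr1. Qed.

Lemma addcharN x : e (- x) = conjc (e x).
Proof.
have h : e x * e (- x) = 1 by rewrite -addcharD subrr addchar0.
have h' : e x * conjc (e x) = 1 by rewrite -sqr_cabs cabs_addchar expr1n.
have x0 : e x != 0 by apply: contra_eq_neq h => ->; rewrite mul0r eq_sym oner_eq0.
by apply: (mulfI x0); rewrite h h'.
Qed.

Lemma addchar1_neq1 : e 1 != 1.
Proof.
have -> : e 1 = root_pow 1 by [].
rewrite eq_complex /= negb_and; apply/orP; left.
rewrite mulr1; pose t : R := pi / p%:R.
have -> : 2 * pi / p%:R = t + t :> R by rewrite /t; field.
rewrite cosD -!expr2.
have p1 : (1 < p%:R :> R) by rewrite ltr1n prime_gt1.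
have t0 : 0 < t by rewrite divr_gt0 ?pi_gt0 // (lt_trans ltr01).
have tpi : t < pi by rewrite ltr_pdivrMr ?(lt_trans ltr01) // ltr_pMr ?pi_gt0.
have st : 0 < sin t by rewrite sin_gt0_pi // t0 tpi.
have := cos2Dsin2 t => h.
have : 0 < sin t ^+ 2 by rewrite exprn_gt0.
by apply: contraTneq => e1; lra.
Qed.

Lemma sum_addchar y : \sum_(x : 'F_p) e (x * y) = if y == 0 then p%:R else 0.
Proof.
case: eqP => [->|/eqP y0].
  under eq_bigr do rewrite mulr0 addchar0.
  by rewrite sumr_const card_Fp.
have eS : \sum_(x : 'F_p) e (x * y) = \sum_(x : 'F_p) e x.
  rewrite [RHS](reindex (fun x => x * y)) //=.
  by exists (fun x => x / y) => x _; rewrite ?mulfK ?divfK.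
rewrite eS; have : (e 1 - 1) * \sum_(x : 'F_p) e x = 0.
  rewrite mulrBl mul1r big_distrr /=.
  under eq_bigr do rewrite -addcharD.
  rewrite [X in _ - X](reindex (fun x => 1 + x)) /= ?subrr //.
  by exists (fun x => x - 1) => x _; rewrite ?addrA ?subrK // addrC addKr.
by move/eqP; rewrite mulf_eq0 subr_eq0 (negbTE addchar1_neq1) /= => /eqP.
Qed.

End Character.

(** * Additive energy and Fourier estimates modulo p *)

Lemma sum_natr_eq (R : pzSemiRingType) (I : finType) (P : {set I}) (x : I) :
  \sum_(v in P) (x == v)%:R = (x \in P)%:R :> R.
Proof. by rewrite -natr_sum sum_eq_nat. Qed.

(** Reading a + b = a' + b' as a - a' = b' - b makes the energy a second moment of differences, the
    form used both by [bsg] and by Parseval. *)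
Lemma additive_energy_drep (G : finZmodType) (B : {set G}) :
  additive_energy B B = (\sum_v drep B v ^ 2)%N.
Proof.
have -> : additive_energy B B = (\sum_(a in B) \sum_(a' in B) \sum_(b in B) \sum_(b' in B)
    (a + b == a' + b')%R)%N.
  pose Q a a' b b' := [&& a \in B, a' \in B, b \in B, b' \in B & a + b == a' + b'].
  have -> : additive_energy B B = (\sum_a \sum_a' \sum_b \sum_b' Q a a' b b')%N.
    rewrite pair_bigA /=; under eq_bigr do rewrite pair_bigA /=.
    rewrite pair_bigA /= /additive_energy -sum1_card big_mkcond /=.
    by apply: eq_bigr => q _; rewrite inE /Q; case: ifP.
  rewrite [RHS]big_mkcond; apply: eq_bigr => a _; rewrite /Q.
  case: (a \in B); last by rewrite !big1 // => *; rewrite !big1 // => *; rewrite !big1.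
  rewrite [RHS]big_mkcond; apply: eq_bigr => a' _.
  case: (a' \in B); last by rewrite !big1 // => *; rewrite !big1.
  rewrite [RHS]big_mkcond; apply: eq_bigr => b _.
  case: (b \in B); last by rewrite !big1.
  by rewrite [RHS]big_mkcond; apply: eq_bigr => b' _; case: (b' \in B).
have -> : (\sum_v drep B v ^ 2 = \sum_v \sum_(a in B) \sum_(a' in B)
     \sum_(b' in B) \sum_(b in B) ((a - a')%R == v) * ((b' - b)%R == v))%N.
  apply: eq_bigr => v _; rewrite expnS expn1 /drep big_distrl; apply: eq_bigr => a _ /=.
  rewrite big_distrl; apply: eq_bigr => a' _ /=; rewrite big_distrr; apply: eq_bigr => b' _ /=.
  by rewrite big_distrr.
rewrite [RHS]exchange_big; apply: eq_bigr => a _.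
rewrite [RHS]exchange_big; apply: eq_bigr => a' _.
rewrite [RHS]exchange_big [LHS]exchange_big; apply: eq_bigr => b' _.
rewrite [RHS]exchange_big; apply: eq_bigr => b _ /=.
rewrite (bigD1 (a - a')) //= eqxx mul1n big1 => [|v /negbTE vn].
  rewrite addn0; congr nat_of_bool; apply/eqP/eqP => h.
    by apply/eqP; rewrite subr_eq addrAC h [a' + b']addrC addrK.
  by move/eqP: h; rewrite subr_eq => /eqP ->; rewrite addrA [a' + _]addrC subrK.
by rewrite eq_sym vn mul0n.
Qed.

Section Fourier.
Variables (R : realType) (p : nat).
Hypothesis pr_p : prime p.
Local Notation e := (@addchar R p).
Implicit Types (g h : 'F_p -> R[i]) (B : {set 'F_p}).

Lemma reindex_mul (T : nmodType) (c : 'F_p) (F : 'F_p -> T) : c != 0 ->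
  \sum_x F (c * x) = \sum_x F x.
Proof.
move=> c0; rewrite [RHS](reindex (fun x => c * x)) //=.
by exists (fun x => c^-1 * x) => x _; rewrite ?mulKf ?mulVKf.
Qed.

Lemma parseval_le g :
  \sum_x cabs (\sum_v g v * e (v * x)) ^+ 2 <= p%:R * \sum_v cabs (g v) ^+ 2.
Proof.
apply: le_trans (sum_sqr_cabs _ _ _) _.
rewrite big_distrr /=; apply: ler_sum => v _.
rewrite (bigD1 v) //= [X in _ + X]big1 ?addr0 => [|k kv].
  under eq_bigr do rewrite -sqr_cabs cabsM cabs_addchar mulr1.
  by rewrite sumr_const card_Fp // -raddfMn cabsR ger0_norm ?mulrn_wge0 ?sqr_ge0 // mulr_natl.
under eq_bigr => x _.
  rewrite conjcM -addcharN // mulrACA -addcharD //.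
  rewrite (_ : v * x - k * x = x * (v - k)); last by ring.
  over.
by rewrite -big_distrr /= sum_addchar // subr_eq0 eq_sym (negbTE kv) mulr0 cabs0.
Qed.

Lemma bilinear_bound g h (c : 'F_p) : c != 0 ->
  cabs (\sum_v \sum_w g v * h w * e (c * v * w)) ^+ 2 <=
  p%:R * (\sum_v cabs (g v) ^+ 2) * (\sum_w cabs (h w) ^+ 2).
Proof.
move=> c0; pose H x := \sum_w h w * e (w * x).
have h1 : cabs (\sum_v \sum_w g v * h w * e (c * v * w)) <=
    \sum_v cabs (g v) * cabs (H (c * v)).
  apply: le_trans (cabs_sum _ _ _) _; apply: ler_sum => v _.
  rewrite -cabsM /H big_distrr /= le_eqVlt; apply/orP; left; apply/eqP; congr cabs.
  by apply: eq_bigr => w _; rewrite mulrA [w * _]mulrC.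
have s0 : 0 <= \sum_v cabs (g v) * cabs (H (c * v)).
  by apply: sumr_ge0 => v _; rewrite mulr_ge0 ?cabs_ge0.
apply: (@le_trans _ _ ((\sum_v cabs (g v) * cabs (H (c * v))) ^+ 2)).
  by rewrite lerXn2r ?nnegrE ?cabs_ge0.
apply: le_trans (cauchy_schwarz _ _ _ _) _; rewrite mulrAC mulrC.
apply: ler_wpM2r; first by apply: sumr_ge0 => v _; rewrite sqr_ge0.
by rewrite (reindex_mul (fun x => cabs (H x) ^+ 2) c0) parseval_le.
Qed.

(* The coefficients of the trigonometric polynomial [|sum_b t_b e(b x)|^2]. *)
Definition autocorr B (t : 'F_p -> R[i]) (v : 'F_p) : R[i] :=
  \sum_(b in B) \sum_(d in B) t b * conjc (t d) * (b - d == v)%:R.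

Lemma autocorrE B t x :
  real_complex R (cabs (\sum_(b in B) t b * e (b * x)) ^+ 2) =
  \sum_v autocorr B t v * e (v * x).
Proof.
rewrite sqr_cabs conjc_sum big_distrl /=.
under [RHS]eq_bigr => v _.
  rewrite /autocorr big_distrl /=; under eq_bigr do rewrite big_distrl /=; over.
rewrite exchange_big; apply: eq_bigr => b _ /=; rewrite exchange_big big_distrr.
apply: eq_bigr => d _ /=; rewrite (bigD1 (b - d)) //= eqxx mulr1 big1 => [|v vn].
  rewrite addr0 conjcM -addcharN // mulrACA -addcharD //; congr (_ * e _).
  by ring.
by rewrite eq_sym (negbTE vn) mulr0 mul0r.
Qed.

Lemma autocorr_le B t v : (forall b, cabs (t b) <= 1) ->
  cabs (autocorr B t v) <= (drep B v)%:R.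
Proof.
move=> t1; apply: le_trans (cabs_sum _ _ _) _; rewrite natr_sum.
apply: ler_sum => b _; apply: le_trans (cabs_sum _ _ _) _; rewrite natr_sum.
apply: ler_sum => d _; rewrite !cabsM cabs_conj.
case: (_ == v); last by rewrite cabs0 mulr0.
by rewrite cabs1 mulr1 mulr_ile1 ?cabs_ge0.
Qed.

(** Parseval for the squared modulus, whose coefficients [autocorr] are dominated by [drep] whatever
    the phases t are. *)
Lemma fourth_moment B t : (forall b, cabs (t b) <= 1) ->
  \sum_x cabs (\sum_(b in B) t b * e (b * x)) ^+ 4 <=
  p%:R * (additive_energy B B)%:R.
Proof.
move=> t1.
have -> : \sum_x cabs (\sum_(b in B) t b * e (b * x)) ^+ 4 =
    \sum_x cabs (\sum_v autocorr B t v * e (v * x)) ^+ 2.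
  apply: eq_bigr => x _; rewrite -autocorrE cabsR ger0_norm ?sqr_ge0 //.
  by rewrite -exprM.
apply: le_trans (parseval_le _) _; apply: ler_wpM2l => //.
rewrite additive_energy_drep natr_sum; apply: ler_sum => v _.
by rewrite natrX lerXn2r ?nnegrE ?cabs_ge0 // autocorr_le.
Qed.

Lemma quad_split (k b1 b2 : 'F_p) :
  e (- (b1 - b2) ^+ 2 * k) = e (- b1 ^+ 2 * k) * e (- b2 ^+ 2 * k) * e (b1 * (2 * k * b2)).
Proof. by rewrite -!addcharD //; congr e; ring. Qed.

(** By [quad_split] the inner sum is, up to a phase, a trigonometric polynomial at 2 k b2. These
    points are distinct, so after the power mean inequality the sum over b2 can be completed to the
    whole field, where [fourth_moment] applies. *)
Lemma low_energy_bound B B2 (k : 'F_p) : 2 * k != 0 ->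
  (\sum_(b2 in B2) cabs (\sum_(b in B) e (- (b - b2) ^+ 2 * k))) ^+ 4 <=
  #|B2|%:R ^+ 3 * (p%:R * (additive_energy B B)%:R).
Proof.
move=> k0; pose t b := e (- b ^+ 2 * k).
have -> : \sum_(b2 in B2) cabs (\sum_(b in B) e (- (b - b2) ^+ 2 * k)) =
   \sum_(b2 in B2) cabs (\sum_(b in B) t b * e (b * (2 * k * b2))).
  apply: eq_bigr => b2 _.
  have -> : \sum_(b in B) e (- (b - b2) ^+ 2 * k) =
     e (- b2 ^+ 2 * k) * \sum_(b in B) t b * e (b * (2 * k * b2)).
    by rewrite big_distrr; apply: eq_bigr => b _ /=; rewrite quad_split /t; ring.
  by rewrite cabsM cabs_addchar mul1r.
apply: le_trans (power_mean 3 _) _ => [b2 _|]; first exact: cabs_ge0.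
apply: ler_wpM2l; first by rewrite exprn_ge0.
have t1 b : cabs (t b) <= 1 by rewrite cabs_addchar.
apply: le_trans (fourth_moment B t1).
rewrite -[leRHS](reindex_mul _ k0) [leRHS](bigID (mem B2)) /= lerDl.
by apply: sumr_ge0 => x _; rewrite exprn_ge0 ?cabs_ge0.
Qed.

(** Three applications of Cauchy-Schwarz: S^2 <= |B1| X and X^2 <= |B2|^2 Y, where X and Y weight
    the first and second powers of |f| by the differences of B2; then Y is a bilinear form in the
    difference counts of B2 and the autocorrelation of B1, with Y^2 at most p times both
    energies. *)
Lemma pair_energy_bound B1 B2 (k : 'F_p) : 2 * k != 0 ->
  cabs (\sum_(b1 in B1) \sum_(b2 in B2) e (- (b1 - b2) ^+ 2 * k)) ^+ 8 <=
  (#|B1|%:R * #|B2|%:R) ^+ 4 *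
    (p%:R * (additive_energy B1 B1)%:R * (additive_energy B2 B2)%:R).
Proof.
move=> k0; pose t b := e (- b ^+ 2 * k).
pose f x := \sum_(b1 in B1) 1 * e (b1 * x).
set S := cabs _.
have S0 : 0 <= S by exact: cabs_ge0.
pose X := \sum_v (drep B2 v)%:R * cabs (f (2 * k * v)).
pose Y := \sum_v (drep B2 v)%:R * cabs (f (2 * k * v)) ^+ 2.
have X0 : 0 <= X by apply: sumr_ge0 => v _; rewrite mulr_ge0 ?cabs_ge0.
have Y0 : 0 <= Y by apply: sumr_ge0 => v _; rewrite mulr_ge0 ?sqr_ge0.
have hS : S ^+ 2 <= #|B1|%:R * X.
  have h1 : S <= \sum_(b1 in B1) cabs (\sum_(b2 in B2) t b2 * e (b1 * (2 * k * b2))).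
    apply: le_trans (cabs_sum _ _ _) _; apply: ler_sum => b1 _.
    have -> : \sum_(b2 in B2) e (- (b1 - b2) ^+ 2 * k) =
       e (- b1 ^+ 2 * k) * \sum_(b2 in B2) t b2 * e (b1 * (2 * k * b2)).
      by rewrite big_distrr; apply: eq_bigr => b _ /=; rewrite quad_split // /t; ring.
    by rewrite cabsM cabs_addchar mul1r.
  have h2 : S ^+ 2 <= (\sum_(b1 in B1) cabs (\sum_(b2 in B2) t b2 * e (b1 * (2 * k * b2)))) ^+ 2.
    by rewrite lerXn2r ?nnegrE // (le_trans S0).
  apply: le_trans h2 _; apply: le_trans (sum_sqr_le _ _) _; apply: ler_wpM2l => //.
  apply: le_trans (sum_sqr_cabs _ _ _) _.
  have -> : X = \sum_(b in B2) \sum_(d in B2) cabs (f (2 * k * (b - d))).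
    rewrite /X; under eq_bigr => v _.
      rewrite /drep natr_sum big_distrl /=.
      under eq_bigr do rewrite natr_sum big_distrl /=.
      over.
    rewrite exchange_big; apply: eq_bigr => b _ /=; rewrite exchange_big.
    apply: eq_bigr => d _ /=; rewrite (bigD1 (b - d)) //= eqxx mul1r big1 ?addr0 // => v vn.
    by rewrite eq_sym (negbTE vn) mul0r.
  apply: ler_sum => b _; apply: ler_sum => d _.
  have gen (u u' : R[i]) (x y : 'F_p) :
      \sum_(i in B1) u * e (i * x) * conjc (u' * e (i * y)) = u * conjc u' * f (x - y).
    rewrite /f big_distrr; apply: eq_bigr => i _ /=.
    rewrite conjcM -[conjc (e (i * _))]addcharN // mulrACA -addcharD // mul1r.
    by congr (_ * e _); ring.
  rewrite gen -mulrBr.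
  by rewrite !cabsM cabs_conj !cabs_addchar !mul1r.
have hX : X ^+ 2 <= #|B2|%:R ^+ 2 * Y.
  pose s v : R := Num.sqrt (drep B2 v)%:R.
  have ss v : s v ^+ 2 = (drep B2 v)%:R by rewrite sqr_sqrtr.
  have -> : X = \sum_v s v * (s v * cabs (f (2 * k * v))).
    by apply: eq_bigr => v _; rewrite mulrA -expr2 ss.
  apply: le_trans (cauchy_schwarz _ _ _ _) _.
  under eq_bigr do rewrite ss; rewrite -natr_sum sum_drepT natrX.
  by under [X in _ * X <= _]eq_bigr do rewrite exprMn ss.
have hY : Y ^+ 2 <= p%:R * (additive_energy B1 B1)%:R * (additive_energy B2 B2)%:R.
  pose g v : R[i] := real_complex R (drep B2 v)%:R.
  have eY : Y = cabs (\sum_v \sum_w g v * autocorr B1 (fun=> 1) w * e (2 * k * v * w)).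
    have -> : \sum_v \sum_w g v * autocorr B1 (fun=> 1) w * e (2 * k * v * w) =
      real_complex R Y.
      rewrite real_complex_sum; apply: eq_bigr => v _.
      rewrite real_complexM autocorrE big_distrr; apply: eq_bigr => w _ /=.
      by rewrite mulrA [w * _]mulrC.
    by rewrite cabsR ger0_norm.
  rewrite eY; apply: le_trans (bilinear_bound _ _ k0) _.
  rewrite -!mulrA; apply: ler_wpM2l => //; rewrite mulrC !additive_energy_drep !natr_sum.
  apply: ler_pM.
  - by apply: sumr_ge0 => v _; rewrite sqr_ge0.
  - by apply: sumr_ge0 => v _; rewrite sqr_ge0.
  - apply: ler_sum => v _; rewrite natrX lerXn2r ?nnegrE ?cabs_ge0 //.
    by apply: autocorr_le => b; rewrite cabs1.
  - by apply: ler_sum => v _; rewrite natrX /g cabsR normr_nat.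
have h4 : S ^+ 4 <= #|B1|%:R ^+ 2 * (#|B2|%:R ^+ 2 * Y).
  rewrite (exprM S 2 2); apply: (@le_trans _ _ ((#|B1|%:R * X) ^+ 2)).
    by rewrite lerXn2r ?nnegrE ?sqr_ge0 ?mulr_ge0.
  by rewrite exprMn ler_wpM2l ?sqr_ge0.
rewrite (exprM S 4 2); apply: (@le_trans _ _ ((#|B1|%:R ^+ 2 * (#|B2|%:R ^+ 2 * Y)) ^+ 2)).
  by rewrite lerXn2r ?nnegrE ?exprn_ge0 ?mulr_ge0 ?exprn_ge0.
have -> : (#|B1|%:R ^+ 2 * (#|B2|%:R ^+ 2 * Y)) ^+ 2 = (#|B1|%:R * #|B2|%:R) ^+ 4 * Y ^+ 2 by ring.
by rewrite ler_wpM2l // exprn_ge0 // mulr_ge0.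
Qed.

End Fourier.

(** * Representations by sums of reciprocals *)

Lemma card_perm_eq (T : finType) (m : nat) (x : m.-tuple T) :
  (#|[set y : m.-tuple T | perm_eq y x]| <= m`!)%N.
Proof.
rewrite -card_Sn.
apply: leq_trans (leq_imset_card (fun s : 'S_m => [tuple tnth x (s i) | i < m]) _).
apply: subset_leq_card; apply/subsetP => y; rewrite inE => /tuple_permP[s es].
by apply/imsetP; exists s => //; apply: val_inj.
Qed.

Section Representations.
Variables (F : finFieldType) (k : nat) (a1 : F) (A2 : {set F}) (n : F -> nat).
Hypothesis nA2 : forall a, a \notin A2 -> n a = 0%N.
Hypothesis uniq_rep : forall s t : (k + k).-tuple F,
  {subset s <= A2} -> {subset t <= A2} ->
  \sum_(j < k + k) 1 / (a1 - tnth s j) = \sum_(j < k + k) 1 / (a1 - tnth t j) ->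
  perm_eq s t.
Hypothesis four0 : (4 : F) != 0.

Local Notation J := {ffun 'I_k -> F}.

Definition weight (s : J) : nat := (\prod_(i < k) n (s i))%N.
Definition node (a : F) : F := (4 * (a1 - a))^-1.
Definition node_sum (s : J) : F := \sum_(i < k) node (s i).
(** Representations of xi as a difference of two k-fold sums of nodes, each node counted with the
    multiplicity n; these are the frequencies produced by a moment of order 2 k. *)
Definition reps (xi : F) : nat :=
  (\sum_(s : J) \sum_(t : J) weight s * weight t * (node_sum s - node_sum t == xi)%R)%N.

Lemma sum_weight : (\sum_s weight s = (\sum_a n a) ^ k)%N.
Proof.
rewrite /weight -(bigA_distr_bigA (fun (_ : 'I_k) a => n a)) /=.
by rewrite prod_nat_const card_ord.
Qed.

Lemma sum_sqr_weight : (\sum_s weight s ^ 2 = (\sum_a n a ^ 2) ^ k)%N.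
Proof.
have -> : (\sum_s weight s ^ 2 = \sum_(s : J) \prod_(i < k) n (s i) ^ 2)%N.
  by apply: eq_bigr => s _; rewrite -mulnn -big_split; apply: eq_bigr => i _; rewrite /= mulnn.
rewrite -(bigA_distr_bigA (fun (_ : 'I_k) a => n a ^ 2)%N) /=.
by rewrite prod_nat_const card_ord.
Qed.

Lemma sum_reps : (\sum_xi reps xi = (\sum_a n a) ^ (k + k))%N.
Proof.
rewrite /reps exchange_big expnD -sum_weight big_distrl; apply: eq_bigr => s _ /=.
rewrite exchange_big big_distrr; apply: eq_bigr => t _ /=.
rewrite (bigD1 (node_sum s - node_sum t)) //= eqxx muln1 big1 ?addn0 // => xi.
by rewrite eq_sym => /negbTE ->; rewrite muln0.
Qed.

(** Moving the negative terms across an equality of two differences gives an equality of two sums of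
    k + k nodes, the shape of condition (a) for an even m = k + k. *)
Let glue (s t : J) : (k + k).-tuple F := cat_tuple (mktuple s) (mktuple t).

Lemma glue_inj s t s' t' : glue s t = glue s' t' -> s = s' /\ t = t'.
Proof.
move/(congr1 val)/eqP; rewrite /= eqseq_cat ?size_map // => /andP[/eqP h1 /eqP h2].
have e1 : mktuple s = mktuple s' by apply: val_inj.
have e2 : mktuple t = mktuple t' by apply: val_inj.
split; apply/ffunP => i.
  by have := congr1 (fun u => tnth u i) e1; rewrite !tnth_mktuple.
by have := congr1 (fun u => tnth u i) e2; rewrite !tnth_mktuple.
Qed.

Lemma weight_glue s t : (weight s * weight t = \prod_(a <- glue s t) n a)%N.
Proof.
rewrite /glue /= big_cat /= !big_map /weight.
by congr (_ * _)%N; rewrite big_enum.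
Qed.

Lemma sum_glue s t :
  \sum_(j < k + k) 1 / (a1 - tnth (glue s t) j) = 4 * (node_sum s + node_sum t).
Proof.
rewrite -(big_tuple _ _ (glue s t) xpredT (fun x => 1 / (a1 - x))) /= big_cat /=.
have aux u : \sum_(x <- mktuple (fun i => fun_of_fin u i)) 1 / (a1 - x) = 4 * node_sum u.
  rewrite big_tuple big_distrr; apply: eq_bigr => i _ /=.
  by rewrite tnth_mktuple /node invfM mulVKf // div1r.
by rewrite mulrDr -!aux.
Qed.

Lemma weight_neq0 s t : (weight s * weight t != 0)%N -> {subset glue s t <= A2}.
Proof.
rewrite weight_glue => h a ag; apply: contraNT h => /nA2 na.
have -> : (\prod_(a <- glue s t) n a = n a * \prod_(a <- rem a (glue s t)) n a)%N.
  by rewrite (perm_big _ (perm_to_rem ag)) big_cons.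
by rewrite na mul0n.
Qed.

(* By [uniq_rep], only the permutations of a tuple collide with it. *)
Lemma sum_sqr_reps :
  (\sum_xi reps xi ^ 2 <= (k + k)`! * (\sum_a n a ^ 2) ^ (k + k))%N.
Proof.
(* The collision node_sum s - node_sum t = node_sum s' - node_sum t' is indexed so that s is grouped
   with t' and s' with t, the tuples that will be glued. *)
have -> : (\sum_xi reps xi ^ 2 = \sum_(s : J) \sum_(t' : J) \sum_(s' : J) \sum_(t : J)
    weight s * weight t' * (weight s' * weight t) *
    (node_sum s - node_sum t == node_sum s' - node_sum t')%R)%N.
  have -> : (\sum_xi reps xi ^ 2 = \sum_xi \sum_(s : J) \sum_(t : J) \sum_(s' : J) \sum_(t' : J)
      weight s * weight t * (node_sum s - node_sum t == xi)%R *
      (weight s' * weight t' * (node_sum s' - node_sum t' == xi)%R))%N.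
    apply: eq_bigr => xi _; rewrite expnS expn1 {1}/reps big_distrl.
    apply: eq_bigr => s _ /=; rewrite big_distrl; apply: eq_bigr => t _ /=.
    rewrite /reps big_distrr; apply: eq_bigr => s' _ /=.
    by rewrite big_distrr.
  rewrite exchange_big; apply: eq_bigr => s _ /=.
  transitivity (\sum_(t : J) \sum_(s' : J) \sum_(t' : J)
    weight s * weight t' * (weight s' * weight t) *
    (node_sum s - node_sum t == node_sum s' - node_sum t')%R)%N; last first.
    by rewrite exchange_big [RHS]exchange_big; apply: eq_bigr => s' _; rewrite exchange_big.
  rewrite exchange_big; apply: eq_bigr => t _ /=.
  rewrite exchange_big; apply: eq_bigr => s' _ /=.
  rewrite exchange_big; apply: eq_bigr => t' _ /=.
  rewrite (bigD1 (node_sum s - node_sum t)) //= eqxx muln1 big1 => [|xi]; last first.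
    by rewrite eq_sym => /negbTE ->; rewrite muln0 mul0n.
  by rewrite addn0 [in RHS]eq_sym; ring.
apply: (@leq_trans (\sum_(s : J) \sum_(t' : J) (weight s * weight t') ^ 2 *
    \sum_(s' : J) \sum_(t : J) (perm_eq (glue s' t) (glue s t')))%N).
  apply: leq_sum => s _; apply: leq_sum => t' _; rewrite big_distrr; apply: leq_sum => s' _ /=.
  rewrite big_distrr; apply: leq_sum => t _ /=.
  case: eqP => [e|]; last by rewrite muln0.
  have [->|w0] := eqVneq (weight s * weight t')%N 0%N; first by rewrite !mul0n.
  have [->|w1] := eqVneq (weight s' * weight t)%N 0%N; first by rewrite !(muln0, mul0n).
  have pe : perm_eq (glue s' t) (glue s t').
    apply: uniq_rep; [exact: weight_neq0|exact: weight_neq0|].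
    rewrite !sum_glue; congr (_ * _).
    by move/eqP: e; rewrite subr_eq addrAC eq_sym subr_eq => /eqP.
  (* Tuples that are permutations of each other have equal weights, so the product of the two
     weights is a square. *)
  rewrite pe !muln1 expnS expn1 leq_mul2l; apply/orP; right.
  by rewrite !weight_glue (perm_big _ pe).
have hcnt (s t' : J) : (\sum_(s' : J) \sum_(t : J) (perm_eq (glue s' t) (glue s t')) <= (k + k)`!)%N.
  apply: leq_trans (card_perm_eq (glue s t')).
  pose f (q : J * J) := glue q.1 q.2.
  have finj : injective f by move=> [x y] [x' y'] /glue_inj[/= -> ->].
  rewrite pair_bigA /= (_ : (\sum_(q : J * J) _)%N =
      #|[set q : J * J | perm_eq (f q) (glue s t')]|).
    rewrite -(card_imset _ finj); apply: subset_leq_card.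
    by apply/subsetP => y /imsetP[q]; rewrite !inE => h ->.
  rewrite -sum1_card [RHS]big_mkcond; apply: eq_bigr => q _.
  by rewrite inE; case: (perm_eq _ _).
apply: (@leq_trans (\sum_(s : J) \sum_(t' : J) (weight s * weight t') ^ 2 * (k + k)`!)%N).
  by apply: leq_sum => s _; apply: leq_sum => t' _; rewrite leq_mul2l hcnt orbT.
rewrite expnD -sum_sqr_weight big_distrl big_distrr /=; apply: leq_sum => s _.
rewrite big_distrr big_distrr /=; apply: leq_sum => t' _.
by rewrite expnMn mulnC.
Qed.

End Representations.

(** * Trilinear chirp sums *)

Lemma ler_sum_subset (R : numDomainType) (I : finType) (A B : {set I}) (F : I -> R) :
  A \subset B -> (forall i, 0 <= F i) -> \sum_(i in A) F i <= \sum_(i in B) F i.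
Proof.
move=> sAB F0; rewrite [leRHS](bigID (mem A)) /=.
rewrite [X in X + _](eq_bigl (mem A)) ?lerDl ?sumr_ge0 // => i.
by apply: andb_idl => /(subsetP sAB).
Qed.

Lemma Fp_natr_neq0 p n : prime p -> (0 < n < p)%N -> (n%:R : 'F_p) != 0.
Proof.
move=> pr_p /andP[n0 np]; apply/eqP => /(congr1 (@nat_of_ord _)).
by rewrite val_Fp_nat //= modn_small // => h; move: n0; rewrite h.
Qed.

Section Moment.
Variables (R : realType) (p : nat).
Hypotheses (pr_p : prime p) (p2 : (2 < p)%N).
Local Notation e := (@addchar R p).
Variables (k : nat) (a1 : 'F_p) (Om : 'F_p -> {set 'F_p}).
Hypothesis k0 : (0 < k)%N.

Local Notation n := (fun a => #|Om a|).
Local Notation kap := (node a1).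

Definition chirp_sum (B : {set 'F_p}) : R :=
  \sum_a \sum_(b2 in Om a) cabs (\sum_(b in B) e (- (b - b2) ^+ 2 * kap a)).

Let Q : {set 'F_p * 'F_p} := [set q | q.2 \in Om q.1].

Let sumQ (T : nmodType) (F : 'F_p -> 'F_p -> T) :
  \sum_(q in Q) F q.1 q.2 = \sum_a \sum_(b2 in Om a) F a b2.
Proof.
by rewrite pair_big_dep /=; apply: eq_bigl => q; rewrite inE.
Qed.

Let cardQ : (#|Q| = \sum_a n a)%N.
Proof.
rewrite -sum1_card; transitivity (\sum_a \sum_(b2 in Om a) 1)%N; last first.
  by apply: eq_bigr => a _; rewrite sum1_card.
by rewrite pair_big_dep /=; apply: eq_bigl => q; rewrite inE.
Qed.

Definition shifted_sum (v w : 'F_p) : R[i] :=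
  \sum_a (\sum_(b2 in Om a) e (- (2 * b2 * v) * kap a)) * e (v * w * kap a).

(** Cauchy-Schwarz over the pairs (a, b2). The phase becomes (b' - b2)^2 - (b - b2)^2 = v w - 2 b2 v
    with v = b' - b and w = b' + b, so w no longer interacts with b2; [shifted_sum] records exactly
    this. *)
Lemma chirp_sum_sqr B :
  chirp_sum B ^+ 2 <= (\sum_a n a)%:R *
    \sum_(q in setX B B) cabs (shifted_sum (q.2 - q.1) (q.2 + q.1)).
Proof.
rewrite /chirp_sum -(sumQ (fun a b2 => cabs (\sum_(b in B) e (- (b - b2) ^+ 2 * kap a)))).
apply: le_trans (sum_sqr_le _ _) _; rewrite cardQ; apply: ler_wpM2l => //.
apply: le_trans (sum_sqr_cabs _ _ _) _.
have -> : \sum_(q in setX B B) cabs (shifted_sum (q.2 - q.1) (q.2 + q.1)) =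
    \sum_(b in B) \sum_(b' in B) cabs (shifted_sum (b' - b) (b' + b)).
  by rewrite pair_big_dep /=; apply: eq_bigl => q; rewrite inE.
apply: ler_sum => b _; apply: ler_sum => b' _.
rewrite le_eqVlt; apply/orP; left; apply/eqP; congr cabs.
under eq_bigr do rewrite -addcharN // -addcharD //.
rewrite (sumQ (fun a b2 => e (- (b - b2) ^+ 2 * kap a - - (b' - b2) ^+ 2 * kap a))).
apply: eq_bigr => a _; rewrite big_distrl; apply: eq_bigr => b2 _ /=.
by rewrite -addcharD //; congr e; ring.
Qed.

(** Decouples v and w: (b, b') is recovered from its difference and sum since 2 is invertible, and
    the image is enlarged to a full product, which is affordable when B has small doubling. *)
Lemma sum_over_differences B (G : 'F_p -> 'F_p -> R) : (forall v w, 0 <= G v w) ->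
  \sum_(q in setX B B) G (q.2 - q.1) (q.2 + q.1) <=
  \sum_(v in diffset B B) \sum_(w in sumset B B) G v w.
Proof.
move=> G0; pose g (q : 'F_p * 'F_p) := (q.2 - q.1, q.2 + q.1).
have two0 : (2 : 'F_p) != 0 by apply: Fp_natr_neq0.
have ginj : {in setX B B &, injective g}.
  move=> [x y] [x' y'] _ _ h.
  have e1 : y - x = y' - x' by exact: (congr1 fst h).
  have e2 : y + x = y' + x' by exact: (congr1 snd h).
  have ey : y = y'.
    apply: (mulfI two0); rewrite !mulr_natl !mulr2n.
    have -> : y + y = (y - x) + (y + x) by ring.
    by rewrite e1 e2; ring.
  by rewrite ey in e2 *; move/addrI: e2 => ->.
rewrite -(big_imset (fun q => G q.1 q.2) ginj) /=.
have -> : \sum_(v in diffset B B) \sum_(w in sumset B B) G v w =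
   \sum_(q in setX (diffset B B) (sumset B B)) G q.1 q.2.
  by rewrite pair_big_dep /=; apply: eq_bigl => q; rewrite inE.
apply: ler_sum_subset => [|q]; last exact: G0.
apply/subsetP => q /imsetP[[b b']]; rewrite inE /= => /andP[bB b'B] ->.
by rewrite inE /= mem_diffset // mem_sumset.
Qed.

(** The k-th power of [shifted_sum] is a trigonometric polynomial in w with frequencies v times
    [node_sum]; squaring its modulus gives differences of node sums. The coefficients, in which b2
    is hidden, do not depend on w and are bounded by the weights, so the cancellation over w is
    kept. *)
Lemma shifted_sum_moment (X : {set 'F_p}) v :
  \sum_(w in X) cabs (shifted_sum v w) ^+ (k + k) <=
  \sum_xi (reps k a1 n xi)%:R * cabs (\sum_(w in X) e (w * (v * xi))).
Proof.
pose h a : R[i] := \sum_(b2 in Om a) e (- (2 * b2 * v) * kap a).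
have hn a : cabs (h a) <= (n a)%:R.
  apply: le_trans (cabs_sum _ _ _) _; rewrite -sum1_card natr_sum.
  by apply: ler_sum => b _; rewrite cabs_addchar.
pose H (s : {ffun 'I_k -> 'F_p}) : R[i] := \prod_i h (s i).
have HW s : cabs (H s) <= (weight n s)%:R.
  rewrite /H cabs_prod /weight natr_prod; apply: ler_prod => i _.
  by rewrite cabs_ge0 hn.
have pw w : shifted_sum v w ^+ k = \sum_(s : {ffun 'I_k -> 'F_p}) H s * e (w * (v * node_sum a1 s)).
  rewrite /shifted_sum -/(h _).
  have -> : (\sum_a h a * e (v * w * kap a)) ^+ k =
     \prod_(i < k) \sum_a h a * e (v * w * kap a) by rewrite prodr_const card_ord.
  rewrite (bigA_distr_bigA (fun (_ : 'I_k) a => h a * e (v * w * kap a))) /=.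
  apply: eq_bigr => s _; rewrite big_split /=; congr (_ * _).
  rewrite /node_sum !big_distrr /=.
  elim/big_rec2: _ => [|i x y _ ->]; first by rewrite addchar0.
  by rewrite -addcharD //; congr e; ring.
have eS : real_complex R (\sum_(w in X) cabs (shifted_sum v w) ^+ (k + k)) =
   \sum_(s : {ffun 'I_k -> 'F_p}) \sum_(t : {ffun 'I_k -> 'F_p}) H s * conjc (H t) *
      \sum_(w in X) e (w * (v * (node_sum a1 s - node_sum a1 t))).
  rewrite real_complex_sum.
  have -> : \sum_(w in X) real_complex R (cabs (shifted_sum v w) ^+ (k + k)) =
    \sum_(w in X) \sum_(s : {ffun 'I_k -> 'F_p}) \sum_(t : {ffun 'I_k -> 'F_p})
      H s * conjc (H t) * e (w * (v * (node_sum a1 s - node_sum a1 t))).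
    apply: eq_bigr => w _.
    rewrite addnn -muln2 exprM -cabsX sqr_cabs pw conjc_sum big_distrl.
    apply: eq_bigr => s _ /=; rewrite big_distrr; apply: eq_bigr => t _ /=.
    rewrite conjcM -[conjc (e _)]addcharN // mulrACA -addcharD //.
    by congr (_ * e _); ring.
  rewrite exchange_big; apply: eq_bigr => s _ /=; rewrite exchange_big.
  by apply: eq_bigr => t _ /=; rewrite big_distrr.
have s0 : 0 <= \sum_(w in X) cabs (shifted_sum v w) ^+ (k + k).
  by apply: sumr_ge0 => w _; rewrite exprn_ge0 ?cabs_ge0.
rewrite -(ger0_norm s0) -cabsR eS; apply: le_trans (cabs_sum _ _ _) _.
have -> : \sum_xi (reps k a1 n xi)%:R * cabs (\sum_(w in X) e (w * (v * xi))) =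
   \sum_(s : {ffun 'I_k -> 'F_p}) \sum_(t : {ffun 'I_k -> 'F_p}) (weight n s * weight n t)%:R *
      cabs (\sum_(w in X) e (w * (v * (node_sum a1 s - node_sum a1 t)))).
  under eq_bigr => xi _.
    rewrite /reps natr_sum big_distrl /=; under eq_bigr do rewrite natr_sum big_distrl /=.
    over.
  rewrite exchange_big; apply: eq_bigr => s _ /=; rewrite exchange_big.
  apply: eq_bigr => t _ /=; rewrite (bigD1 (node_sum a1 s - node_sum a1 t)) //=.
  rewrite eqxx muln1 [X in _ + X]big1 ?addr0 // => xi.
  by rewrite eq_sym => /negbTE ->; rewrite muln0 mul0r.
apply: ler_sum => s _; apply: le_trans (cabs_sum _ _ _) _; apply: ler_sum => t _.
rewrite !cabsM cabs_conj natrM ler_wpM2r ?cabs_ge0 //.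
by apply: ler_pM; rewrite ?cabs_ge0.
Qed.

Definition trilinear (B : {set 'F_p}) : R :=
  \sum_(v in diffset B B) \sum_xi (reps k a1 n xi)%:R *
     cabs (\sum_(w in sumset B B) e (w * (v * xi))).

Lemma moment_bound B :
  chirp_sum B ^+ (2 * (k + k)) <=
  (\sum_a n a)%:R ^+ (k + k) * #|B|%:R ^+ (2 * (k + k).-1) * trilinear B.
Proof.
have m0 : (k + k = (k + k).-1.+1)%N by rewrite prednK // addn_gt0 k0.
have c0 : 0 <= chirp_sum B by apply: sumr_ge0 => a _; apply: sumr_ge0 => b _; exact: cabs_ge0.
set S := \sum_(q in setX B B) cabs (shifted_sum (q.2 - q.1) (q.2 + q.1)).
have S0 : 0 <= S by apply: sumr_ge0 => q _; exact: cabs_ge0.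
have h1 : chirp_sum B ^+ (2 * (k + k)) <= (\sum_a n a)%:R ^+ (k + k) * S ^+ (k + k).
  rewrite exprM -exprMn lerXn2r ?nnegrE ?sqr_ge0 ?mulr_ge0 //.
  exact: chirp_sum_sqr.
apply: le_trans h1 _; rewrite -mulrA; apply: ler_wpM2l; first by rewrite exprn_ge0.
rewrite [in leLHS]m0; apply: le_trans (power_mean _ _) _ => [q _|]; first exact: cabs_ge0.
rewrite -m0 cardsX natrM -expr2 -exprM; apply: ler_wpM2l; first by rewrite exprn_ge0.
apply: le_trans (sum_over_differences B (G := fun v w => cabs (shifted_sum v w) ^+ (k + k)) _) _.
  by move=> v w; rewrite exprn_ge0 ?cabs_ge0.
by apply: ler_sum => v _; exact: shifted_sum_moment.
Qed.

End Moment.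

(** * Overlaps of dilates of a difference set *)

Section Overlap.
Variable F : finFieldType.
Implicit Types (B Y : {set F}) (r : F).

Definition overlap Y r : nat := #|[set v in Y | v * r \in Y]|.

Lemma overlapN B r : overlap (diffset B B) (- r) = overlap (diffset B B) r.
Proof.
apply: eq_card => v; rewrite !inE mulrN; congr (_ && _).
by rewrite -mem_oppset oppset_diffset.
Qed.

Lemma overlap_le Y r : (overlap Y r <= #|Y|)%N.
Proof. by apply: subset_leq_card; apply/subsetP => v; rewrite inE => /andP[]. Qed.

Lemma overlap1 Y : overlap Y 1 = #|Y|.
Proof. by apply: eq_card => v; rewrite inE mulr1 andbb. Qed.

(** Let Y = B - B and W the intersection of Y with r Y. The triangle inequality through W works
    because B - W lies in 2B - B and W - r B in r (B - 2B), each of size at most K1^3 |B|, while W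
    is large by hypothesis. *)
Lemma overlap_diffset B r (K1 Kt : nat) : r != 0 -> B != set0 ->
  (#|diffset B B| <= K1 * #|B|)%N ->
  (#|B| <= Kt * overlap (diffset B B) r)%N ->
  (#|diffset B (dil r B)| <= K1 ^ 6 * Kt * #|B|)%N.
Proof.
move=> r0 B0 hK hov; have B1 : (0 < #|B|)%N by rewrite card_gt0.
pose W := [set v * r | v in [set v in diffset B B | v * r \in diffset B B]].
have cW : #|W| = overlap (diffset B B) r by rewrite card_imset //; exact: mulIf.
have h1 : (#|diffset B W| <= K1 ^ 3 * #|B|)%N.
  apply: leq_trans (plunnecke_ruzsa 2 1 B0 hK); apply: subset_leq_card.
  apply/subsetP => x /diffsetP[b [w [bB /imsetP[v + ->] ->]]].
  rewrite inE => /andP[_ /diffsetP[b1 [b2 [b1B b2B ->]]]].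
  rewrite nsum1 nsumS nsum1 (_ : b - (b1 - b2) = (b + b2) - b1); last by ring.
  by rewrite mem_diffset // mem_sumset.
have h2 : (#|diffset W (dil r B)| <= K1 ^ 3 * #|B|)%N.
  apply: leq_trans (plunnecke_ruzsa 1 2 B0 hK); rewrite -[leqRHS](card_dil _ r0).
  apply: subset_leq_card.
  apply/subsetP => x /diffsetP[w [y [/imsetP[v + ->] /imsetP[b bB ->] ->]]].
  rewrite inE => /andP[/diffsetP[b1 [b2 [b1B b2B ->]]] _].
  rewrite (_ : (b1 - b2) * r - r * b = r * (b1 - (b2 + b))); last by ring.
  by rewrite mem_dil // nsum1 nsumS nsum1 mem_diffset // mem_sumset.
have := ruzsa_triangle B W (dil r B); rewrite cW => h3.
have h4 := leq_trans h3 (leq_mul h1 h2).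
have h5 : (#|diffset B (dil r B)| * #|B| <= Kt * (K1 ^ 3 * #|B| * (K1 ^ 3 * #|B|)))%N.
  apply: leq_trans (leq_mul (leqnn _) hov) _.
  by rewrite mulnCA leq_mul2l h4 orbT.
rewrite -(leq_pmul2r B1); apply: leq_trans h5 _.
by rewrite (expnD K1 3 3); move: (K1 ^ 3)%N #|B| => a b; lia.
Qed.

Lemma overlap_sumset B r (K1 Kt : nat) : r != 0 -> B != set0 ->
  (#|diffset B B| <= K1 * #|B|)%N ->
  (#|B| <= Kt * overlap (diffset B B) r)%N ->
  (#|sumset B (dil r B)| <= K1 ^ 6 * Kt * #|B|)%N.
Proof.
move=> r0 B0 hK hov; rewrite -diffset_oppset oppset_dil.
by apply: overlap_diffset => //; rewrite ?oppr_eq0 ?overlapN.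
Qed.

End Overlap.

Lemma card_large_overlap p (pr_p : prime p) (B : {set 'F_p}) (K1 Kt : nat) :
  B != set0 -> (0 < K1)%N -> (0 < Kt)%N ->
  (#|diffset B B| <= K1 * #|B|)%N ->
  (2 * (K1 ^ 6 * Kt) < #|B|)%N ->
  (2 ^ 59 * (K1 ^ 6 * Kt) ^ 41 * #|B| <= p)%N ->
  (#|[set r : 'F_p | (r != 0)%R && (#|B| <= Kt * overlap (diffset B B) r)%N]|
     <= 2 ^ 60 * (K1 ^ 6 * Kt) ^ 41)%N.
Proof.
move=> B0 K10 Kt0 hK h2 hp.
(* The ratio r = 1 belongs to the set and supplies the two doubling hypotheses on B itself. *)
have h1 : (#|B| <= Kt * overlap (diffset B B) 1%R)%N.
  rewrite overlap1; case/set0Pn: B0 => b bB.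
  by apply: leq_trans (card_diffset_gel B bB) _; rewrite leq_pmull.
apply: (sum_product pr_p (A := B)) => //.
- by rewrite muln_gt0 expn_gt0 K10.
- by rewrite inE eqxx.
- by rewrite -{2}(dil1 B); apply: overlap_sumset => //; exact: oner_neq0.
- by rewrite -{2}(dil1 B); apply: overlap_diffset => //; exact: oner_neq0.
- by move=> r; rewrite inE => /andP[r0 hr]; apply: overlap_sumset.
- by move=> r; rewrite inE => /andP[r0 hr]; apply: overlap_diffset.
Qed.

Section Trilinear.
Variables (R : realType) (p : nat).
Hypothesis pr_p : prime p.
Local Notation e := (@addchar R p).
Implicit Types (B X Y : {set 'F_p}) (lam : 'F_p -> R).

Lemma energy_cube X : (additive_energy X X <= #|X| ^ 3)%N.
Proof.
rewrite additive_energy_drep expnS -sum_drepT big_distrr /=; apply: leq_sum => v _.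
by rewrite expnS expn1 leq_mul2r drep_le orbT.
Qed.

(** Collecting the products v xi = z into a weight zeta, Cauchy-Schwarz is used twice: once against
    the total mass of zeta, once between its second moment and the fourth moment of the exponential
    sum over X. The second moment of zeta is the sum of overlaps, as v xi = v' xi' means v = v' (xi'
    / xi). *)
Lemma trilinear_fourth X Y lam : (forall xi, 0 <= lam xi) ->
  (\sum_(v in Y) \sum_(xi | xi != 0) lam xi *
     cabs (\sum_(w in X) e (w * (v * xi)))) ^+ 4 <=
  (#|Y|%:R * \sum_xi lam xi) ^+ 2 *
  (\sum_(xi | xi != 0) \sum_(xi' | xi' != 0) lam xi * lam xi' *
     (overlap Y (xi' / xi))%:R) * (p%:R * #|X|%:R ^+ 3).
Proof.
move=> lam0; pose f z := \sum_(w in X) e (w * z).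
pose zeta z := \sum_(v in Y) \sum_(xi | xi != 0) lam xi * (v * xi == z)%:R.
have z0 z : 0 <= zeta z.
  by apply: sumr_ge0 => v _; apply: sumr_ge0 => xi _; rewrite mulr_ge0.
have -> : \sum_(v in Y) \sum_(xi | xi != 0) lam xi *
     cabs (\sum_(w in X) e (w * (v * xi))) = \sum_z zeta z * cabs (f z).
  rewrite /zeta; under [RHS]eq_bigr => z _.
    rewrite big_distrl /=; under eq_bigr do rewrite big_distrl /=.
    over.
  rewrite [RHS]exchange_big; apply: eq_bigr => v _ /=; rewrite [RHS]exchange_big.
  apply: eq_bigr => xi _ /=; rewrite [RHS](bigD1 (v * xi)) //= eqxx mulr1.
  rewrite [X in _ = _ + X]big1 ?addr0 // => z.
  by rewrite eq_sym => /negbTE ->; rewrite mulr0 mul0r.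
have s1 : \sum_z zeta z <= #|Y|%:R * \sum_xi lam xi.
  rewrite /zeta exchange_big mulr_natl -sumr_const; apply: ler_sum => v _ /=.
  rewrite exchange_big [leRHS](bigID (fun xi => xi != 0)) /=.
  have h : \sum_(xi | xi != 0) \sum_z lam xi * (v * xi == z)%:R = \sum_(xi | xi != 0) lam xi.
    apply: eq_bigr => xi _; rewrite -big_distrr /= (bigD1 (v * xi)) //= eqxx.
    by rewrite big1 ?addr0 ?mulr1 // => z; rewrite eq_sym => /negbTE ->.
  by rewrite h lerDl sumr_ge0.
have s2 : \sum_z zeta z ^+ 2 = \sum_(xi | xi != 0) \sum_(xi' | xi' != 0) lam xi * lam xi' *
     (overlap Y (xi' / xi))%:R.
  have -> : \sum_z zeta z ^+ 2 = \sum_z \sum_(xi | xi != 0) \sum_(xi' | xi' != 0)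
      \sum_(v in Y) \sum_(v' in Y) lam xi * (v * xi == z)%:R * (lam xi' * (v' * xi' == z)%:R).
    apply: eq_bigr => z _; rewrite expr2 {1}/zeta exchange_big big_distrl.
    apply: eq_bigr => xi _ /=.
    rewrite /zeta exchange_big big_distrr; apply: eq_bigr => xi' _ /=.
    by rewrite big_distrl; apply: eq_bigr => v _ /=; rewrite big_distrr.
  rewrite exchange_big; apply: eq_bigr => xi xi0; rewrite exchange_big.
  apply: eq_bigr => xi' xi'0; rewrite exchange_big /overlap card_sum_nat.
  rewrite natr_sum big_distrr; transitivity (\sum_(v' in Y) \sum_(v in Y)
    lam xi * lam xi' * (v == v' * (xi' / xi))%:R).
    rewrite [RHS]exchange_big; apply: eq_bigr => v _; rewrite exchange_big.
    apply: eq_bigr => v' _; rewrite (bigD1 (v * xi)) //= eqxx big1 ?addr0 => [|z]; last first.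
      by rewrite eq_sym => /negbTE ->; rewrite mulr0 mul0r.
    rewrite mulr1 mulrA; congr (_ * _%:R); congr nat_of_bool.
    apply/eqP/eqP => [h|->]; first by rewrite mulrA h mulfK.
    by rewrite mulrA divfK.
  apply: eq_bigr => v' _; rewrite -big_distrr /=; congr (_ * _).
  by under eq_bigr do rewrite eq_sym; rewrite sum_natr_eq.
have s4 : \sum_z cabs (f z) ^+ 4 <= p%:R * #|X|%:R ^+ 3.
  have -> : \sum_z cabs (f z) ^+ 4 = \sum_z cabs (\sum_(w in X) (fun=> 1) w * e (w * z)) ^+ 4.
    by apply: eq_bigr => z _; congr (cabs _ ^+ 4); apply: eq_bigr => w _; rewrite mul1r.
  apply: le_trans (fourth_moment pr_p _ _) _ => [b|]; first by rewrite cabs1.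
  by apply: ler_wpM2l => //; rewrite -natrX ler_nat energy_cube.
set S := \sum_z zeta z * cabs (f z).
have S0 : 0 <= S by apply: sumr_ge0 => z _; rewrite mulr_ge0 ?cabs_ge0.
set U := \sum_z zeta z * cabs (f z) ^+ 2.
have U0 : 0 <= U by apply: sumr_ge0 => z _; rewrite mulr_ge0 ?sqr_ge0.
have c1 : S ^+ 2 <= (#|Y|%:R * \sum_xi lam xi) * U.
  pose s z : R := Num.sqrt (zeta z).
  have ss z : s z ^+ 2 = zeta z by rewrite sqr_sqrtr.
  have -> : S = \sum_z s z * (s z * cabs (f z)).
    by apply: eq_bigr => z _; rewrite mulrA -expr2 ss.
  apply: le_trans (cauchy_schwarz _ _ _ _) _.
  under eq_bigr do rewrite ss.
  by under [X in _ * X <= _]eq_bigr do rewrite exprMn ss; rewrite ler_wpM2r.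
have c2 : U ^+ 2 <= (\sum_z zeta z ^+ 2) * (p%:R * #|X|%:R ^+ 3).
  apply: le_trans (cauchy_schwarz _ _ _ _) _.
  under [X in _ * X <= _]eq_bigr do rewrite -exprM.
  by apply: ler_wpM2l => //; apply: sumr_ge0 => z _; rewrite sqr_ge0.
rewrite (exprM S 2 2) -s2; apply: (@le_trans _ _ ((#|Y|%:R * (\sum_xi lam xi) * U) ^+ 2)).
  have L0 : 0 <= \sum_xi lam xi by apply: sumr_ge0.
  have YU0 : 0 <= #|Y|%:R * (\sum_xi lam xi) * U by apply: mulr_ge0 => //; apply: mulr_ge0.
  by rewrite ler_pXn2r ?nnegrE ?sqr_ge0.
by rewrite exprMn -mulrA ler_wpM2l ?sqr_ge0.
Qed.

(** For a ratio outside [Bad] the overlap is below |B| / Kt. For a ratio in [Bad] only the trivial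
    |B - B| is available, but such xi' lie in a dilate of [Bad], where Cauchy-Schwarz trades the
    mass of lam for its l2 norm. *)
Lemma overlap_average B lam (K1 Kt : nat) (beta : R) : (forall xi, 0 <= lam xi) ->
  B != set0 -> (0 < K1)%N -> (0 < Kt)%N ->
  (#|diffset B B| <= K1 * #|B|)%N ->
  (2 * (K1 ^ 6 * Kt) < #|B|)%N ->
  (2 ^ 59 * (K1 ^ 6 * Kt) ^ 41 * #|B| <= p)%N ->
  (2 ^ 60 * (K1 ^ 6 * Kt) ^ 41)%:R <= beta ->
  \sum_(xi | xi != 0) \sum_(xi' | xi' != 0) lam xi * lam xi' *
     (overlap (diffset B B) (xi' / xi))%:R <=
  (\sum_xi lam xi) * (#|B|%:R / Kt%:R * (\sum_xi lam xi) + #|diffset B B|%:R *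
     Num.sqrt (beta * \sum_xi lam xi ^+ 2)).
Proof.
move=> lam0 B0 K10 Kt0 hK h2 hp hbeta; set Y := diffset B B.
pose Bad := [set r : 'F_p | (r != 0)%R && (#|B| <= Kt * overlap (diffset B B) r)%N].
have hbad : #|Bad|%:R <= beta.
  apply: le_trans hbeta; rewrite ler_nat; exact: card_large_overlap.
have {hp h2} _ := hp.
have L0 : 0 <= \sum_xi lam xi by apply: sumr_ge0.
rewrite big_distrl [leRHS](bigID (fun xi => xi != 0)) /=; apply: ler_wpDr.
  by apply: sumr_ge0 => xi _; rewrite !(mulr_ge0, addr_ge0, sqrtr_ge0, divr_ge0).
apply: ler_sum => xi xi0.
under eq_bigr do rewrite -mulrA.
rewrite -big_distrr /=; apply: ler_wpM2l => //.
apply: (@le_trans _ _ (\sum_xi' (#|B|%:R / Kt%:R * lam xi') +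
    \sum_xi' (xi' / xi \in Bad)%:R * (#|Y|%:R * lam xi'))).
  rewrite -big_split /= [leRHS](bigID (fun xi' => xi' != 0)) /=; apply: ler_wpDr.
    by apply: sumr_ge0 => x _; rewrite addr_ge0 // !mulr_ge0.
  apply: ler_sum => xi' xi'0.
  have [b|b] := boolP (xi' / xi \in Bad).
    rewrite mul1r mulrC; apply: ler_wpDl; first by rewrite !mulr_ge0.
    by rewrite ler_wpM2r // ler_nat overlap_le.
  rewrite mul0r addr0 mulrC; apply: ler_wpM2r => //.
  move: b; rewrite inE mulf_neq0 ?invr_eq0 //= -ltnNge => b.
  rewrite ler_pdivlMr ?ltr0n // mulrC -natrM ler_nat; exact: ltnW.
rewrite -big_distrr /=; apply: lerD => //.
have -> : \sum_xi' (xi' / xi \in Bad)%:R * (#|Y|%:R * lam xi') =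
   #|Y|%:R * \sum_xi' (xi' / xi \in Bad)%:R * lam xi'.
  by rewrite big_distrr; apply: eq_bigr => x _; rewrite mulrCA.
apply: ler_wpM2l => //.
have s0 : 0 <= \sum_xi' (xi' / xi \in Bad)%:R * lam xi' by apply: sumr_ge0 => x _; rewrite mulr_ge0.
have l20 : 0 <= \sum_xi' lam xi' ^+ 2 by apply: sumr_ge0 => x _; rewrite sqr_ge0.
rewrite -(ger0_norm s0) -sqrtr_sqr ler_wsqrtr //.
apply: le_trans (cauchy_schwarz _ _ _ _) _; apply: ler_wpM2r => //.
have -> : \sum_xi' ((xi' / xi \in Bad)%:R : R) ^+ 2 = #|Bad|%:R.
  rewrite -(reindex_mul _ xi0) -sum1_card natr_sum [RHS]big_mkcond; apply: eq_bigr => x _.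
  by rewrite mulrAC mulfV // mul1r; case: (x \in Bad); rewrite ?expr1n ?expr0n.
exact: hbad.
Qed.

End Trilinear.

(** * Powers of p and the structured case *)

Section Powers.
Variables (R : realType) (P : R).
Hypothesis P1 : 1 < P.
Local Notation q a := (P `^ a).

Let P0 : 0 < P. Proof. exact: lt_trans ltr01 P1. Qed.

Lemma powD a b : q a * q b = q (a + b).
Proof. by rewrite powRD // (gt_eqF P0) implybT. Qed.

Lemma powX a n : q a ^+ n = q (a * n%:R).
Proof. by rewrite powRrM powR_mulrn // powR_ge0. Qed.

Lemma pow_le a b : a <= b -> q a <= q b.
Proof. by apply: ler_powR; exact: ltW. Qed.

Lemma pow_lt a b : a < b -> q a < q b.
Proof.
move=> ab; rewrite -(subrK a b) -powD ltr_pMl ?powR_gt0 //.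
have d0 : 0 < b - a by rewrite subr_gt0.
by have := gt0_ltr_powR d0 _ _ P1; rewrite powR1 !nnegrE => h; apply: h => //; exact: ltW.
Qed.

Lemma pow_ge1 a : 0 <= a -> 1 <= q a.
Proof. by move=> a0; rewrite -(powRr0 P) pow_le. Qed.

Lemma pow1 : q 1 = P.
Proof. by rewrite powRr1 // ltW. Qed.

Lemma pow_sqrt a : Num.sqrt (q a) = q (a / 2).
Proof.
have -> : q a = q (a / 2) ^+ 2 by rewrite powX; congr (q _); field.
by rewrite sqrtr_sqr ger0_norm // powR_ge0.
Qed.

End Powers.

Lemma nat_between (R : realType) (x : R) : 1 <= x ->
  exists n : nat, [/\ (0 < n)%N, x <= n%:R & n%:R <= 2 * x].
Proof.
move=> x1; have x0 : 0 <= x by apply: le_trans x1.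
have /andP[h1 h2] := truncn_itv x0.
exists (Num.truncn x).+1; split=> //; first exact: ltW.
by rewrite -addn1 natrD; lra.
Qed.

Section Structured.
Variables (R : realType) (p : nat).
Hypotheses (pr_p : prime p) (p4 : (4 < p)%N).
Local Notation P := (p%:R : R).
Local Notation q a := (P `^ a).
Variables (k : nat) (a1 : 'F_p) (A2 : {set 'F_p}) (Om : 'F_p -> {set 'F_p}).
Hypothesis k0 : (0 < k)%N.
Local Notation m := (k + k)%N.
Local Notation n := (fun a => #|Om a|).
Local Notation M := (m%:R : R).
Hypothesis Om0 : forall a, a \notin A2 -> Om a = set0.
Hypothesis uniq_rep : forall s t : m.-tuple 'F_p,
  {subset s <= A2} -> {subset t <= A2} ->
  \sum_(j < m) 1 / (a1 - tnth s j) = \sum_(j < m) 1 / (a1 - tnth t j) ->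
  perm_eq s t.
Variables (y z sigma : R).
Hypotheses (z0 : 0 < z) (z1 : z <= 1 / 2) (Myz : M * y = z).
Hypotheses (s0 : 0 <= M * sigma) (s1 : M * sigma <= z / 800 / 100).
Hypothesis large : 2 ^+ 60 <= q (z / 100 / 100).
Hypothesis large_fact : (m`!)%:R <= q (z / 100 / 100).
Hypothesis sum_n : (\sum_a n a)%:R <= q (1 / 2).
Hypothesis sum_n2 : (\sum_a n a ^ 2)%:R <= q (1 - y).

Let P1 : 1 < P. Proof. by rewrite ltr1n prime_gt1. Qed.

Let large_const j : (j <= 60)%N -> 2 ^+ j <= q (z / 100 / 100).
Proof. by move=> hj; apply: le_trans large; apply: ler_weXn2l; rewrite ?ler1n. Qed.

Let large2 : 2 <= q (z / 100 / 100).
Proof. by rewrite -[leLHS]expr1; apply: large_const. Qed.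

(** The weights have mass at most p^(M / 2) but second moment only p^(M - z), up to p^(z / 10000):
    this saving is what few large overlaps convert into a bound for the trilinear sum. The allowed
    doubling p^(z / 16000) and the deficit p^(z / 32000) in the size of B are small enough not to
    consume it. *)
Lemma structured_bound (B : {set 'F_p}) (K1 : nat) :
  (0 < K1)%N -> (#|diffset B B| <= K1 * #|B|)%N -> K1%:R <= q (z / 160 / 100) ->
  q (1 / 2 - z / 320 / 100) <= #|B|%:R -> #|B|%:R <= q (1 / 2) ->
  chirp_sum R a1 Om B <= #|B|%:R * q (1 / 2) * q (- sigma).
Proof.
move: (z0) (z1) (Myz) (s0) (s1) => hz0 hz1 hMyz hs0 hs1.
move=> K10 hK hK1 Blo Bhi; set b : R := #|B|%:R in Blo Bhi *.
have b0 : 0 < b by apply: lt_le_trans Blo; rewrite powR_gt0 // (lt_trans ltr01).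
have B0 : B != set0 by rewrite -card_gt0 -(ltr0n R).
have q0 a : 0 <= q a by exact: powR_ge0.
pose lam xi : R := (reps k a1 n xi)%:R.
have four0 : (4 : 'F_p) != 0 by apply: Fp_natr_neq0.
have nA2 a : a \notin A2 -> #|Om a| = 0%N by move=> /Om0 ->; rewrite cards0.
have lam0 xi : 0 <= lam xi by exact: ler0n.
have hL : \sum_xi lam xi <= q (M / 2).
  rewrite -natr_sum sum_reps natrX.
  apply: (@le_trans _ _ (q (1 / 2) ^+ m)); first by rewrite lerXn2r ?nnegrE.
  by rewrite powX //; apply: pow_le => //; lra.
have hLam2 : \sum_xi lam xi ^+ 2 <= q (z / 100 / 100 + M - z).
  rewrite /lam; under eq_bigr do rewrite -natrX.
  rewrite -natr_sum; apply: (@le_trans _ _ ((m`! * (\sum_a n a ^ 2) ^ m)%N)%:R).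
    by rewrite ler_nat; apply: (sum_sqr_reps nA2 uniq_rep four0).
  rewrite natrM natrX; apply: (@le_trans _ _ (q (z / 100 / 100) * q (1 - y) ^+ m)).
    by apply: ler_pM; rewrite ?exprn_ge0 // lerXn2r ?nnegrE.
  by rewrite powX // powD //; apply: pow_le => //; rewrite mulrBl mul1r [y * _]mulrC Myz; lra.
have Lam20 : 0 <= \sum_xi lam xi ^+ 2 by apply: sumr_ge0 => xi _; rewrite sqr_ge0.
have L0 : 0 <= \sum_xi lam xi by apply: sumr_ge0.
(* A larger Kt saves more on ordinary ratios but admits more bad ones, about (K1^6 Kt)^41 of them.
   With Kt near p^(z / 80) this number is below p^(0.54 z), so the second moment saving p^(-z) still
   wins; [c] is 1 / 80 plus the small losses. *)
have [Kt [Kt0 Ktlo Kthi]] : exists n : nat, [/\ (0 < n)%N, q (z / 80) <= n%:R & n%:R <= 2 * q (z / 80)].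
  by apply: nat_between; apply: pow_ge1 => //; lra.
have {}Kthi : Kt%:R <= q (z / 100 / 100 + z / 80).
  apply: le_trans Kthi _; by rewrite -powD //; apply: ler_wpM2r.
pose K := (K1 ^ 6 * Kt)%N.
pose c : R := 6 / 160 / 100 + 1 / 100 / 100 + 1 / 80.
have hKR : K%:R <= q (c * z).
  rewrite natrM natrX; apply: (@le_trans _ _ (q (z / 160 / 100) ^+ 6 * q (z / 100 / 100 + z / 80))).
    by apply: ler_pM; rewrite ?exprn_ge0 // lerXn2r ?nnegrE.
  by rewrite powX // powD //; apply: pow_le => //; rewrite /c; lra.
have h2K : (2 * K < #|B|)%N.
  rewrite -(ltr_nat R) natrM; apply: lt_le_trans Blo.
  apply: (@le_lt_trans _ _ (q (z / 100 / 100) * q (c * z))).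
    apply: ler_pM => //; exact: large2.
  by rewrite powD //; apply: pow_lt => //; rewrite /c; lra.
have hY : #|diffset B B|%:R <= q (z / 160 / 100) * b.
  apply: (@le_trans _ _ (K1 * #|B|)%:R); first by rewrite ler_nat.
  by rewrite natrM ler_wpM2r.
have hX : #|sumset B B|%:R <= q (2 * (z / 160 / 100)) * b.
  have h : (#|sumset B B| <= K1 ^ 2 * #|B|)%N.
    have := plunnecke_ruzsa 2 0 B0 hK; rewrite -sumset_oppset nsumS nsum1.
    have -> : oppset (nsum 0 B) = [set 0].
      by apply/setP => x; rewrite mem_oppset !inE oppr_eq0.
    by rewrite sumset0 addn0.
  apply: (@le_trans _ _ (K1 ^ 2 * #|B|)%:R); first by rewrite ler_nat.
  rewrite natrM natrX ler_wpM2r //; apply: (@le_trans _ _ (q (z / 160 / 100) ^+ 2)).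
    by rewrite lerXn2r ?nnegrE.
  by rewrite powX //; apply: pow_le => //; lra.
pose W := \sum_(xi | xi != 0) \sum_(xi' | xi' != 0) lam xi * lam xi' *
     (overlap (diffset B B) (xi' / xi))%:R.
have hW : W <= b * q (M + z / 100 / 100 - z / 80).
  apply: (@le_trans _ _ (q (M / 2) * (b * q (M / 2 - z / 80) + b * q (M / 2 - z / 80)))).
    have h259 : 2 ^+ 59 * K%:R ^+ 41 * #|B|%:R <= q 1.
      apply: (@le_trans _ _ (q (z / 100 / 100) * q (c * z) ^+ 41 * q (1 / 2))).
        apply: ler_pM => //.
        apply: ler_pM; rewrite ?exprn_ge0 ?lerXn2r ?nnegrE //.
        exact: large_const.
      by rewrite powX // !powD //; apply: pow_le => //; rewrite /c; lra.
    have h260 : 2 ^+ 60 * K%:R ^+ 41 <= q (z / 100 / 100 + 41 * (c * z)).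
      rewrite -powD //.
      apply: ler_pM; [by apply: exprn_ge0; exact: ler0n|by apply: exprn_ge0; exact: ler0n| |].
        exact: large_const.
      by rewrite mulrC -powX // lerXn2r ?nnegrE.
    apply: le_trans (overlap_average (beta := q (z / 100 / 100 + 41 * (c * z)))
      pr_p lam0 B0 K10 Kt0 hK h2K _ _) _.
    - by rewrite -(ler_nat R) natrM natrM natrX natrX -[leRHS](pow1 P1).
    - by rewrite natrM natrX natrX.
    clear h259 h260.
    apply: ler_pM; [exact: L0| |exact: hL|apply: lerD].
    - by rewrite addr_ge0 // mulr_ge0 ?divr_ge0 ?sqrtr_ge0.
    -
      rewrite -mulrA; apply: ler_wpM2l; first exact: ltW.
      rewrite addrC -powD //; apply: ler_pM; rewrite ?invr_ge0 //.
      by rewrite powRN lef_pV2 // posrE ?ltr0n // powR_gt0 // (lt_trans ltr01).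
    - apply: (@le_trans _ _ (q (z / 160 / 100) * b *
        q ((z / 100 / 100 + 41 * (c * z) + (z / 100 / 100 + M - z)) / 2))).
      apply: ler_pM; rewrite ?sqrtr_ge0 // -pow_sqrt // ler_wsqrtr // -[leRHS]powD //.
      by apply: ler_pM.
    rewrite mulrAC powD // mulrC; apply: ler_wpM2l; first exact: ltW.
    by apply: pow_le => //; rewrite /c; lra.
  have -> : q (M / 2) * (b * q (M / 2 - z / 80) + b * q (M / 2 - z / 80)) =
    b * (2 * (q (M / 2) * q (M / 2 - z / 80))) by ring.
  apply: ler_wpM2l; first exact: ltW.
  apply: (@le_trans _ _ (q (z / 100 / 100) * (q (M / 2) * q (M / 2 - z / 80)))).
    by apply: ler_wpM2r => //; rewrite mulr_ge0.
  by rewrite !powD //; apply: pow_le => //; lra.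
pose t := M * sigma.
(* The target for the trilinear sum: inserted in [moment_bound] it gives b^(2 m) p^(M - 2 t), whose
   root of order 2 m is b p^(1/2 - sigma). *)
pose Th := q (M / 2 - 2 * t) * b ^+ 2.
have Th0 : 0 <= Th by rewrite mulr_ge0 ?sqr_ge0.
(* The frequency xi = 0 is set apart, since no ratio xi' / xi exists there; its weight is at most
   the l2 norm of the weights, which already saves about z / 2. *)
pose T0 := #|diffset B B|%:R * (lam 0 * #|sumset B B|%:R).
pose T1 := \sum_(v in diffset B B) \sum_(xi | xi != 0) lam xi *
     cabs (\sum_(w in sumset B B) addchar R (w * (v * xi))).
have eT : trilinear R k a1 Om B = T0 + T1.
  rewrite /T0 /T1 mulr_natl -sumr_const -big_split /=; apply: eq_bigr => v _.
  rewrite (bigD1 0) //=; congr (_ * _ + _).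
  under eq_bigr do rewrite !mulr0 addchar0.
  rewrite sumr_const (_ : 1 *+ _ = real_complex R #|sumset B B|%:R); last first.
    by rewrite rmorph_nat.
  by rewrite cabsR normr_nat.
have hT0 : T0 <= Th / 2.
  have hl : lam 0 <= q ((z / 100 / 100 + M - z) / 2).
    rewrite -pow_sqrt // -(ger0_norm (lam0 0)) -sqrtr_sqr ler_wsqrtr //.
    apply: le_trans hLam2; rewrite (bigD1 0) //= lerDl.
    by apply: sumr_ge0 => xi _; rewrite sqr_ge0.
  apply: (@le_trans _ _ (q (z / 160 / 100) * b * (q ((z / 100 / 100 + M - z) / 2) *
    (q (2 * (z / 160 / 100)) * b)))).
    by apply: ler_pM; rewrite ?mulr_ge0 //; apply: ler_pM.
  rewrite ler_pdivlMr //.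
  have -> : q (z / 160 / 100) * b * (q ((z / 100 / 100 + M - z) / 2) * (q (2 * (z / 160 / 100)) * b)) * 2 =
    (2 * (q (z / 160 / 100) * q ((z / 100 / 100 + M - z) / 2) * q (2 * (z / 160 / 100)))) * b ^+ 2 by ring.
  apply: ler_wpM2r; first by rewrite sqr_ge0.
  apply: (@le_trans _ _ (q (z / 100 / 100) * (q (z / 160 / 100) * q ((z / 100 / 100 + M - z) / 2) * q (2 * (z / 160 / 100))))).
    apply: ler_wpM2r; first by rewrite !mulr_ge0.
    exact: large2.
  by rewrite !powD //; apply: pow_le => //; rewrite /t; lra.
have hT1 : T1 <= Th / 2.
  have T10 : 0 <= T1.
    by apply: sumr_ge0 => v _; apply: sumr_ge0 => xi _; rewrite mulr_ge0 ?cabs_ge0.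
  rewrite -(ler_pXn2r (isT : (0 < 4)%N)) ?nnegrE ?divr_ge0 //.
  apply: le_trans (trilinear_fourth pr_p _ _ lam0) _; rewrite -/W.
  have W0 : 0 <= W.
    by apply: sumr_ge0 => xi _; apply: sumr_ge0 => xi' _; rewrite !mulr_ge0.
  apply: (@le_trans _ _ ((q (z / 160 / 100) * b * q (M / 2)) ^+ 2 *
     (b * q (M + z / 100 / 100 - z / 80)) * (q 1 * (q (2 * (z / 160 / 100)) * b) ^+ 3))).
    apply: ler_pM; rewrite ?mulr_ge0 ?sqr_ge0 ?exprn_ge0 //.
      apply: ler_pM; rewrite ?sqr_ge0 //.
      rewrite lerXn2r ?nnegrE ?mulr_ge0 ?(ltW b0) //.
      by apply: ler_pM.
    rewrite pow1 //; apply: ler_wpM2l => //.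
    by rewrite lerXn2r ?nnegrE ?mulr_ge0 ?(ltW b0).
  pose u := q (2 * (z / 160 / 100)) ^+ 4 * q 1 * q (M + z / 100 / 100 - z / 80) * q M.
  have -> : (q (z / 160 / 100) * b * q (M / 2)) ^+ 2 *
     (b * q (M + z / 100 / 100 - z / 80)) * (q 1 * (q (2 * (z / 160 / 100)) * b) ^+ 3) = u * b ^+ 6.
    rewrite /u (_ : q (2 * (z / 160 / 100)) = q (z / 160 / 100) ^+ 2); last first.
      by rewrite powX //; congr (q _); lra.
    rewrite (_ : q M = q (M / 2) ^+ 2); last by rewrite powX //; congr (q _); lra.
    by ring.
  have -> : (Th / 2) ^+ 4 = q (M / 2 - 2 * t) ^+ 4 / 2 ^+ 4 * b ^+ 2 * b ^+ 6 by rewrite /Th; field.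
  apply: ler_wpM2r; first by rewrite exprn_ge0 // ltW.
  rewrite mulrAC ler_pdivlMr ?exprn_gt0 //.
  apply: (@le_trans _ _ (u * q (z / 100 / 100))).
    apply: ler_wpM2l; first by rewrite /u !mulr_ge0 ?exprn_ge0.
    exact: large_const.
  (* The right side has two spare factors b; by the lower bound on #|B| they pay for the factor p of
     the fourth moment. *)
  apply: (@le_trans _ _ (q (M / 2 - 2 * t) ^+ 4 * q (1 / 2 - z / 320 / 100) ^+ 2)).
    rewrite /u !powX // !powD //; apply: pow_le => //; rewrite /t; lra.
  apply: ler_wpM2l; first by rewrite exprn_ge0.
  by rewrite lerXn2r ?nnegrE ?(ltW b0).
have hT : trilinear R k a1 Om B <= Th by rewrite eT; lra.
have m0 : (0 < 2 * m)%N by rewrite muln_gt0 addn_gt0 k0.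
have cs0 : 0 <= chirp_sum R a1 Om B.
  by apply: sumr_ge0 => a _; apply: sumr_ge0 => b2 _; exact: cabs_ge0.
rewrite -(ler_pXn2r m0) ?nnegrE ?mulr_ge0 ?(ltW b0) //.
apply: le_trans (moment_bound R pr_p (ltnW (ltnW p4)) a1 Om k0 B) _.
apply: (@le_trans _ _ (q (M / 2) * b ^+ (2 * m.-1) * Th)).
  apply: ler_pM => //.
  - by apply: sumr_ge0 => v _; apply: sumr_ge0 => xi _; rewrite mulr_ge0 ?cabs_ge0.
  - apply: ler_wpM2r; first by rewrite exprn_ge0 // ltW.
    apply: (@le_trans _ _ (q (1 / 2) ^+ m)); first by rewrite lerXn2r ?nnegrE.
    by rewrite powX //; apply: pow_le => //; lra.
have -> : q (M / 2) * b ^+ (2 * m.-1) * Th = q (M / 2) * q (M / 2 - 2 * t) * b ^+ (2 * m).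
  have -> : (2 * m = 2 * m.-1 + 2)%N by move: k0; clear; lia.
  by rewrite exprD /Th; ring.
rewrite !exprMn -[leRHS]mulrA [leRHS]mulrC; apply: ler_wpM2r; first by rewrite exprn_ge0 // ltW.
rewrite !powX // !powD //; apply: pow_le => //.
have -> : - sigma * (2 * m)%:R = - (2 * t) by rewrite natrM /t; ring.
by rewrite natrM; lra.
Qed.

End Structured.

Section OneRow.
Variables (R : realType) (p : nat).
Hypotheses (pr_p : prime p) (p4 : (4 < p)%N).
Local Notation P := (p%:R : R).
Local Notation q a := (P `^ a).
Variables (k : nat) (a1 : 'F_p) (A2 : {set 'F_p}) (Om : 'F_p -> {set 'F_p}).
Hypothesis k0 : (0 < k)%N.
Local Notation m := (k + k)%N.
Local Notation n := (fun a => #|Om a|).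
Local Notation M := (m%:R : R).
Hypothesis a1A2 : a1 \notin A2.
Hypothesis Om0 : forall a, a \notin A2 -> Om a = set0.
Hypothesis uniq_rep : forall s t : m.-tuple 'F_p,
  {subset s <= A2} -> {subset t <= A2} ->
  \sum_(j < m) 1 / (a1 - tnth s j) = \sum_(j < m) 1 / (a1 - tnth t j) ->
  perm_eq s t.
Variables (y z sigma alpha x : R).
Hypotheses (z0 : 0 < z) (z1 : z <= 1 / 2) (Myz : M * y = z).
Hypotheses (s0 : 0 <= M * sigma) (s1 : M * sigma <= z / 800 / 100).
Hypotheses (x0 : 0 < x) (xz : x <= z / 1600 / 105).
Hypothesis large : 2 ^+ 60 <= q (z / 100 / 100).
Hypothesis large_fact : (m`!)%:R <= q (z / 100 / 100).
Hypothesis large32 : 2 ^+ 32 <= q (z / 1000 / 1000).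
Hypothesis sum_n : (\sum_a n a)%:R <= q (1 / 2).
Hypothesis sum_n2 : (\sum_a n a ^ 2)%:R <= q (1 - y).
Hypothesis cardA2 : #|A2|%:R <= q alpha.

Let P1 : 1 < P. Proof. by rewrite ltr1n prime_gt1. Qed.
Let P0 : 0 < P. Proof. exact: lt_trans ltr01 P1. Qed.

Lemma node_neq0 a : a != a1 -> 2 * node a1 a != 0.
Proof.
move=> aa1; apply: mulf_neq0.
  by apply: Fp_natr_neq0 => //; rewrite /= (ltn_trans _ p4).
rewrite invr_eq0; apply: mulf_neq0; first exact: Fp_natr_neq0.
by rewrite subr_eq0 eq_sym.
Qed.

Lemma low_energy_row (B : {set 'F_p}) :
  (additive_energy B B)%:R <= q (3 / 2 - x) ->
  chirp_sum R a1 Om B <= q (alpha + 1 - x / 4).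
Proof.
move=> hE; have hrow a : \sum_(b2 in Om a) cabs (\sum_(b in B) addchar R (- (b - b2) ^+ 2 * node a1 a))
    <= (a \in A2)%:R * q (1 - x / 4).
  have [aA2|aA2] := boolP (a \in A2); last by rewrite Om0 // big_set0 mul0r.
  rewrite mul1r.
  have aa1 : a != a1 by apply: contraNneq a1A2 => <-.
  have s00 : 0 <= \sum_(b2 in Om a) cabs (\sum_(b in B) addchar R (- (b - b2) ^+ 2 * node a1 a)).
    by apply: sumr_ge0 => b _; exact: cabs_ge0.
  rewrite -(ler_pXn2r (isT : (0 < 4)%N)) ?nnegrE ?powR_ge0 //.
  apply: le_trans (@low_energy_bound R p pr_p _ _ _ (node_neq0 aa1)) _.
  apply: (@le_trans _ _ (q (1 / 2) ^+ 3 * (q 1 * q (3 / 2 - x)))).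
    apply: ler_pM; rewrite ?exprn_ge0 ?mulr_ge0 //.
      rewrite lerXn2r ?nnegrE ?powR_ge0 //; apply: le_trans sum_n.
      by rewrite ler_nat (bigD1 a) //= leq_addr.
    by rewrite pow1 // ler_wpM2l.
  by rewrite !powX // !powD //; apply: pow_le => //; lra.
apply: le_trans (ler_sum _ (fun a _ => hrow a)) _.
rewrite -big_distrl /=.
have -> : \sum_a ((a \in A2)%:R : R) = #|A2|%:R.
  by rewrite -natr_sum -sum1_card [in RHS]big_mkcond; congr _%:R; apply: eq_bigr => a _; case: ifP.
apply: (@le_trans _ _ (q alpha * q (1 - x / 4))); first by apply: ler_wpM2r => //; exact: powR_ge0.
by rewrite powD //; apply: pow_le => //; lra.
Qed.

Lemma chirp_sum_split (B B' : {set 'F_p}) : B' \subset B ->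
  chirp_sum R a1 Om B <= chirp_sum R a1 Om B' + chirp_sum R a1 Om (B :\: B').
Proof.
move=> sB; rewrite /chirp_sum -big_split; apply: ler_sum => a _ /=.
rewrite -big_split; apply: ler_sum => b2 _ /=.
rewrite (big_setID B') /= (setIidPr sB); exact: cabsD.
Qed.

(* Induction on the size of [B]: as long as the energy is large, [bsg] provides a
   structured subset that can be removed. *)
Lemma one_row_bound (B : {set 'F_p}) : #|B|%:R <= q (1 / 2) ->
  chirp_sum R a1 Om B <= #|B|%:R * q (1 / 2) * q (- sigma) + q (alpha + 1 - x / 4).
Proof.
move: (z0) (z1) (x0) (xz) => hz0 hz1 hx0 hxz.
have q0 a : 0 <= q a by exact: powR_ge0.
(* For #|B| <= p^(1/2), energy above p^(3/2 - x) is at least |B|^3 / K once K >= p^x, the hypothesis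
   of [bsg]. *)
have [K [K0 Klo Khi]] : exists n : nat, [/\ (0 < n)%N, q x <= n%:R & n%:R <= 2 * q x].
  by apply: nat_between; apply: pow_ge1 => //; lra.
have large_const j : (j <= 32)%N -> 2 ^+ j <= q (z / 1000 / 1000).
  by move=> hj; apply: le_trans large32; apply: ler_weXn2l; rewrite ?ler1n.
pose K1 := (2 ^ 22 * K ^ 10)%N.
have hK1 : K1%:R <= q (z / 160 / 100).
  rewrite natrM natrX natrX; apply: (@le_trans _ _ (2 ^+ 22 * (2 * q x) ^+ 10)).
    by apply: ler_wpM2l; rewrite ?exprn_ge0 // lerXn2r ?nnegrE ?mulr_ge0.
  rewrite exprMn mulrA -exprD powX //.
  apply: (@le_trans _ _ (q (z / 1000 / 1000) * q (x * 10%:R))).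
    by apply: ler_wpM2r => //; exact: large_const.
  by rewrite powD //; apply: pow_le => //; lra.
have [N cB] : exists N, (#|B| < N)%N by exists #|B|.+1.
elim: N B cB => // N IH B cB hB.
have [hE|hE] := leP (additive_energy B B)%:R (q (3 / 2 - x)).
  apply: le_trans (low_energy_row hE) _; rewrite lerDr.
  by rewrite !mulr_ge0.
have B3 : q (3 / 2 - x) < #|B|%:R ^+ 3.
  by apply: lt_le_trans hE _; rewrite -natrX ler_nat energy_cube.
have bn0 : B != set0.
  apply: contraTneq B3 => ->; rewrite cards0 expr0n /= -leNgt //.
have hb : (#|B| ^ 3 <= K * \sum_v drep B v ^ 2)%N.
  rewrite -additive_energy_drep -(ler_nat R) natrX natrM.
  apply: (@le_trans _ _ (q (1 / 2) ^+ 3)); first by rewrite lerXn2r ?nnegrE.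
  apply: (@le_trans _ _ (q x * q (3 / 2 - x))).
    by rewrite powX // powD //; apply: pow_le => //; lra.
  by apply: ler_pM => //; exact: ltW.
have [B' [sB' B'0 hBB' hdiff]] := bsg K0 bn0 hb.
(* The energy never exceeds |B|^3, so high energy forces B, and with it the structured piece B', to
   be nearly of size p^(1/2). *)
have Blo : q (1 / 2 - x / 3) <= #|B|%:R.
  rewrite leNgt; apply/negP => hlt.
  have : #|B|%:R ^+ 3 <= q (1 / 2 - x / 3) ^+ 3 by rewrite lerXn2r ?nnegrE // ltW.
  rewrite powX // => h; have := lt_le_trans B3 h.
  by rewrite (_ : (1 / 2 - x / 3) * 3%:R = 3 / 2 - x) ?ltxx //; lra.
have B'lo : q (1 / 2 - z / 320 / 100) <= #|B'|%:R.
  have h1 : q (1 / 2 - x / 3) <= 2 ^+ 4 * q x * #|B'|%:R.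
    apply: le_trans Blo _; apply: (@le_trans _ _ (6 * K * #|B'|)%:R); first by rewrite ler_nat.
    rewrite !natrM; apply: ler_wpM2r => //.
    have : 0 <= q x by [].
    by move: Khi; rewrite -natrX (_ : (2 ^ 4 = 16)%N) //; lra.
  have h2 : 2 ^+ 4 * q x * #|B'|%:R <= q (z / 1000 / 1000) * q x * #|B'|%:R.
    by apply: ler_wpM2r => //; apply: ler_wpM2r => //; exact: large_const.
  have := le_trans h1 h2; rewrite powD // => h3.
  have c0 : 0 < q (z / 1000 / 1000 + x) by rewrite powR_gt0.
  rewrite -(ler_pM2l c0); apply: le_trans h3; rewrite powD //.
  by apply: pow_le => //; lra.
have K10 : (0 < K1)%N by rewrite muln_gt0 !expn_gt0 K0.
have B'hi : #|B'|%:R <= q (1 / 2).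
  by apply: le_trans hB; rewrite ler_nat subset_leq_card.
have h1 := structured_bound pr_p p4 k0 Om0 uniq_rep z0 z1 Myz s0 s1 large large_fact
   sum_n sum_n2 K10 hdiff hK1 B'lo B'hi.
have cB' : (0 < #|B'|)%N by rewrite card_gt0.
have cD : (#|B| = #|B'| + #|B :\: B'|)%N by rewrite -(cardsID B' B) (setIidPr sB').
have h2 : chirp_sum R a1 Om (B :\: B') <=
   #|B :\: B'|%:R * q (1 / 2) * q (- sigma) + q (alpha + 1 - x / 4).
  apply: IH; first by move: cB cB'; rewrite cD; clear; lia.
  by apply: le_trans hB; rewrite ler_nat cD leq_addl.
(* The main terms are linear in the cardinality and add up; the remainder term is present only in
   the bound for B minus B'. *)
apply: le_trans (chirp_sum_split sB') _.
rewrite cD natrD !mulrDl -addrA; exact: lerD.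
Qed.

End OneRow.

(** * The double sum over pairs of chirp rates *)

Section Total.
Variables (R : realType) (p : nat).
Hypotheses (pr_p : prime p) (p4 : (4 < p)%N).
Local Notation P := (p%:R : R).
Local Notation q a := (P `^ a).
Local Notation family := ('F_p -> {set 'F_p}).

Definition pair_abs (O1 O2 : family) (a1 a2 : 'F_p) : R :=
  cabs (\sum_(b1 in O1 a1) \sum_(b2 in O2 a2) addchar R (- (b1 - b2) ^+ 2 * node a1 a2)).

Lemma pair_abs_ge0 O1 O2 a1 a2 : 0 <= pair_abs O1 O2 a1 a2.
Proof. exact: cabs_ge0. Qed.

Lemma pair_absC O1 O2 a1 a2 : pair_abs O1 O2 a1 a2 = pair_abs O2 O1 a2 a1.
Proof.
rewrite /pair_abs -cabs_conj conjc_sum exchange_big /=; congr cabs.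
under eq_bigr do rewrite conjc_sum.
apply: eq_bigr => b1 _; apply: eq_bigr => b2 _; rewrite -addcharN //; congr addchar.
by rewrite /node -[a2 - a1]opprB mulrN invrN -[b2 - b1]opprB sqrrN !mulNr mulrN opprK.
Qed.

Lemma pair_abs_le O1 O2 a1 a2 : pair_abs O1 O2 a1 a2 <= #|O1 a1|%:R * #|O2 a2|%:R.
Proof.
apply: le_trans (cabs_sum _ _ _) _; rewrite mulr_natl -sumr_const.
apply: ler_sum => b1 _; apply: le_trans (cabs_sum _ _ _) _.
rewrite -sumr_const; under eq_bigr do rewrite cabs_addchar.
by rewrite sumr_const.
Qed.

Variables (A B : {set 'F_p}) (k : nat).
Hypothesis k0 : (0 < k)%N.
Local Notation m := (k + k)%N.
Local Notation M := (m%:R : R).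
Hypothesis uniq_rep : forall a, a \in A -> forall s t : m.-tuple 'F_p,
  {subset s <= A :\ a} -> {subset t <= A :\ a} ->
  \sum_(j < m) 1 / (a - tnth s j) = \sum_(j < m) 1 / (a - tnth t j) ->
  perm_eq s t.
Variables (y z sigma alpha x : R).
Hypotheses (z0 : 0 < z) (z1 : z <= 1 / 2) (Myz : M * y = z).
Hypotheses (s0 : 0 <= M * sigma) (s1 : M * sigma <= z / 800 / 100).
Hypotheses (x0 : 0 < x) (xz : x <= z / 1600 / 105).
Hypothesis large : 2 ^+ 60 <= q (z / 100 / 100).
Hypothesis large_fact : (m`!)%:R <= q (z / 100 / 100).
Hypothesis large32 : 2 ^+ 32 <= q (z / 1000 / 1000).
Hypothesis cardA : #|A|%:R <= q alpha.

Let P1 : 1 < P. Proof. by rewrite ltr1n prime_gt1. Qed.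
Let P0 : 0 < P. Proof. exact: lt_trans ltr01 P1. Qed.
Let q0 a : 0 <= q a. Proof. exact: powR_ge0. Qed.

Definition light (O : family) a : bool := #|O a|%:R < q (1 / 2 - y).

(** For fixed a1 the sets that are heavy or indexed by a1 are emptied. Lightness then enters through
    the second moment alone: it is at most p^(1/2 - y) times the first. The remainder of each row is
    paid for every a1 in A, hence 2 alpha. *)
Lemma light_bound (O1 O2 : family) :
  (forall a, a \notin A -> O1 a = set0) -> (forall a, a \notin A -> O2 a = set0) ->
  (\sum_a #|O1 a|)%:R <= q (1 / 2) -> (\sum_a #|O2 a|)%:R <= q (1 / 2) ->
  \sum_a1 \sum_(a2 | (a2 != a1) && light O2 a2) pair_abs O1 O2 a1 a2 <=
  q (1 - sigma) + q (2 * alpha + 1 - x / 4).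
Proof.
move=> sO1 sO2 h1 h2.
have hrow a1 : \sum_(a2 | (a2 != a1) && light O2 a2) pair_abs O1 O2 a1 a2 <=
   #|O1 a1|%:R * (q (1 / 2) * q (- sigma)) + (a1 \in A)%:R * q (alpha + 1 - x / 4).
  have [a1A|a1A] := boolP (a1 \in A); last first.
    rewrite sO1 // cards0 !mul0r addr0 big1 // => a2 _.
    by rewrite /pair_abs sO1 // big_set0 cabs0.
  rewrite [X in _ <= _ + X]mul1r.
  pose Om a := if (a != a1) && light O2 a then O2 a else set0.
  have cOm a : (#|Om a| <= #|O2 a|)%N by rewrite /Om; case: ifP; rewrite // cards0.
  have Om0 a : a \notin A :\ a1 -> Om a = set0.
    rewrite !inE negb_and negbK /Om => /orP[/eqP->|aA]; first by rewrite eqxx.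
    by rewrite sO2 // if_same.
  have sOm : (\sum_a #|Om a|)%:R <= q (1 / 2).
    by apply: le_trans h2; rewrite ler_nat; apply: leq_sum => a _.
  have sOm2 : (\sum_a #|Om a| ^ 2)%:R <= q (1 - y).
    apply: (@le_trans _ _ (q (1 / 2 - y) * (\sum_a #|Om a|)%:R)).
      rewrite !natr_sum big_distrr; apply: ler_sum => a _ /=.
      rewrite natrX expr2; apply: ler_wpM2r => //.
      rewrite /Om; case: ifP => [/andP[_ /ltW]|_] //; by rewrite cards0.
    apply: (@le_trans _ _ (q (1 / 2 - y) * q (1 / 2))); first exact: ler_wpM2l.
    by rewrite powD //; apply: pow_le => //; lra.
  have hB : #|O1 a1|%:R <= q (1 / 2).
    by apply: le_trans h1; rewrite ler_nat (bigD1 a1) //= leq_addr.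
  have cA2 : #|A :\ a1|%:R <= q alpha.
    by apply: le_trans cardA; rewrite ler_nat subset_leq_card // subD1set.
  have na1 : a1 \notin A :\ a1 by rewrite !inE eqxx.
  have h := one_row_bound pr_p p4 k0 na1 Om0 (uniq_rep a1A) z0 z1 Myz s0 s1 x0 xz
    large large_fact large32 sOm sOm2 cA2 hB.
  apply: (@le_trans _ _ (chirp_sum R a1 Om (O1 a1))); last by rewrite mulrA.
  rewrite big_mkcond; apply: ler_sum => a2 _ /=.
  rewrite /Om; case: ifP => [_|_]; last by rewrite big_set0.
  by rewrite /pair_abs exchange_big; exact: cabs_sum.
apply: le_trans (ler_sum _ (fun a1 _ => hrow a1)) _.
rewrite big_split -!big_distrl /=; apply: lerD.
  apply: (@le_trans _ _ (q (1 / 2) * (q (1 / 2) * q (- sigma)))).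
    by apply: ler_wpM2r; rewrite ?mulr_ge0 // -natr_sum.
  by rewrite !powD //; apply: pow_le => //; lra.
have -> : \sum_a ((a \in A)%:R : R) = #|A|%:R.
  by rewrite -natr_sum -sum1_card [in RHS]big_mkcond; congr _%:R; apply: eq_bigr => a _; case: ifP.
apply: (@le_trans _ _ (q alpha * q (alpha + 1 - x / 4))); first exact: ler_wpM2r.
by rewrite powD //; apply: pow_le => //; lra.
Qed.

Variables (l gamma eta : R).
Hypothesis energyB : forall S : {set 'F_p}, S \subset B -> q l <= #|S|%:R ->
  (additive_energy S S)%:R <= q (- gamma + eta) * #|S|%:R ^+ 3.

(** Two sets that are not light satisfy n1 n2 >= p^(1 - 2 y), which absorbs the factor p of
    [pair_energy_bound] at the price p^(2 y), that is y / 4 after the eighth root. *)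
Lemma heavy_bound (O1 O2 : family) a1 a2 : a1 != a2 ->
  O1 a1 \subset B -> O2 a2 \subset B -> ~~ light O1 a1 -> ~~ light O2 a2 ->
  q l <= #|O1 a1|%:R -> q l <= #|O2 a2|%:R ->
  pair_abs O1 O2 a1 a2 <= #|O1 a1|%:R * #|O2 a2|%:R * q ((y - gamma + eta) / 4).
Proof.
move=> a12 sB1 sB2 l1 l2 g1 g2; set n1 : R := #|O1 a1|%:R; set n2 : R := #|O2 a2|%:R.
have n10 : 0 <= n1 by exact: ler0n.
have n20 : 0 <= n2 by exact: ler0n.
rewrite -(ler_pXn2r (isT : (0 < 8)%N)) ?nnegrE ?mulr_ge0 ?pair_abs_ge0 //.
have a21 : a2 != a1 by rewrite eq_sym.
apply: le_trans (@pair_energy_bound R p pr_p _ _ _ (node_neq0 pr_p p4 a21)) _.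
rewrite -/n1 -/n2.
apply: (@le_trans _ _ ((n1 * n2) ^+ 4 * (q 1 * (q (- gamma + eta) * n1 ^+ 3) *
   (q (- gamma + eta) * n2 ^+ 3)))).
  apply: ler_wpM2l; first by rewrite exprn_ge0 ?mulr_ge0.
  rewrite pow1 //; apply: ler_pM; rewrite ?mulr_ge0 ?energyB //.
  by apply: ler_wpM2l => //; exact: energyB.
have -> : (n1 * n2) ^+ 4 * (q 1 * (q (- gamma + eta) * n1 ^+ 3) *
   (q (- gamma + eta) * n2 ^+ 3)) =
   (n1 * n2) ^+ 7 * (q 1 * q (- gamma + eta) * q (- gamma + eta)) by ring.
have -> : (n1 * n2 * q ((y - gamma + eta) / 4)) ^+ 8 =
   (n1 * n2) ^+ 7 * (n1 * n2 * q ((y - gamma + eta) / 4) ^+ 8) by ring.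
apply: ler_wpM2l; first by rewrite exprn_ge0 ?mulr_ge0.
rewrite -/n1 -/n2 in l1 l2.
apply: (@le_trans _ _ (q (1 / 2 - y) * q (1 / 2 - y) * q ((y - gamma + eta) / 4) ^+ 8)).
  by rewrite powX // !powD //; apply: pow_le => //; lra.
apply: ler_wpM2r; first by rewrite exprn_ge0.
by move: l1 l2; rewrite /light -!leNgt => l1 l2; apply: ler_pM.
Qed.

Lemma total_bound (O1 O2 : family) :
  (forall a, a \notin A -> O1 a = set0) -> (forall a, a \notin A -> O2 a = set0) ->
  (forall a, O1 a \subset B) -> (forall a, O2 a \subset B) ->
  (\sum_a #|O1 a|)%:R <= q (1 / 2) -> (\sum_a #|O2 a|)%:R <= q (1 / 2) ->
  \sum_a1 \sum_(a2 | a2 != a1) pair_abs O1 O2 a1 a2 <=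
  2 * (q (1 - sigma) + q (2 * alpha + 1 - x / 4)) +
  (q (1 + (y - gamma + eta) / 4) + 2 * q (alpha + l + 1 / 2)).
Proof.
move=> sO1 sO2 sB1 sB2 h1 h2.
pose th := q ((y - gamma + eta) / 4).
have th0 : 0 <= th by exact: q0.
pose small (O : family) a : bool := #|O a|%:R < q l.
(* Each pair is charged to the first case that applies: O2 light; O1 light, with the roles exchanged
   by [pair_absC]; a set below p^l, bounded trivially; both heavy. *)
have hpt a1 a2 : a2 != a1 -> pair_abs O1 O2 a1 a2 <=
   (if light O2 a2 then pair_abs O1 O2 a1 a2 else 0) +
   (if light O1 a1 then pair_abs O2 O1 a2 a1 else 0) +
   (#|O1 a1|%:R * #|O2 a2|%:R * th +
     ((small O1 a1)%:R * #|O1 a1|%:R * #|O2 a2|%:R +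
      #|O1 a1|%:R * ((small O2 a2)%:R * #|O2 a2|%:R))).
  move=> a21; have a12 : a1 != a2 by rewrite eq_sym.
  have pge := pair_abs_ge0 O1 O2 a1 a2.
  have pge' := pair_abs_ge0 O2 O1 a2 a1.
  have t0 : 0 <= #|O1 a1|%:R * #|O2 a2|%:R * th by rewrite !mulr_ge0.
  have u0 : 0 <= (small O1 a1)%:R * #|O1 a1|%:R * #|O2 a2|%:R :> R by rewrite !mulr_ge0 ?ler0n.
  have v0 : 0 <= #|O1 a1|%:R * ((small O2 a2)%:R * #|O2 a2|%:R) :> R by rewrite !mulr_ge0 ?ler0n.
  case: ifP => [_|/negbT l2]; first by case: ifP => _; rewrite -addrA lerDl !addr_ge0.
  rewrite add0r; case: ifP => [_|/negbT l1].
    by rewrite pair_absC lerDl !addr_ge0.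
  rewrite add0r; have [sm1|sm1] := boolP (small O1 a1).
    rewrite mul1r; apply: le_trans (pair_abs_le _ _ _ _) _.
    by rewrite addrCA lerDl addr_ge0.
  have [sm2|sm2] := boolP (small O2 a2).
    rewrite mul1r mul0r mul0r add0r; apply: le_trans (pair_abs_le _ _ _ _) _.
    by rewrite lerDr.
  rewrite !mul0r mulr0 !addr0; move: sm1 sm2; rewrite /small -!leNgt => sm1 sm2.
  exact: heavy_bound.
apply: (@le_trans _ _ (\sum_a1 \sum_(a2 | a2 != a1)
   ((if light O2 a2 then pair_abs O1 O2 a1 a2 else 0) +
    (if light O1 a1 then pair_abs O2 O1 a2 a1 else 0) +
   (#|O1 a1|%:R * #|O2 a2|%:R * th +
     ((small O1 a1)%:R * #|O1 a1|%:R * #|O2 a2|%:R +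
      #|O1 a1|%:R * ((small O2 a2)%:R * #|O2 a2|%:R)))))).
  by apply: ler_sum => a1 _; apply: ler_sum => a2 a21; exact: hpt.
under eq_bigr do rewrite big_split /=.
rewrite big_split /=; apply: lerD.
  under eq_bigr do rewrite big_split /=.
  rewrite big_split /= mulr_natl mulr2n; apply: lerD.
    under eq_bigr do rewrite -big_mkcondr /=.
    exact: light_bound.
  rewrite (exchange_big_dep predT) //=.
  apply: le_trans (light_bound sO2 sO1 h2 h1).
  apply: ler_sum => a2 _; rewrite big_mkcondr /= le_eqVlt; apply/orP; left; apply/eqP.
  by apply: eq_bigl => a1; rewrite eq_sym.
apply: (@le_trans _ _ (\sum_a1 \sum_a2 (#|O1 a1|%:R * #|O2 a2|%:R * th +
     ((small O1 a1)%:R * #|O1 a1|%:R * #|O2 a2|%:R +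
      #|O1 a1|%:R * ((small O2 a2)%:R * #|O2 a2|%:R))))).
  apply: ler_sum => a1 _; rewrite [leRHS](bigID (fun a2 => a2 != a1)) /= lerDl.
  by apply: sumr_ge0 => a2 _; rewrite !addr_ge0 ?mulr_ge0.
have eN1 : \sum_a #|O1 a|%:R <= q (1 / 2) by rewrite -natr_sum.
have eN2 : \sum_a #|O2 a|%:R <= q (1 / 2) by rewrite -natr_sum.
have N10 : 0 <= \sum_a #|O1 a|%:R :> R by apply: sumr_ge0.
have N20 : 0 <= \sum_a #|O2 a|%:R :> R by apply: sumr_ge0.
have hsm (O : family) : (forall a, a \notin A -> O a = set0) ->
    \sum_a (small O a)%:R * #|O a|%:R <= q (alpha + l).
  move=> sO; apply: (@le_trans _ _ (\sum_a (a \in A)%:R * q l)).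
    apply: ler_sum => a _; have [aA|aA] := boolP (a \in A); last first.
      by rewrite sO // cards0 mulr0 mul0r.
    rewrite mul1r /small; case: ltP => [/ltW h|_]; first by rewrite mul1r.
    by rewrite mul0r.
  rewrite -big_distrl /=.
  have -> : \sum_a ((a \in A)%:R : R) = #|A|%:R.
    by rewrite -natr_sum -sum1_card [in RHS]big_mkcond; congr _%:R; apply: eq_bigr => a _; case: ifP.
  apply: (@le_trans _ _ (q alpha * q l)); first exact: ler_wpM2r.
  by rewrite powD.
have fac (f g : 'F_p -> R) : \sum_a1 \sum_a2 f a1 * g a2 = (\sum_a f a) * (\sum_a g a).
  by rewrite big_distrl; apply: eq_bigr => a _; rewrite big_distrr.
under eq_bigr do rewrite big_split /=.
rewrite big_split /=; apply: lerD.
  under eq_bigr do under eq_bigr do rewrite -mulrA.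
  rewrite (fac (fun a => #|O1 a|%:R) (fun a => #|O2 a|%:R * th)) -big_distrl /= mulrA.
  apply: (@le_trans _ _ (q (1 / 2) * q (1 / 2) * th)).
    by apply: ler_wpM2r => //; exact: ler_pM.
  by rewrite /th !powD //; apply: pow_le => //; lra.
under eq_bigr do rewrite big_split /=.
rewrite big_split /= mulr_natl mulr2n; apply: lerD.
  rewrite (fac (fun a => (small O1 a)%:R * #|O1 a|%:R) (fun a => #|O2 a|%:R)).
  apply: (@le_trans _ _ (q (alpha + l) * q (1 / 2))); last by rewrite powD.
  apply: ler_pM => //; last exact: hsm.
  by apply: sumr_ge0 => a _; rewrite mulr_ge0.
rewrite (fac (fun a => #|O1 a|%:R) (fun a => (small O2 a)%:R * #|O2 a|%:R)).
apply: (@le_trans _ _ (q (1 / 2) * q (alpha + l))).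
  apply: ler_pM => //; last exact: hsm.
  by apply: sumr_ge0 => a _; rewrite mulr_ge0.
by rewrite powD // addrC.
Qed.

End Total.

(** * The Gram matrix of the chirps *)

Section Gram.
Variables (R : realType) (p : nat).
Hypotheses (pr_p : prime p) (p4 : (4 < p)%N).
Local Notation e := (@addchar R p).
Implicit Types (d a b c x : 'F_p) (q : 'F_p * 'F_p).

Lemma sum_ord_Fp (T : nmodType) (F : 'F_p -> T) :
  \sum_(t < p) F (nat_of_ord t)%:R = \sum_x F x.
Proof.
rewrite (reindex (cast_ord (Fp_cast pr_p))) /=.
  by apply: eq_bigr => x _; rewrite natr_Zp.
by exists (cast_ord (esym (Fp_cast pr_p))) => x _; [exact: cast_ordK|exact: cast_ordKV].
Qed.

Lemma reindex_add (T : nmodType) c (F : 'F_p -> T) : \sum_x F (x + c) = \sum_x F x.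
Proof.
rewrite [RHS](reindex (fun x => x + c)) //=.
by exists (fun x => x - c) => x _; rewrite ?addrK ?subrK.
Qed.

Definition gauss d : R[i] := \sum_x e (d * x ^+ 2).

(** After the substitution x = h + y the difference of the squares is linear in y, and orthogonality
    leaves only h = 0. *)
Lemma cabs_gauss d : d != 0 -> cabs (gauss d) = Num.sqrt p%:R.
Proof.
move=> d0.
have two0 : (2 : 'F_p) != 0 by apply: Fp_natr_neq0 => //; rewrite /= (ltn_trans _ p4).
have h : real_complex R (cabs (gauss d) ^+ 2) = real_complex R p%:R.
  rewrite sqr_cabs /gauss conjc_sum.
  have mulS (f g : 'F_p -> R[i]) : (\sum_x f x) * (\sum_y g y) = \sum_y \sum_h f (h + y) * g y.
    rewrite big_distrr; apply: eq_bigr => y _ /=.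
    by rewrite big_distrl -[LHS](reindex_add y).
  have -> : (\sum_x e (d * x ^+ 2)) * (\sum_y conjc (e (d * y ^+ 2))) =
     \sum_y \sum_h e (d * h ^+ 2) * e (y * (2 * d * h)).
    rewrite mulS; apply: eq_bigr => y _; apply: eq_bigr => h _.
    by rewrite -addcharN // -!addcharD //; congr e; ring.
  rewrite exchange_big (bigD1 0) //= [X in _ + X]big1 ?addr0 => [|h h0].
    under eq_bigr do rewrite expr0n !mulr0 !addchar0 mulr1.
    by rewrite sumr_const card_Fp // rmorph_nat.
  by rewrite -big_distrr /= sum_addchar // !mulf_eq0 (negbTE two0) (negbTE d0) (negbTE h0) mulr0.
rewrite -[LHS]ger0_norm ?cabs_ge0 // -sqrtr_sqr.
by rewrite (complexI h).
Qed.

Definition gram q q' : R[i] :=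
  real_complex R (p%:R)^-1 * \sum_x e ((q.1 - q'.1) * x ^+ 2 + (q.2 - q'.2) * x).

Lemma gram_diag q q' : q.1 = q'.1 -> gram q q' = (q == q')%:R.
Proof.
case: q q' => a b [a' b'] /= ->; rewrite /gram /= subrr.
under eq_bigr do rewrite mul0r add0r mulrC.
rewrite sum_addchar // subr_eq0 xpair_eqE eqxx /=.
case: eqP => _; last by rewrite mulr0.
rewrite -(rmorph_nat (real_complex R) p) -real_complexM mulVf //.
by rewrite pnatr_eq0 -lt0n prime_gt0.
Qed.

Lemma gram_offdiag q q' : q.1 != q'.1 -> gram q q' =
  real_complex R (p%:R)^-1 * gauss (q.1 - q'.1) *
    e (- (q.2 - q'.2) ^+ 2 * node q.1 q'.1).
Proof.
move=> h; have d0 : q.1 - q'.1 != 0 by rewrite subr_eq0.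
have two0 : (2 : 'F_p) != 0 by apply: Fp_natr_neq0 => //; rewrite /= (ltn_trans _ p4).
have four0 : (4 : 'F_p) != 0 by apply: Fp_natr_neq0.
rewrite /gram /gauss -mulrA; congr (_ * _).
rewrite big_distrl /= -[RHS](reindex_add ((q.2 - q'.2) / (2 * (q.1 - q'.1)))).
apply: eq_bigr => x _; rewrite -addcharD //; congr e; rewrite /node.
move: d0; set d := q.1 - q'.1; set c := q.2 - q'.2 => d0.
by field; rewrite d0 two0 four0.
Qed.

Definition gram_off q q' : R[i] := if q.1 == q'.1 then 0 else gram q q'.

Lemma gram_split q q' : gram q q' = (q == q')%:R + gram_off q q'.
Proof.
rewrite /gram_off; have [h|h] := eqVneq q.1 q'.1; first by rewrite addr0 gram_diag.
by rewrite (_ : q == q' = false) ?add0r //; apply: contraNF h => /eqP ->.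
Qed.

Lemma gram_coef : (p%:R : R)^-1 * Num.sqrt p%:R = p%:R `^ (- (1 / 2)).
Proof.
have p0 : 0 < p%:R :> R by rewrite ltr0n prime_gt0.
have p1 : 1 < p%:R :> R by rewrite ltr1n prime_gt1.
rewrite -{1 2}(pow1 p1) pow_sqrt // -powRN powD //; congr (_ `^ _); lra.
Qed.

Lemma cabs_gram_off_le q q' : cabs (gram_off q q') <= p%:R `^ (- (1 / 2)).
Proof.
rewrite /gram_off; case: eqP => [_|/eqP h]; first by rewrite cabs0 powR_ge0.
rewrite gram_offdiag // !cabsM cabs_addchar mulr1 cabs_gauss ?subr_eq0 // cabsR.
by rewrite ger0_norm ?invr_ge0 // gram_coef.
Qed.

Definition slice (I : {set 'F_p * 'F_p}) a : {set 'F_p} := [set b | (a, b) \in I].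

Lemma sum_slice (T : nmodType) (I : {set 'F_p * 'F_p}) (F : 'F_p -> 'F_p -> T) :
  \sum_(q in I) F q.1 q.2 = \sum_a \sum_(b in slice I a) F a b.
Proof. by rewrite pair_big_dep /=; apply: eq_bigl => -[a b]; rewrite inE. Qed.

Lemma card_slice I : (\sum_a #|slice I a| = #|I|)%N.
Proof.
rewrite -sum1_card (eq_bigr (fun a => \sum_(b in slice I a) 1)%N); last first.
  by move=> a _; rewrite sum1_card.
by rewrite pair_big_dep /=; apply: eq_bigl => -[a b]; rewrite inE.
Qed.

Lemma gram_off_sum_le (I J : {set 'F_p * 'F_p}) :
  cabs (\sum_(q in I) \sum_(q' in J) gram_off q q') <=
  p%:R `^ (- (1 / 2)) *
    \sum_a1 \sum_(a2 | a2 != a1) pair_abs R (slice I) (slice J) a1 a2.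
Proof.
have -> : \sum_(q in I) \sum_(q' in J) gram_off q q' =
   \sum_a1 \sum_(a2 | a2 != a1) \sum_(b1 in slice I a1) \sum_(b2 in slice J a2)
     gram_off (a1, b1) (a2, b2).
  transitivity (\sum_a1 \sum_(b1 in slice I a1) \sum_a2 \sum_(b2 in slice J a2)
     gram_off (a1, b1) (a2, b2)).
    rewrite -(sum_slice I (fun a1 b1 => \sum_a2 \sum_(b2 in slice J a2)
       gram_off (a1, b1) (a2, b2))); apply: eq_bigr => -[a1 b1] _ /=.
    rewrite -(sum_slice J (fun a2 b2 => gram_off (a1, b1) (a2, b2))).
    by apply: eq_bigr => -[a2 b2] _.
  apply: eq_bigr => a1 _; rewrite exchange_big [RHS]big_mkcond /=.
  apply: eq_bigr => a2 _; case: eqP => //= ->.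
  by rewrite big1 // => b1 _; rewrite big1 // => b2 _; rewrite /gram_off eqxx.
apply: le_trans (cabs_sum _ _ _) _; rewrite big_distrr; apply: ler_sum => a1 _ /=.
apply: le_trans (cabs_sum _ _ _) _; rewrite big_distrr; apply: ler_sum => a2 a21 /=.
have a12 : a1 != a2 by rewrite eq_sym.
have -> : \sum_(b1 in slice I a1) \sum_(b2 in slice J a2) gram_off (a1, b1) (a2, b2) =
   real_complex R (p%:R)^-1 * gauss (a1 - a2) *
   \sum_(b1 in slice I a1) \sum_(b2 in slice J a2) e (- (b1 - b2) ^+ 2 * node a1 a2).
  rewrite big_distrr; apply: eq_bigr => b1 _ /=; rewrite big_distrr; apply: eq_bigr => b2 _ /=.
  by rewrite /gram_off /= (negbTE a12) gram_offdiag.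
rewrite !cabsM cabs_gauss ?subr_eq0 // cabsR ger0_norm ?invr_ge0 //.
by rewrite gram_coef.
Qed.

End Gram.

Section ChirpMatrix.
Variables (R : realType) (p : nat) (A B : {set 'F_p}).
Hypotheses (pr_p : prime p) (p4 : (4 < p)%N).
Local Notation N := #|setX A B|.

Definition col_pair (j : 'I_N) : 'F_p * 'F_p := enum_val j.

Lemma l2normE n (x : 'cV[R[i]]_n) : l2norm x ^+ 2 = \sum_(k < n) cabs (x k ord0) ^+ 2.
Proof. by rewrite sqr_sqrtr // sumr_ge0 // => k _; rewrite sqr_ge0. Qed.

Lemma chirp_gram (x : 'cV[R[i]]_N) :
  real_complex R (l2norm (chirp_matrix R A B *m x) ^+ 2) =
  real_complex R (l2norm x ^+ 2) +
  \sum_j \sum_j' x j ord0 * conjc (x j' ord0) *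
    gram_off R (col_pair j) (col_pair j').
Proof.
have e1 : real_complex R (l2norm (chirp_matrix R A B *m x) ^+ 2) =
   \sum_j \sum_j' x j ord0 * conjc (x j' ord0) * gram R (col_pair j) (col_pair j').
  rewrite l2normE real_complex_sum.
  have [u uE] : exists u : 'I_N -> 'F_p -> R[i], forall j t,
      u j t = addchar R ((col_pair j).1 * t ^+ 2 + (col_pair j).2 * t).
    by exists (fun j t => addchar R ((col_pair j).1 * t ^+ 2 + (col_pair j).2 * t)).
  pose s := real_complex R (Num.sqrt p%:R)^-1.
  have eM (t : 'I_p) (j : 'I_N) : chirp_matrix R A B t j = s * u j (nat_of_ord t)%:R.
    by rewrite mxE uE /col_pair; case: (enum_val j).
  have -> : \sum_(t < p) real_complex R (cabs ((chirp_matrix R A B *m x) t ord0) ^+ 2) =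
     \sum_(t < p) \sum_j \sum_j' x j ord0 * conjc (x j' ord0) *
       (real_complex R (p%:R)^-1 * (u j (nat_of_ord t)%:R * conjc (u j' (nat_of_ord t)%:R))).
    apply: eq_bigr => t _; rewrite sqr_cabs mxE conjc_sum big_distrl; apply: eq_bigr => j _ /=.
    rewrite big_distrr; apply: eq_bigr => j' _ /=; rewrite !eM !conjcM.
    have -> : real_complex R (p%:R)^-1 = s * conjc s.
      rewrite -sqr_cabs cabsR ger0_norm ?invr_ge0 ?sqrtr_ge0 //.
      by rewrite exprVn sqr_sqrtr.
    ring.
  rewrite (sum_ord_Fp pr_p (fun t => \sum_j \sum_j' x j ord0 * conjc (x j' ord0) *
       (real_complex R (p%:R)^-1 * (u j t * conjc (u j' t))))).
  rewrite exchange_big; apply: eq_bigr => j _; rewrite exchange_big.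
  apply: eq_bigr => j' _ /=; rewrite /gram -!big_distrr /=; congr (_ * (_ * _)).
  by apply: eq_bigr => t _; rewrite !uE -addcharN // -addcharD //; congr addchar; ring.
rewrite e1 l2normE real_complex_sum -big_split; apply: eq_bigr => j _ /=.
under eq_bigr do rewrite gram_split // mulrDr.
rewrite big_split /=; congr (_ + _).
rewrite (bigD1 j) //= eqxx mulr1 big1 ?addr0 ?sqr_cabs // => j' j'j.
rewrite (_ : col_pair j == col_pair j' = false) ?mulr0 //.
by apply: contraNF j'j => /eqP/enum_val_inj ->.
Qed.

End ChirpMatrix.

(** * From flat vectors to sparse vectors *)

Section Weights.
Variable R : realType.
Implicit Types z : R[i].

Lemma ReD (z w : R[i]) : complex.Re (z + w) = complex.Re z + complex.Re w.
Proof. by case: z w => [a b] [c d]. Qed.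

Lemma ImD (z w : R[i]) : complex.Im (z + w) = complex.Im z + complex.Im w.
Proof. by case: z w => [a b] [c d]. Qed.

Lemma Re_sum (I : Type) (r : seq I) (P : pred I) (F : I -> R[i]) :
  complex.Re (\sum_(i <- r | P i) F i) = \sum_(i <- r | P i) complex.Re (F i).
Proof. by apply: (big_morph _ ReD). Qed.

Lemma Im_sum (I : Type) (r : seq I) (P : pred I) (F : I -> R[i]) :
  complex.Im (\sum_(i <- r | P i) F i) = \sum_(i <- r | P i) complex.Im (F i).
Proof. by apply: (big_morph _ ImD). Qed.

Lemma Re_le_cabs z : `|complex.Re z| <= cabs z.
Proof. by rewrite cabsE -sqrtr_sqr ler_wsqrtr // lerDl sqr_ge0. Qed.

Lemma Im_le_cabs z : `|complex.Im z| <= cabs z.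
Proof. by rewrite cabsE -sqrtr_sqr ler_wsqrtr // lerDr sqr_ge0. Qed.

Lemma cabs_le_ReIm z : cabs z <= `|complex.Re z| + `|complex.Im z|.
Proof.
rewrite cabsE -[leRHS]ger0_norm ?addr_ge0 // -sqrtr_sqr ler_wsqrtr //.
rewrite sqrrD !real_normK ?num_real // lerD2r lerDl.
by rewrite mulrn_wge0 // mulr_ge0.
Qed.

Lemma sum_norm_le (I : finType) (U : {set I}) (f : I -> R) (b : R) :
  (forall S : {set I}, S \subset U -> `|\sum_(i in S) f i| <= b) ->
  \sum_(i in U) `|f i| <= 2 * b.
Proof.
move=> hb; pose V := [set i in U | 0 <= f i].
have sV : V \subset U by apply/subsetP => i; rewrite inE => /andP[].
rewrite (big_setID V) /= (setIidPr sV).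
have -> : \sum_(i in V) `|f i| = \sum_(i in V) f i.
  by apply: eq_bigr => i; rewrite inE => /andP[_ h]; rewrite ger0_norm.
have -> : \sum_(i in U :\: V) `|f i| = - \sum_(i in U :\: V) f i.
  rewrite -sumrN; apply: eq_bigr => i; rewrite !inE negb_and.
  by case: (i \in U); rewrite ?andbF //= andbT -ltNge => h; rewrite ltr0_norm.
have := hb _ sV; have := hb (U :\: V) (subsetDl _ _).
rewrite !ler_norml => /andP[h1 h2] /andP[h3 h4]; lra.
Qed.

(** Absolute values of the c i are sums over subsets once real and imaginary parts are separated and
    each is split by sign, whence the factor 4. A bound uniform over subsets thus tolerates
    arbitrary phases in w. *)
Lemma bounded_weights (I : finType) (U : {set I}) (c w : I -> R[i]) (b t : R) :
  0 <= t -> (forall S : {set I}, S \subset U -> cabs (\sum_(i in S) c i) <= b) ->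
  (forall i, i \in U -> cabs (w i) <= t) ->
  cabs (\sum_(i in U) w i * c i) <= 4 * (t * b).
Proof.
move=> t0 hb hw; apply: le_trans (cabs_sum _ _ _) _.
apply: (@le_trans _ _ (t * \sum_(i in U) (`|complex.Re (c i)| + `|complex.Im (c i)|))).
  rewrite big_distrr; apply: ler_sum => i iU /=; rewrite cabsM.
  by apply: ler_pM; rewrite ?cabs_ge0 ?hw ?cabs_le_ReIm.
rewrite mulrCA; apply: ler_wpM2l => //; rewrite big_split /=.
have h1 : \sum_(i in U) `|complex.Re (c i)| <= 2 * b.
  apply: sum_norm_le => S sS; rewrite -Re_sum.
  exact: le_trans (Re_le_cabs _) (hb _ sS).
have h2 : \sum_(i in U) `|complex.Im (c i)| <= 2 * b.
  apply: sum_norm_le => S sS; rewrite -Im_sum.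
  exact: le_trans (Im_le_cabs _) (hb _ sS).
by lra.
Qed.

End Weights.

Section Blocks.
Variables (R : realType) (I : finType).

Lemma exists_subset_card (S : {set I}) k : (k <= #|S|)%N ->
  exists2 T : {set I}, T \subset S & #|T| = k.
Proof.
move=> hk; exists [set x in take k (enum S)].
  by apply/subsetP => x; rewrite inE => /mem_take; rewrite mem_enum.
rewrite cardsE (card_uniqP _) ?take_uniq ?enum_uniq // size_take_min -cardE.
exact/minn_idPl.
Qed.

(** Cutting off k elements at a time, the square roots of the block sizes are recombined by
    Cauchy-Schwarz, so n + 1 blocks cost only the square root of n + 1. *)
Lemma block_bound (f : {set I} -> R) (c : R) (k : nat) : 0 <= c ->
  (forall S T : {set I}, T \subset S -> f S <= f T + f (S :\: T)) ->
  (forall S : {set I}, (#|S| <= k)%N -> f S <= c * Num.sqrt #|S|%:R) ->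
  forall n (S : {set I}), (#|S| <= n.+1 * k)%N ->
    f S <= c * Num.sqrt n.+1%:R * Num.sqrt #|S|%:R.
Proof.
move=> c0 fsub fk; elim=> [|n IH] S hS.
  by rewrite sqrtr1 mulr1 fk // -[k]mul1n.
have [hk|/ltnW hk] := leqP #|S| k.
  apply: le_trans (fk _ hk) _; apply: ler_wpM2r; first exact: sqrtr_ge0.
  rewrite -{1}[c]mulr1; apply: ler_wpM2l => //.
  by rewrite -{1}(sqrtr1 R) ler_wsqrtr // ler1n.
have [T sT cT] := exists_subset_card hk.
have cS : (#|S| = #|T| + #|S :\: T|)%N by rewrite -(cardsID T S) (setIidPr sT).
have hD : (#|S :\: T| <= n.+1 * k)%N.
  by move: hS; rewrite cS cT mulSn leq_add2l.
apply: le_trans (fsub _ _ sT) _.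
apply: (@le_trans _ _ (c * (Num.sqrt #|T|%:R + Num.sqrt n.+1%:R * Num.sqrt #|S :\: T|%:R))).
  by rewrite mulrDr mulrA; apply: lerD; [apply: fk; rewrite cT|exact: IH].
rewrite -mulrA; apply: ler_wpM2l => //.
set a : R := Num.sqrt #|T|%:R; set b : R := Num.sqrt #|S :\: T|%:R; set s : R := Num.sqrt n.+1%:R.
have a0 : 0 <= a by exact: sqrtr_ge0.
have b0 : 0 <= b by exact: sqrtr_ge0.
have s0 : 0 <= s by exact: sqrtr_ge0.
have aa : a ^+ 2 = #|T|%:R by rewrite sqr_sqrtr.
have bb : b ^+ 2 = #|S :\: T|%:R by rewrite sqr_sqrtr.
have ss : s ^+ 2 = n.+1%:R by rewrite sqr_sqrtr.
have h0 : 0 <= a + s * b by rewrite addr_ge0 // mulr_ge0.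
rewrite -[leRHS]sqrtrM // -(ger0_norm h0) -sqrtr_sqr; apply: ler_wsqrtr.
rewrite cS natrD -[n.+2]addn1 natrD -aa -bb -ss.
by have := sqr_ge0 (s * a - b); nra.
Qed.

Variable G : I -> I -> R[i].
Definition bil (S T : {set I}) : R[i] := \sum_(i in S) \sum_(j in T) G i j.

Variables (eta : R) (k : nat).
Hypothesis eta0 : 0 <= eta.
Hypothesis flat : forall S T : {set I}, (#|S| <= k)%N -> (#|T| <= k)%N ->
  cabs (bil S T) <= eta * Num.sqrt #|S|%:R * Num.sqrt #|T|%:R.

Lemma flat_blocks n (S T : {set I}) :
  (#|S| <= n.+1 * k)%N -> (#|T| <= n.+1 * k)%N ->
  cabs (bil S T) <= eta * n.+1%:R * Num.sqrt #|S|%:R * Num.sqrt #|T|%:R.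
Proof.
move=> hS hT.
have step1 (U : {set I}) : (#|U| <= k)%N ->
   cabs (bil S U) <= eta * Num.sqrt n.+1%:R * Num.sqrt #|S|%:R * Num.sqrt #|U|%:R.
  move=> hU; have := @block_bound (fun V => cabs (bil V U)) (eta * Num.sqrt #|U|%:R) k _ _ _ n S hS.
  have -> : eta * Num.sqrt n.+1%:R * Num.sqrt #|S|%:R * Num.sqrt #|U|%:R =
    eta * Num.sqrt #|U|%:R * Num.sqrt n.+1%:R * Num.sqrt #|S|%:R by ring.
  apply.
  - by rewrite mulr_ge0 ?sqrtr_ge0.
  - move=> V W sW; rewrite /bil (big_setID W) /= (setIidPr sW); exact: cabsD.
  - by move=> V hV; rewrite mulrAC; exact: flat.
have := @block_bound (fun U => cabs (bil S U)) (eta * Num.sqrt n.+1%:R * Num.sqrt #|S|%:R) k _ _ _ n T hT.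
have -> : eta * Num.sqrt n.+1%:R * Num.sqrt #|S|%:R * Num.sqrt n.+1%:R =
    eta * n.+1%:R * Num.sqrt #|S|%:R.
  have ss : n.+1%:R = Num.sqrt n.+1%:R * Num.sqrt n.+1%:R :> R by rewrite -expr2 sqr_sqrtr.
  by rewrite [in RHS]ss; ring.
apply.
- by rewrite !mulr_ge0 ?sqrtr_ge0.
- move=> U W sW; apply: le_trans (cabsD _ _); rewrite /bil -big_split /=.
  rewrite le_eqVlt; apply/orP; left; apply/eqP; congr cabs; apply: eq_bigr => i _.
  by rewrite (big_setID W) /= (setIidPr sW).
- by move=> U hU; exact: step1.
Qed.

(** The last level L has no lower bound: it collects all remaining small values, zero included. *)
Lemma exists_level (u X r : R) (L : nat) : u <= X ->
  exists l : 'I_L.+1, u <= r^-1 ^+ l * X /\ ((l < L)%N -> r^-1 ^+ l.+1 * X <= u).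
Proof.
move=> uX; elim: L => [|L [l [h1 h2]]].
  by exists ord0; rewrite expr0 mul1r.
have [lL|lL] := ltnP l L.
  by exists (widen_ord (leqnSn _) l); split=> // _; exact: h2.
have el : nat_of_ord l = L by apply/eqP; rewrite eqn_leq lL -ltnS ltn_ord.
have [h|h] := leP u (r^-1 ^+ L.+1 * X).
  by exists ord_max; split=> //=; rewrite ltnn.
by exists (widen_ord (leqnSn _) l); split=> //= _; rewrite el ltW.
Qed.

(* [x] is cut into the sets where [|x_i|] is within a factor [r] of a fixed
   value, so that on each of them [x] is essentially a bounded weight. *)
Lemma flat_quadratic (x : I -> R[i]) (X r : R) (n L : nat) :
  0 <= X -> 1 <= r -> \sum_i cabs (x i) ^+ 2 <= X ^+ 2 ->
  (#|[set i | x i != 0%R]| <= n.+1 * k)%N ->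
  Num.sqrt #|[set i | x i != 0]|%:R <= r ^+ L ->
  cabs (\sum_i \sum_j x i * conjc (x j) * G i j) <=
  16 * (eta * n.+1%:R) * (L.+1%:R * (r * X)) ^+ 2.
Proof.
move=> X0 r1 hX hn hL; set U := [set i | x i != 0] in hn hL.
have r0 : 0 < r by apply: lt_le_trans r1.
have ri0 j : 0 <= r^-1 ^+ j * X by rewrite mulr_ge0 ?exprn_ge0 // invr_ge0 ltW.
have hx i : cabs (x i) <= X.
  rewrite -(ler_pXn2r (isT : (0 < 2)%N)) ?nnegrE ?cabs_ge0 //; apply: le_trans hX.
  by rewrite (bigD1 i) //= lerDl sumr_ge0 // => j _; rewrite sqr_ge0.
have [lev levP] : exists lev : I -> 'I_L.+1, forall i,
    cabs (x i) <= r^-1 ^+ lev i * X /\ ((lev i < L)%N -> r^-1 ^+ (lev i).+1 * X <= cabs (x i)).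
  exact: (fin_all_exists (fun i => exists_level r L (hx i))).
pose V (l : 'I_L.+1) := [set i in U | lev i == l].
pose tau (l : 'I_L.+1) := r^-1 ^+ l * X.
have tau0 l : 0 <= tau l by exact: ri0.
(* Below the last level, many entries of size at least tau / r would exceed the norm X. On the last
   level tau = r^(-L) X, and the sparsity bound, at most r^(2 L) nonzero entries, takes over. *)
have hV l : tau l * Num.sqrt #|V l|%:R <= r * X.
  have sVU : V l \subset U by apply/subsetP => i; rewrite inE => /andP[].
  have [lL|lL] := ltnP l L.
    have h : #|V l|%:R * (r^-1 * tau l) ^+ 2 <= X ^+ 2.
      apply: le_trans hX; rewrite mulr_natl -sumr_const.
      apply: (@le_trans _ _ (\sum_(i in V l) cabs (x i) ^+ 2)).
        apply: ler_sum => i; rewrite inE => /andP[_ /eqP el].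
        have t0 : 0 <= r^-1 * tau l by rewrite mulr_ge0 // invr_ge0 ltW.
        rewrite ler_pXn2r ?nnegrE ?cabs_ge0 //.
        have [_ hl] := levP i; rewrite /tau mulrA -exprS -el.
        by apply: hl; rewrite el.
      rewrite [leRHS](bigID (mem (V l))) /= lerDl.
      by apply: sumr_ge0 => i _; rewrite sqr_ge0.
    have h' : (r^-1 * tau l * Num.sqrt #|V l|%:R) ^+ 2 <= X ^+ 2.
      by rewrite exprMn sqr_sqrtr // mulrC.
    have nn : 0 <= r^-1 * tau l * Num.sqrt #|V l|%:R.
      by rewrite mulr_ge0 ?sqrtr_ge0 // mulr_ge0 // invr_ge0 ltW.
    have : r^-1 * tau l * Num.sqrt #|V l|%:R <= X.
      by rewrite -(ler_pXn2r (isT : (0 < 2)%N)) ?nnegrE.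
    by rewrite -mulrA ler_pdivrMl.
  have el : nat_of_ord l = L by apply/eqP; rewrite eqn_leq lL -ltnS ltn_ord.
  have hs : Num.sqrt #|V l|%:R <= r ^+ L.
    by apply: le_trans hL; rewrite ler_wsqrtr // ler_nat subset_leq_card.
  apply: (@le_trans _ _ (tau l * r ^+ L)); first exact: ler_wpM2l.
  rewrite /tau el mulrAC exprVn mulVf ?mul1r ?expf_neq0 ?gt_eqF //.
  by rewrite ler_peMl.
have split (F : I -> R[i]) : (forall i, x i = 0 -> F i = 0) ->
    \sum_i F i = \sum_(l < L.+1) \sum_(i in V l) F i.
  move=> F0; rewrite (partition_big lev predT) //=; apply: eq_bigr => l _.
  rewrite [RHS]big_mkcond [LHS]big_mkcond; apply: eq_bigr => i _; rewrite !inE.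
  by have [/F0 ->|] := eqVneq (x i) 0; rewrite ?if_same.
have -> : \sum_i \sum_j x i * conjc (x j) * G i j =
   \sum_(l < L.+1) \sum_(l' < L.+1) \sum_(i in V l) \sum_(j in V l') x i * (conjc (x j) * G i j).
  rewrite split => [|i xi]; last by rewrite big1 // => j _; rewrite xi !mul0r.
  apply: eq_bigr => l _; rewrite [RHS]exchange_big; apply: eq_bigr => i _ /=.
  have -> : \sum_j x i * conjc (x j) * G i j = \sum_j x i * (conjc (x j) * G i j).
    by apply: eq_bigr => j _; rewrite mulrA.
  by rewrite split // => j ->; rewrite conjc0 mul0r mulr0.
have hblock (l l' : 'I_L.+1) :
    cabs (\sum_(i in V l) \sum_(j in V l') x i * (conjc (x j) * G i j)) <=
    16 * (eta * n.+1%:R) * (r * X) ^+ 2.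
  have cV l0 (S : {set I}) : S \subset V l0 -> (#|S| <= n.+1 * k)%N.
    move=> sS; apply: leq_trans hn; apply: subset_leq_card; apply: subset_trans sS _.
    by apply/subsetP => i; rewrite inE => /andP[].
  pose b := eta * n.+1%:R * Num.sqrt #|V l|%:R * Num.sqrt #|V l'|%:R.
  have hb (S T : {set I}) : S \subset V l -> T \subset V l' -> cabs (bil S T) <= b.
    move=> sS sT; apply: le_trans (flat_blocks (cV _ _ sS) (cV _ _ sT)) _.
    apply: ler_pM; rewrite ?mulr_ge0 ?sqrtr_ge0 //; last first.
      by rewrite ler_wsqrtr // ler_nat subset_leq_card.
    apply: ler_wpM2l; first by rewrite mulr_ge0.
    by rewrite ler_wsqrtr // ler_nat subset_leq_card.
  have h1 (S : {set I}) : S \subset V l ->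
     cabs (\sum_(i in S) \sum_(j in V l') conjc (x j) * G i j) <= 4 * (tau l' * b).
    move=> sS; have -> : \sum_(i in S) \sum_(j in V l') conjc (x j) * G i j =
       \sum_(j in V l') conjc (x j) * \sum_(i in S) G i j.
      by rewrite exchange_big; apply: eq_bigr => j _; rewrite big_distrr.
    apply: bounded_weights => // [T sT|j].
      by rewrite exchange_big; exact: hb.
    by rewrite inE cabs_conj => /andP[_ /eqP <-]; have [] := levP j.
  have -> : \sum_(i in V l) \sum_(j in V l') x i * (conjc (x j) * G i j) =
     \sum_(i in V l) x i * \sum_(j in V l') conjc (x j) * G i j.
    by apply: eq_bigr => i _; rewrite big_distrr.
  apply: le_trans (bounded_weights (tau0 l) h1 _) _ => [i|].
    by rewrite inE => /andP[_ /eqP <-]; have [] := levP i.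
  have -> : 4 * (tau l * (4 * (tau l' * b))) = 16 * (eta * n.+1%:R) *
     ((tau l * Num.sqrt #|V l|%:R) * (tau l' * Num.sqrt #|V l'|%:R)) by rewrite /b; ring.
  apply: ler_wpM2l; first by rewrite !mulr_ge0.
  have tV0 l0 : 0 <= tau l0 * Num.sqrt #|V l0|%:R by rewrite mulr_ge0 ?sqrtr_ge0.
  by rewrite expr2; apply: ler_pM.
apply: le_trans (cabs_sum _ _ _) _.
apply: (@le_trans _ _ (\sum_(l < L.+1) \sum_(l' < L.+1) 16 * (eta * n.+1%:R) * (r * X) ^+ 2)).
  apply: ler_sum => l _; apply: le_trans (cabs_sum _ _ _) _; apply: ler_sum => l' _.
  exact: hblock.
move: (16 * (eta * n.+1%:R)) => c; move: (r * X) => d; move: L.+1 => L'.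
rewrite sumr_const card_ord sumr_const card_ord -mulrnA -[leLHS]mulr_natl natrM.
by rewrite -expr2 [leLHS]mulrCA exprMn.
Qed.

End Blocks.

(** * From sums over pairs of chirp rates to the isometry property *)

Section Isometry.
Variables (R : realType) (p : nat) (A B : {set 'F_p}) (eps1 : R).
Hypotheses (pr_p : prime p) (p4 : (4 < p)%N).
Local Notation P := (p%:R : R).
Local Notation q a := (P `^ a).
Local Notation N := #|setX A B|.
Local Notation cp := (@col_pair p A B).
Hypothesis pairs_le : forall O1 O2 : 'F_p -> {set 'F_p},
  (forall a, a \notin A -> O1 a = set0) -> (forall a, a \notin A -> O2 a = set0) ->
  (forall a, O1 a \subset B) -> (forall a, O2 a \subset B) ->
  (\sum_a #|O1 a|)%:R <= q (1 / 2) -> (\sum_a #|O2 a|)%:R <= q (1 / 2) ->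
  \sum_a1 \sum_(a2 | a2 != a1) pair_abs R O1 O2 a1 a2 <= q (1 - eps1).

Let P1 : 1 < P. Proof. by rewrite ltr1n prime_gt1. Qed.

Definition col_gram (j j' : 'I_N) : R[i] := gram_off R (cp j) (cp j').

(** Geometric mean of two bounds: p^(1/2 - eps1) from the sum over pairs, and p^(-1/2) |S| |T| from
    the size of the Gram entries. This produces the square roots of the cardinalities. *)
Lemma flat_gram k (S T : {set 'I_N}) : k%:R <= q (1 / 2) ->
  (#|S| <= k)%N -> (#|T| <= k)%N ->
  cabs (bil col_gram S T) <= q (- (eps1 / 2)) * Num.sqrt #|S|%:R * Num.sqrt #|T|%:R.
Proof.
move=> hk hS hT; set c := cabs _.
have inj : injective cp by exact: enum_val_inj.
have supp (U : {set 'I_N}) : [/\ forall a, a \notin A -> slice (cp @: U) a = set0,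
    forall a, slice (cp @: U) a \subset B & #|cp @: U| = #|U|].
  have h a b : (a, b) \in cp @: U -> (a \in A) && (b \in B).
    by case/imsetP => j _ e; rewrite -in_setX e; exact: enum_valP.
  split=> [a aA|a|]; last by rewrite card_imset.
    by apply/setP => b; rewrite !inE; apply: contraNF aA => /h/andP[].
  by apply/subsetP => b; rewrite inE => /h/andP[].
have [s1 s2 s3] := supp S; have [t1 t2 t3] := supp T.
have cE : c = cabs (\sum_(u in cp @: S) \sum_(v in cp @: T) gram_off R u v).
  rewrite big_imset /=; last by move=> ? ? _ _; exact: inj.
  congr cabs; apply: eq_bigr => j _.
  by rewrite big_imset //= => ? ? _ _; exact: inj.
have c0 : 0 <= c by exact: cabs_ge0.
have b1 : c <= q (- (1 / 2)) * q (1 - eps1).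
  rewrite cE; apply: le_trans (gram_off_sum_le _ pr_p p4 _ _) _.
  apply: ler_wpM2l; first exact: powR_ge0.
  by apply: pairs_le => //; rewrite card_slice ?s3 ?t3; apply: le_trans hk; rewrite ler_nat.
have b2 : c <= q (- (1 / 2)) * (#|S|%:R * #|T|%:R).
  apply: le_trans (cabs_sum _ _ _) _.
  apply: (@le_trans _ _ (\sum_(i in S) \sum_(j in T) q (- (1 / 2)))).
    apply: ler_sum => i _; apply: le_trans (cabs_sum _ _ _) _; apply: ler_sum => j _.
    exact: cabs_gram_off_le.
  by rewrite !sumr_const -mulrnA -[leLHS]mulr_natr natrM mulrC [_ * #|T|%:R]mulrC mulrC.
rewrite -(ler_pXn2r (isT : (0 < 2)%N)) ?nnegrE ?mulr_ge0 ?powR_ge0 ?sqrtr_ge0 //.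
rewrite !exprMn !sqr_sqrtr // expr2.
apply: (@le_trans _ _ ((q (- (1 / 2)) * q (1 - eps1)) * (q (- (1 / 2)) * (#|S|%:R * #|T|%:R)))).
  by apply: ler_pM.
rewrite !mulrA powX // !powD //.
by have -> : - (1 / 2) + (1 - eps1) + - (1 / 2) = - (eps1 / 2) * 2%:R by lra.
Qed.

Lemma RIP_chirp (K delta r : R) (n L k : nat) :
  k%:R <= q (1 / 2) -> 1 <= r -> K <= (n.+1 * k)%:R -> Num.sqrt K <= r ^+ L ->
  16 * (q (- (eps1 / 2)) * n.+1%:R) * (L.+1%:R * r) ^+ 2 <= delta ->
  RIP K delta (chirp_matrix R A B).
Proof.
move=> hk r1 hK hL hd x; rewrite /sparse => sx.
set E := l2norm (chirp_matrix R A B *m x) ^+ 2; set X := l2norm x.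
have X0 : 0 <= X by exact: sqrtr_ge0.
have hE : cabs (\sum_i \sum_j x i ord0 * conjc (x j ord0) * col_gram i j) <= delta * X ^+ 2.
  have := @flat_quadratic R _ col_gram (q (- (eps1 / 2))) k (powR_ge0 _ _)
    (fun S T hS hT => flat_gram hk hS hT) (fun i => x i ord0) X r n L X0 r1.
  rewrite l2normE => /(_ (lexx _)) h; apply: le_trans (h _ _) _.
  - by rewrite -(ler_nat R); apply: le_trans hK.
  - by apply: le_trans hL; exact: ler_wsqrtr.
  have -> : L.+1%:R * (r * X) = L.+1%:R * r * X by rewrite mulrA.
  by rewrite [(_ * X) ^+ 2]exprMn [leLHS]mulrA -l2normE; apply: ler_wpM2r; rewrite ?exprn_ge0.
have eE : \sum_i \sum_j x i ord0 * conjc (x j ord0) * col_gram i j =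
    real_complex R (E - X ^+ 2).
  by rewrite rmorphB /= /E (chirp_gram pr_p) addrC addKr.
move: hE; rewrite eE cabsR ler_norml; move: (X ^+ 2) => Y /andP[h1 h2].
by split; lra.
Qed.

End Isometry.

(** * Choice of exponents for large p *)

Section Asymptotics.
Variable R : realType.

Lemma eventually_le_pow (c e : R) : 0 < e ->
  exists P : nat, forall p : nat, (P <= p)%N -> c <= p%:R `^ e.
Proof.
move=> e0; pose t : R := (`|c| + 1) `^ (e^-1).
have t0 : 0 <= t by exact: powR_ge0.
have /andP[_ ht] := truncn_itv t0.
exists (Num.truncn t).+1 => p hp.
apply: (@le_trans _ _ (t `^ e)).
  rewrite -powRrM mulVf ?gt_eqF // powRr1 ?addr_ge0 //.
  by have := ler_norm c; lra.
apply: ge0_ler_powR; rewrite ?nnegrE ?ler0n //; first exact: ltW.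
by apply: ltW; apply: lt_le_trans ht _; rewrite ler_nat.
Qed.

Lemma RIP_eventually (A B : forall p : nat, {set 'F_p}) (eps1 : R) : 0 < eps1 ->
  (exists P : nat, forall p : nat, (P <= p)%N -> prime p ->
    forall O1 O2 : 'F_p -> {set 'F_p},
    (forall a, a \notin A p -> O1 a = set0) -> (forall a, a \notin A p -> O2 a = set0) ->
    (forall a, O1 a \subset B p) -> (forall a, O2 a \subset B p) ->
    (\sum_a #|O1 a|)%:R <= p%:R `^ (1 / 2) :> R -> (\sum_a #|O2 a|)%:R <= p%:R `^ (1 / 2) :> R ->
    \sum_a1 \sum_(a2 | a2 != a1) pair_abs R O1 O2 a1 a2 <= p%:R `^ (1 - eps1)) ->
  forall eps'' delta : R, 0 < eps'' -> 0 < delta ->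
  exists P : nat, forall p : nat, (P <= p)%N -> prime p ->
    RIP (p%:R `^ (1 / 2 + eps1 / 2 - eps'')) delta (chirp_matrix R (A p) (B p)).
Proof.
move=> e10 [P1 hP1] e d e0 d0.
(* With ratio p^(kap / 4) and about p^(eps1 / 2 - kap) blocks, the flat gain p^(-eps1 / 2) leaves
   p^(-kap / 2), which beats every constant. *)
pose kap := Num.min (eps1 / 2) e.
have [kap1 kap2] : kap <= eps1 / 2 /\ kap <= e by rewrite !ge_min !lexx orbT.
have kap0 : 0 < kap by rewrite lt_min e0 andbT; lra.
pose w := 1 / 2 + eps1 / 2 - e.
(* Independent of p: L steps of ratio p^(kap / 4) reach p^(w / 2), the square root of the
   sparsity. *)
pose L := (Num.truncn (2 * `|w| / kap)).+1.
have wL : w / 2 <= kap / 4 * L%:R.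
  have h0 : 0 <= 2 * `|w| / kap by rewrite divr_ge0 ?mulr_ge0 // ltW.
  have /andP[_] := truncn_itv h0; rewrite -/L ltr_pdivrMr //.
  by move: (ler_norm w) (L%:R : R) => h u; lra.
have k20 : 0 < kap / 2 by lra.
(* Here 48 = 16 * 3: the constant of [flat_quadratic] and n + 1 <= 3 p^g. *)
have [P2 hP2] := eventually_le_pow (48 * L.+1%:R ^+ 2 / d) k20.
exists (maxn P1 (maxn P2 5)) => p; rewrite !geq_max => /and3P[hp1 hp2 p4] pr_p.
have p1 : 1 < p%:R :> R by rewrite ltr1n prime_gt1.
have p0 : 0 < p%:R :> R by rewrite ltr0n prime_gt0.
pose k := Num.truncn ((p%:R : R) `^ (1 / 2)).
have /andP[k1 k2] := truncn_itv (powR_ge0 (p%:R : R) (1 / 2)).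
have k3 : (p%:R : R) `^ (1 / 2) <= 2 * k%:R.
  have k1' : (1 : R) <= k%:R.
    have : (0 < k)%N; last by rewrite -(ler1n R).
    by rewrite truncn_gt0 pow_ge1 //; lra.
  by move: k2; rewrite -/k -addn1 natrD; lra.
pose g := eps1 / 2 - kap.
have g0 : 0 <= g by rewrite /g; lra.
pose n := Num.truncn (2 * (p%:R : R) `^ g).
have G1 : 1 <= (p%:R : R) `^ g by exact: pow_ge1.
have /andP[n1 n2] : n%:R <= 2 * (p%:R : R) `^ g < n.+1%:R.
  by apply: truncn_itv; rewrite mulr_ge0 // powR_ge0.
apply: (@RIP_chirp R p (A p) (B p) eps1 pr_p p4 _ _ d (p%:R `^ (kap / 4)) n L k k1).
- exact: hP1.
- by apply: pow_ge1 => //; lra.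
- rewrite natrM; apply: (@le_trans _ _ ((p%:R `^ g) * p%:R `^ (1 / 2))).
    by rewrite powD // pow_le // /g; lra.
  apply: (@le_trans _ _ (p%:R `^ g * (2 * k%:R))); first by rewrite ler_wpM2l ?powR_ge0.
  by rewrite mulrA [_ * 2]mulrC ler_wpM2r // ltW.
- rewrite pow_sqrt // powX //; exact: pow_le.
have h3 : (n.+1)%:R <= 3 * (p%:R : R) `^ g by rewrite -addn1 natrD; lra.
apply: (@le_trans _ _ (16 * (p%:R `^ (- (eps1 / 2)) * (3 * p%:R `^ g)) * (L.+1%:R * p%:R `^ (kap / 4)) ^+ 2)).
  by apply: ler_wpM2r; rewrite ?exprn_ge0 ?mulr_ge0 ?powR_ge0 // ler_wpM2l // ler_wpM2l ?powR_ge0.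
have := hP2 p hp2; rewrite ler_pdivrMr // => hh.
have -> : 16 * (p%:R `^ (- (eps1 / 2)) * (3 * p%:R `^ g)) * (L.+1%:R * p%:R `^ (kap / 4)) ^+ 2 =
   (48 * L.+1%:R ^+ 2) * (p%:R `^ (- (eps1 / 2)) * p%:R `^ g * p%:R `^ (kap / 4) ^+ 2) :> R.
  move: (p%:R `^ g : R) (p%:R `^ (- (eps1 / 2)) : R) (p%:R `^ (kap / 4) : R) (L.+1%:R : R) => u v s t.
  by ring.
rewrite powX // !powD //.
have -> : - (eps1 / 2) + g + kap / 4 * 2%:R = - (kap / 2) by rewrite /g; lra.
apply: (le_trans (ler_wpM2r (powR_ge0 _ _) hh)).
by rewrite mulrAC powD // subrr powRr0 mul1r.
Qed.

(** With c0 / 8 = 1 / 83440, the strict bound on eps1 + eps by the c0 term, multiplied by M, gives M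
    (eps1 + eps) <= M y / 80000. It also keeps 9 alpha2 / 8, hence 81 x / 8, below M y / 83440, so
    that 5 x <= M y / 168000. The factor 5 answers the remainder: the parameters force 2 alpha < x -
    8 (eps1 + eps), so 5 x / 4 exceeds 2 alpha + eps1 + eps. *)
Lemma exponents_fit (M l gamma alpha eps1 alpha1 alpha2 eps x y : R) :
  0 < M -> 0 < eps1 -> [/\ 0 < alpha1, 0 < alpha2, 0 < eps, 0 < x & 0 < y] ->
  eps1 + eps < alpha1 - alpha - (4 / 3) * x - eps ->
  l <= 1 / 2 + (4 / 3) * x - alpha1 + eps / 2 ->
  eps1 + eps < gamma / 4 - y / 4 - eps ->
  9 * x + eps <= alpha2 ->
  (1 / 10430) * y / 8 - (alpha1 / 4 + 9 * alpha2 / 8) / M <= x / 8 - alpha / 4 ->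
  eps1 + eps < (1 / 10430) * y / 8 - (alpha1 / 4 + 9 * alpha2 / 8) / M ->
  M * y <= 1 / 2 - alpha1 ->
  [/\ M * y <= 1 / 2, M * (eps1 + eps) <= M * y / 800 / 100 & 5 * x <= M * y / 1600 / 105] /\
  [/\ 2 * alpha + 1 - 5 * x / 4 <= 1 - (eps1 + eps),
    1 + (y - gamma + eps) / 4 <= 1 - (eps1 + eps) &
    alpha + l + 1 / 2 <= 1 - (eps1 + eps)].
Proof.
move=> M0 e10 [a10 a20 ep0 x0 y0] c1 c2 c3 c4 c5 c6 c7.
have ax := lt_le_trans c6 c5; have c6' : M * (eps1 + eps) <
    (1 / 10430) * (M * y) / 8 - (alpha1 / 4 + 9 * alpha2 / 8).
  rewrite -(ltr_pM2l M0) in c6; apply: lt_le_trans c6 _.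
  rewrite mulrBr [_ * (_ / M)]mulrC divfK ?gt_eqF // lerD2r.
  by rewrite le_eqVlt; apply/orP; left; apply/eqP; field.
have s0 : 0 <= M * (eps1 + eps) by rewrite mulr_ge0 // ltW // addr_gt0.
have z0 : 0 < M * y by rewrite mulr_gt0.
clear c5 c6; split; split; last by lra.
- by clear - c7 a10; lra.
- by clear - c6' a10 a20 z0; move: (M * (eps1 + eps)) (M * y) c6' z0 => u v h z0; lra.
- by clear - c6' s0 z0 c4 ep0 a10; move: (M * (eps1 + eps)) (M * y) z0 s0 c6' => u v z0 s0 h; lra.
- by clear - ax e10 ep0 x0; lra.
- by clear - c3 e10 ep0 x0; lra.
Qed.

Lemma pairs_eventually (A B : forall p : nat, {set 'F_p}) (m : nat) (l gamma alpha eps1 : R) :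
  (0 < m)%N -> ~~ odd m ->
  (exists P : nat, forall p : nat, (P <= p)%N -> prime p ->
      forall a : 'F_p, a \in A p ->
      forall s t : m.-tuple 'F_p,
        {subset s <= A p :\ a} -> {subset t <= A p :\ a} ->
        \sum_(j < m) 1 / (a - tnth s j) = \sum_(j < m) 1 / (a - tnth t j) ->
        perm_eq s t) ->
  (forall eta : R, 0 < eta ->
      exists P : nat, forall p : nat, (P <= p)%N -> prime p ->
      forall S : {set 'F_p}, S \subset B p -> p%:R `^ l <= #|S|%:R ->
        (additive_energy S S)%:R <= p%:R `^ (- gamma + eta) * #|S|%:R ^+ 3) ->
  (exists P : nat, forall p : nat, (P <= p)%N -> prime p -> #|A p|%:R <= p%:R `^ alpha) ->
  0 < eps1 -> forall alpha1 alpha2 eps x y : R,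
      [/\ 0 < alpha1, 0 < alpha2, 0 < eps, 0 < x & 0 < y] ->
      eps1 + eps < alpha1 - alpha - (4 / 3) * x - eps ->
      l <= 1 / 2 + (4 / 3) * x - alpha1 + eps / 2 ->
      eps1 + eps < gamma / 4 - y / 4 - eps ->
      9 * x + eps <= alpha2 ->
      (1 / 10430) * y / 8 - (alpha1 / 4 + 9 * alpha2 / 8) / m%:R <= x / 8 - alpha / 4 ->
      eps1 + eps < (1 / 10430) * y / 8 - (alpha1 / 4 + 9 * alpha2 / 8) / m%:R ->
      m%:R * y <= 1 / 2 - alpha1 ->
  exists P : nat, forall p : nat, (P <= p)%N -> prime p ->
    forall O1 O2 : 'F_p -> {set 'F_p},
    (forall a, a \notin A p -> O1 a = set0) -> (forall a, a \notin A p -> O2 a = set0) ->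
    (forall a, O1 a \subset B p) -> (forall a, O2 a \subset B p) ->
    (\sum_a #|O1 a|)%:R <= p%:R `^ (1 / 2) :> R -> (\sum_a #|O2 a|)%:R <= p%:R `^ (1 / 2) :> R ->
    \sum_a1 \sum_(a2 | a2 != a1) pair_abs R O1 O2 a1 a2 <= p%:R `^ (1 - eps1).
Proof.
move=> m0 m_even hA hB hcard e10 alpha1 alpha2 eps x y.
case=> a10 a20 ep0 x0 y0 c1 c2 c3 c4 c5 c6 c7.
have M0 : 0 < m%:R :> R by rewrite ltr0n.
have [k emk] : exists k, m = (k + k)%N by exists m./2; rewrite addnn even_halfK.
subst m; have k0 : (0 < k)%N by case: (k) m0.
have [PA {}hA] := hA.
have [PB {}hB] := hB _ ep0.
have [PC hC] := hcard.
pose z := (k + k)%:R * y.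
have s0 : 0 <= (k + k)%:R * (eps1 + eps) by rewrite mulr_ge0 // ltW // addr_gt0.
have z0 : 0 < z by rewrite mulr_gt0.
have x50 : 0 < 5 * x by rewrite mulr_gt0.
have pos := And5 a10 a20 ep0 x0 y0.
have [[z1 s1 x51] [f1 f2 f3]] := exponents_fit M0 e10 pos c1 c2 c3 c4 c5 c6 c7.
clear c1 c2 c3 c4 c5 c6 c7.
have zn (i : nat) : (0 < i)%N -> 0 < z / i%:R / i%:R.
  by move=> i0; rewrite !divr_gt0 ?ltr0n.
have z2 : 0 < z / 100 / 100 by apply: zn.
have z3 : 0 < z / 1000 / 1000 by apply: zn.
have [P1 h1] := eventually_le_pow (2 ^+ 60) z2.
have [P2 h2] := eventually_le_pow ((k + k)`!%:R) z2.
have [P3 h3] := eventually_le_pow (2 ^+ 32) z3.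
(* The bound of [total_bound] has 2 * 2 + 1 + 2 = 7 powers, each at most p^(1 - eps1 - eps); taking
   sigma = eps1 + eps leaves p^eps for the count. *)
have [P4 h4] := eventually_le_pow 7 ep0.
exists (\max_(i <- [:: PA; PB; PC; P1; P2; P3; P4; 5%N]) i) => p.
rewrite !big_cons big_nil !geq_max => /and5P[pA pB pC p1 /and5P[p2 p3 p4 p5 _]] pr_p.
move=> O1 O2 sO1 sO2 sB1 sB2 n1 n2.
have := @total_bound R p pr_p p5 (A p) (B p) k k0 (hA p pA pr_p) y z (eps1 + eps) alpha (5 * x)
  z0 z1 erefl s0 s1 x50 x51 (h1 p p1) (h2 p p2) (h3 p p3) (hC p pC pr_p) l gamma eps
  (hB p pB pr_p) O1 O2 sO1 sO2 sB1 sB2 n1 n2.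
move=> h; apply: le_trans h _.
have q1 : 1 < p%:R :> R by rewrite ltr1n prime_gt1.
move: (pow_le q1 f1) (pow_le q1 f2) (pow_le q1 f3) (h4 p p4) => {f1 f2 f3} f1 f2 f3 f4.
have -> : 1 - eps1 = eps + (1 - (eps1 + eps)) by ring.
rewrite -(powD q1 eps).
have q0 : 0 <= p%:R `^ (1 - (eps1 + eps)) :> R by exact: powR_ge0.
have := ler_wpM2r q0 f4; clear - f1 f2 f3; lra.
Qed.

End Asymptotics.

(** * A single sparsity level for each prime *)

Section Witness.
Variable R : realType.

Lemma RIP0 (M N : nat) (delta : R) (Phi : 'M[R[i]]_(M, N)) : RIP 0 delta Phi.
Proof.
move=> x; rewrite /sparse lern0 cards_eq0 => /eqP hx.
have -> : x = 0.
  apply/matrixP => i j; rewrite (ord1 j) mxE; apply/eqP/negbNE.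
  by have /setP/(_ i) := hx; rewrite !inE => ->.
have l0 n : l2norm (0 : 'cV[R[i]]_n) ^+ 2 = 0.
  by rewrite l2normE big1 // => i _; rewrite mxE cabs0 expr0n.
by rewrite mulmx0 !l0 !mulr0.
Qed.

Lemma RIP_le (M N : nat) (K K' delta : R) (Phi : 'M[R[i]]_(M, N)) :
  K' <= K -> RIP K delta Phi -> RIP K' delta Phi.
Proof. by move=> hK h x sx; apply: h; exact: le_trans hK. Qed.

(** For given delta, K must be fixed before eps and be valid for every prime. The largest integer up
    to b with the property does both: it exists because level 0 always qualifies, and it dominates
    each level proved later for a particular eps. *)
Lemma exists_max_RIP (M N : nat) (b delta : R) (Phi : 'M[R[i]]_(M, N)) : 0 <= b ->
  exists K : R, RIP K delta Phi /\
    forall j : nat, j%:R <= b -> RIP j%:R delta Phi -> j%:R <= K.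
Proof.
move=> b0; pose Q j := `[< RIP j%:R delta Phi >] && ((j%:R : R) <= b).
have ex : exists j, Q j by exists 0%N; rewrite /Q b0 andbT; apply/asboolP/RIP0.
have ub j : Q j -> (j <= Num.truncn b)%N.
  by case/andP => _ h; rewrite truncn_ge_nat.
case: (ex_maxnP ex ub) => K /andP[/asboolP hK _] max.
exists K%:R; split=> // j jb hj; rewrite ler_nat; apply: max.
by rewrite /Q jb andbT; apply/asboolP.
Qed.

Lemma chirp_witnesses (A B : forall p : nat, {set 'F_p}) (alpha z : R) : 0 < z ->
  (exists eps' : R, 0 < eps' /\
      exists c : R, 0 < c /\
      exists P : nat, forall p : nat, (P <= p)%N -> prime p ->
        [/\ c * p%:R `^ alpha <= #|A p|%:R,
            #|A p|%:R <= p%:R `^ alpha &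
            c * p%:R `^ (1 - alpha + eps') <= #|B p|%:R]) ->
  (forall eps delta : R, 0 < eps -> 0 < delta ->
    exists P : nat, forall p : nat, (P <= p)%N -> prime p ->
      RIP (p%:R `^ (z - eps)) delta (chirp_matrix R (A p) (B p))) ->
  witnesses_ExRIP z
    (fun p : {p : nat | prime p} => chirp_matrix R (A (sval p)) (B (sval p))).
Proof.
move=> z0 [e [e0 [c [c0 [P1 hP1]]]]] hrip; split=> [rho M0|d d0 _].
  (* The aspect ratio |A| |B| / p is at least c^2 p^e, as alpha cancels. *)
  have [P2 hP2] := eventually_le_pow (rho / c ^+ 2) e0.
  have [p] := prime_above (maxn M0 (maxn P1 P2)).
  move=> /ltnW; rewrite !geq_max => /and3P[pM p1 p2] pr_p.
  exists (exist _ p pr_p); split=> //=.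
  have q1 : 1 < p%:R :> R by rewrite ltr1n prime_gt1.
  have q0 : 0 < p%:R :> R by rewrite ltr0n prime_gt0.
  rewrite cardsX natrM ler_pdivlMr //.
  have [hA _ hB] := hP1 p p1 pr_p; have := hP2 p p2.
  rewrite ler_pdivrMr ?exprn_gt0 // => hrho.
  apply: le_trans (ler_pM _ _ hA hB); rewrite ?mulr_ge0 ?powR_ge0 ?(ltW c0) //.
  have -> : c * p%:R `^ alpha * (c * p%:R `^ (1 - alpha + e)) =
      p%:R `^ e * c ^+ 2 * p%:R.
    rewrite mulrACA powD // addrA addrCA subrr addr0 addrC -powD // pow1 //; ring.
  by apply: ler_wpM2r => //; exact: ltW.
have [K hK] := boolp.choice (fun p : {p : nat | prime p} => exists_max_RIP d
  (chirp_matrix R (A (sval p)) (B (sval p))) (powR_ge0 (sval p)%:R z)).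
exists K; split=> [eps eps0|p]; last by have [] := hK p.
(* The factor 1/2 pays for rounding down to an integer that is at least 1. *)
exists (1 / 2); split; first by lra.
(* Capping eps at z keeps the exponent z - e' nonnegative, so the rounded level is at least 1. *)
pose e' := Num.min eps z.
have [e'0 e'1 e'2] : [/\ 0 < e', e' <= eps & e' <= z].
  by rewrite lt_min eps0 z0 !ge_min !lexx orbT.
have [P hP] := hrip e' d e'0 d0.
exists P => -[p pr_p] /= pP; have [_ /= hmax] := hK (exist _ p pr_p).
have q1 : 1 < p%:R :> R by rewrite ltr1n prime_gt1.
pose j := Num.truncn ((p%:R : R) `^ (z - e')).
have /andP[j1 j2] := truncn_itv (powR_ge0 (p%:R : R) (z - e')).
have j3 : (1 : R) <= j%:R.
  have : (0 < j)%N; last by rewrite -(ler1n R).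
  by rewrite truncn_gt0 pow_ge1 //; lra.
have hj : j%:R <= K (exist _ p pr_p).
  apply: hmax; first by apply: le_trans j1 _; apply: pow_le => //; lra.
  exact: RIP_le j1 (hP p pP pr_p).
have h1 : (p%:R : R) `^ (z - eps) <= p%:R `^ (z - e') by apply: pow_le => //; lra.
by move: j2; rewrite -/j -addn1 natrD; lra.
Qed.

End Witness.

Theorem theorem2 (R : realType) (A B : forall p : nat, {set 'F_p})
    (m : nat) (l gamma : R)
    (m_gt0 : (0 < m)%N) (m_even : ~~ odd m) (l_gt0 : 0 < l)
    (gamma_gt0 : 0 < gamma)
    (hypA : exists P : nat, forall p : nat, (P <= p)%N -> prime p ->
      forall a : 'F_p, a \in A p ->
      forall s t : m.-tuple 'F_p,
        {subset s <= A p :\ a} -> {subset t <= A p :\ a} ->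
        \sum_(j < m) 1 / (a - tnth s j) = \sum_(j < m) 1 / (a - tnth t j) ->
        perm_eq s t)
    (hypB : forall eta : R, 0 < eta ->
      exists P : nat, forall p : nat, (P <= p)%N -> prime p ->
      forall S : {set 'F_p}, S \subset B p -> p%:R `^ l <= #|S|%:R ->
        (additive_energy S S)%:R <= p%:R `^ (- gamma + eta) * #|S|%:R ^+ 3)
    (alpha : R)
    (hyp_card : exists eps' : R, 0 < eps' /\
      exists c : R, 0 < c /\
      exists P : nat, forall p : nat, (P <= p)%N -> prime p ->
        [/\ c * p%:R `^ alpha <= #|A p|%:R,
            #|A p|%:R <= p%:R `^ alpha &
            c * p%:R `^ (1 - alpha + eps') <= #|B p|%:R])
    (c0 : R) (c0_def : c0 = 1 / 10430)
    (eps1 : R) (eps1_gt0 : 0 < eps1)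
    (hyp_params : exists alpha1 alpha2 eps x y : R,
      [/\ 0 < alpha1, 0 < alpha2, 0 < eps, 0 < x & 0 < y] /\
      eps1 + eps < alpha1 - alpha - (4 / 3) * x - eps /\
      l <= 1 / 2 + (4 / 3) * x - alpha1 + eps / 2 /\
      eps1 + eps < gamma / 4 - y / 4 - eps /\
      alpha2 >= 9 * x + eps /\
      c0 * y / 8 - (alpha1 / 4 + 9 * alpha2 / 8) / m%:R <= x / 8 - alpha / 4 /\
      eps1 + eps < c0 * y / 8 - (alpha1 / 4 + 9 * alpha2 / 8) / m%:R /\
      m%:R * y <= Num.min (1 / 2 - alpha1) (1 / 2 - alpha2) /\
      3 * alpha2 - 2 * alpha1 <= (2 - c0) * m%:R * y) :
  (forall eps'' delta : R, 0 < eps'' -> 0 < delta -> delta < Num.sqrt 2 - 1 ->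
    exists P : nat, forall p : nat, (P <= p)%N -> prime p ->
      RIP (p%:R `^ (1 / 2 + eps1 / 2 - eps'')) delta
          (chirp_matrix R (A p) (B p))) /\
  witnesses_ExRIP (1 / 2 + eps1 / 2)
    (fun p : {p : nat | prime p} => chirp_matrix R (A (sval p)) (B (sval p))).
Proof.
have pairs : exists P : nat, forall p : nat, (P <= p)%N -> prime p ->
    forall O1 O2 : 'F_p -> {set 'F_p},
    (forall a, a \notin A p -> O1 a = finset.set0) ->
    (forall a, a \notin A p -> O2 a = finset.set0) ->
    (forall a, O1 a \subset B p) -> (forall a, O2 a \subset B p) ->
    (\sum_a #|O1 a|)%:R <= p%:R `^ (1 / 2) :> R ->
    (\sum_a #|O2 a|)%:R <= p%:R `^ (1 / 2) :> R ->
    \sum_a1 \sum_(a2 | a2 != a1) pair_abs R O1 O2 a1 a2 <= p%:R `^ (1 - eps1).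
  have [a1 [a2 [e [x [y [pos [h1 [h2 [h3 [h4 [h5 [h6 [h7 _]]]]]]]]]]]]] := hyp_params.
  apply: (pairs_eventually m_gt0 m_even hypA hypB _ eps1_gt0 pos h1 h2 h3 h4).
  - have [e' [_ [c [_ [P hP]]]]] := hyp_card; exists P => p pP pr_p.
    by have [] := hP p pP pr_p.
  - by rewrite -c0_def.
  - by rewrite -c0_def.
  - by apply: le_trans h7 _; rewrite ge_min lexx.
have rip := RIP_eventually eps1_gt0 pairs.
split=> [e d e0 d0 _|]; first exact: rip.
apply: (chirp_witnesses _ hyp_card rip).
by rewrite addr_gt0 // divr_gt0.
Qed.
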